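(* Let $M_N=\lfloor \log\log N\rfloor$ for integers $N\ge 3$. Then, as $N\to\infty$, $$\operatorname{Var}\big(F_N(1)\big)\geq \frac12\sum_{k=3}^{M_N}\frac1k - o(1),$$ that is, there is a sequence of real numbers $\epsilon_N\to 0$ such that $\operatorname{Var}(F_N(1))\ge \frac12\sum_{k=3}^{M_N}\frac1k-\epsilon_N$ for every $N\ge 3$ (the sum being $0$ if $M_N<3$). In particular, there exists a constant $C>0$, independent of $N$, such that for every integer $N\geq 3$, $$\operatorname{Var}\big(F_N(1)\big)\geq \frac12\log\log\log N - C.$$ Here $F_N(1)$ is the free energy of the Sherrington--Kirkpatrick model on $N$ spins (zero external field) at inverse temperature $\beta=1$.
   Context: For an integer $N\ge 1$, let $(g_{ij})_{1\le i<j\le N}$ be independent centered real Gaussian random variables of variance $1/N$; probability, expectation $\mathbb E$ and variance $\operatorname{Var}$ are with respect to these variables. For $\sigma=(\sigma_1,\ldots,\sigma_N)\in\{-1,1\}^N$ define the Sherrington--Kirkpatrick Hamiltonian $H_N(\sigma)=\sum_{1\le i<j\le N} g_{ij}\sigma_i\sigma_j$. For $\beta\ge 0$ the partition function and free energy are $$Z_N(\beta)=\frac1{2^N}\sum_{\sigma\in\{-1,1\}^N}e^{\beta H_N(\sigma)},\qquad F_N(\beta)=\log Z_N(\beta).$$ *)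

(* Defs.v *)
From HB Require Import structures.
From mathcomp Require Import all_boot all_order all_algebra.
From mathcomp Require Import all_classical all_reals all_analysis.

Set Implicit Arguments.
Unset Strict Implicit.
Unset Printing Implicit Defensive.

Import Order.TTheory GRing.Theory Num.Theory.
Import numFieldNormedType.Exports.

Local Open Scope classical_set_scope.
Local Open Scope ring_scope.

Section independence.
Context d (T : measurableType d) (R : realType) (P : probability T R).

Definition mutually_independent (I : finType) (D : {set I})
    (X : I -> {RV P >-> R}) : Prop :=
  forall (J : {set I}) (A : I -> set R),
    J \subset D -> (forall i, i \in J -> measurable (A i)) ->
    P (\bigcap_(i in [set` J]) (X i @^-1` A i)) =
    (\big[*%E/1%E]_(i in J) P (X i @^-1` A i))%E.

(* Only the entries g i j with i < j are constrained (and used below). The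
   second parameter of normal_prob is the standard deviation. *)
Definition sk_disorder (N : nat) (g : 'I_N -> 'I_N -> {RV P >-> R}) : Prop :=
  (forall i j : 'I_N, (i < j)%N -> forall A : set R, measurable A ->
     distribution P (g i j) A = normal_prob 0 (Num.sqrt (N%:R^-1)) A) /\
  mutually_independent [set p : 'I_N * 'I_N | (p.1 < p.2)%N]%SET
    (fun p => g p.1 p.2).

End independence.

Section sherrington_kirkpatrick.
Context (R : realType) (N : nat).

(* A configuration in {-1, 1}^N is coded by booleans, true standing for -1. *)
Definition spin (s : {ffun 'I_N -> bool}) (i : 'I_N) : R := (-1) ^+ s i.

(* The functions below are evaluated at a realisation g of the disorder. *)
Definition sk_hamiltonian (g : 'I_N -> 'I_N -> R) (s : {ffun 'I_N -> bool}) : R :=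
  \sum_(i < N) \sum_(j < N | (i < j)%N) g i j * spin s i * spin s j.

Definition sk_partition (g : 'I_N -> 'I_N -> R) (beta : R) : R :=
  (2 ^+ N)^-1 *
  \sum_(s : {ffun 'I_N -> bool}) expR (beta * sk_hamiltonian g s).

Definition sk_free_energy (g : 'I_N -> 'I_N -> R) (beta : R) : R :=
  ln (sk_partition g beta).

End sherrington_kirkpatrick.

(* For N >= 3 one has ln (ln N) > 0, so the truncation is the floor. *)
Definition loglog_floor (R : realType) (N : nat) : nat :=
  Num.truncn (ln (ln (N%:R : R))).

(* Main.v *)
Require Import Defs.
From HB Require Import structures.
From mathcomp Require Import all_boot all_order all_algebra.
From mathcomp Require Import all_classical all_reals all_analysis.
From mathcomp Require Import measurable_realfun zify ring lra.

(** The free energy F is a function of the independent Gaussian variables g_e,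
    one for each edge e of the complete graph on the N vertices. Its variance is
    bounded from below by testing F against one function psi with mean zero, as
    Var F >= 2 E[F psi] - E[psi^2] (variance_test_function). The function psi is
    a combination of the products of the g_e along the simple cycles of length
    k = 3, ..., M_N (cycle_test). Distinct cycles give orthogonal products
    (Eg_monomialM), and there are about N^k / (2k) cycles of length k, each
    labelled by 2k injective sequences of vertices (card_same_cycle).

    By Gaussian integration by parts (stein, gaussian_ibp), the correlation of F
    with the product along a cycle C is N^(-k) times the mean of the iterated
    derivative of F along the edges of C (Eg_free_energy_prod). This derivative is
    the joint cumulant, under the Gibbs measure, of the characters
    sigma_i sigma_j of the edges. Its leading term is the Gibbs average of the
    product of all of them, which is 1 because every vertex of a cycle lies on two
    of its edges. If the remaining terms are negligible, the cycles of length k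
    contribute 1 / (2k) to the variance, which is the k-th term of the sum.

    The remaining terms are at most (2k)^k products of Gibbs averages
    (size_remainder), each of them containing a factor which is the average of
    the characters over a proper part of the cycle (remainderP). The square of
    this factor is an average over two replicas. Summed over the positions of the
    cycle, it is bounded by the overlap of the replicas, because some vertex lies
    on exactly one edge of the part (sum_block_prod_le). It is thus enough that
    the mean overlap at inverse temperature 1 be small by a power of N
    (Eg_overlap_sqr_le); here (2k)^k, with k at most log log N, grows more slowly
    than any power of N (sk_error_le).

    The overlap is bounded as follows. The second moment of the partition
    function Z exceeds (E Z)^2 by a factor at most 2 sqrt N (sk_second_moment).
    Together with the variance bound Var F <= N / 2 given by efron_stein, this
    shows that E F is at least log E Z - O(N^(3/4)) (Eg_free_energy_ge), while at
    every inverse temperature it is at most the logarithm of the mean partition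
    function, by Jensen's inequality. As F is convex in the inverse temperature,
    its derivative at 1 is then close to its maximal value N / 2
    (free_energy_tangent), and by integration by parts the difference is the mean
    squared overlap of two replicas times N / 2, up to a bounded term
    (Eg_mean_energy, sum_bracket_sqr_le).

    Integrability is handled uniformly by the class good of functions of at most
    exponential growth, and independence by a single fact: one coordinate may be
    integrated separately, the others being frozen (freezing, ge0_resample). *)

Set Implicit Arguments.
Unset Strict Implicit.
Unset Printing Implicit Defensive.

Import Order.TTheory GRing.Theory Num.Theory.
Import numFieldNormedType.Exports.

Local Open Scope classical_set_scope.
Local Open Scope ring_scope.

(** * Integrals against the normal law *)

Section normal_density_integral.
Context {R : realType}.
Variables (m s : R).
Local Notation mu := (@lebesgue_measure R).
Local Notation gam := (normal_prob m s).

Lemma ge0_integral_normal_prob (f : R -> \bar R) :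
  measurable_fun [set: R] f -> (forall x, 0 <= f x)%E ->
  (\int[gam]_x f x = \int[mu]_x (f x * (normal_pdf m s x)%:E))%E.
Proof.
move=> mf f0.
have dom := normal_prob_dominates m s.
rewrite -(Radon_Nikodym_SigmaFinite.change_of_variables dom)//.
apply: ae_eq_integral => //.
- apply: emeasurable_funM => //; apply: (measurable_int mu).
  exact: Radon_Nikodym_SigmaFinite.f_integrable.
- by apply: emeasurable_funM => //; apply/measurable_EFinP; exact: measurable_normal_pdf.
- apply: ae_eqe_mul2l => /=.
  apply: integral_ae_eq => //=.
  + exact: Radon_Nikodym_SigmaFinite.f_integrable.
  + by apply/measurable_EFinP; exact: measurable_normal_pdf.
  + by move=> E E01 mE; rewrite -Radon_Nikodym_SigmaFinite.f_integral.
Qed.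

Lemma integrable_normal_probP (f : R -> R) : measurable_fun [set: R] f ->
  gam.-integrable setT (EFin \o f) <->
  mu.-integrable setT (fun x => (f x * normal_pdf m s x)%:E).
Proof.
move=> mf.
have mp := measurable_normal_pdf m s.
have E : (\int[gam]_x `|(f x)%:E| = \int[mu]_x `|(f x * normal_pdf m s x)%:E|)%E.
  rewrite ge0_integral_normal_prob//; last first.
    by apply: measurableT_comp => //; exact/measurable_EFinP.
  apply: eq_integral => x _ /=.
  by rewrite -EFinM normrM (ger0_norm (normal_pdf_ge0 _ _ _)).
split => /integrableP[_ h]; apply/integrableP; split => //=.
- by apply/measurable_EFinP; exact: measurable_funM.
- by rewrite -E.
- exact/measurable_EFinP.
- by rewrite E.
Qed.

Lemma integral_normal_prob (f : R -> R) : measurable_fun [set: R] f ->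
  gam.-integrable setT (EFin \o f) ->
  (\int[gam]_x (f x)%:E = \int[mu]_x (f x * normal_pdf m s x)%:E)%E.
Proof.
move=> mf /= fi; have mp := measurable_normal_pdf m s.
rewrite [LHS]integralE [RHS]integralE.
congr (_ - _)%E.
- rewrite ge0_integral_normal_prob//; last first.
    by apply: measurable_funepos; exact/measurable_EFinP.
  apply: eq_integral => x _ /=.
  by rewrite !funeposE -EFin_max -EFinM maxr_pMl ?normal_pdf_ge0// mul0r EFin_max.
- rewrite ge0_integral_normal_prob//; last first.
    by apply: measurable_funeneg; exact/measurable_EFinP.
  apply: eq_integral => x _ /=.
  rewrite !funenegE -!EFinN -!EFin_max -EFinM.
  by rewrite maxr_pMl ?normal_pdf_ge0// mul0r mulNr.
Qed.

End normal_density_integral.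

(** * Exponential growth and Gaussian integration by parts *)

Section exponential_growth.
Context {R : realType} {A : Type}.
Variable n : A -> R.
Hypothesis n0 : forall x, 0 <= n x.

(** The class is stable under sums and products and, when n is the norm of a
    Gaussian vector, its members are integrable: it settles all integrability
    questions below. *)
Definition exp_growth (f : A -> R) :=
  exists K c : R, [/\ 0 <= K, 0 <= c & forall x, `|f x| <= K * expR (c * n x)].

Lemma exp_growth_le (f g : A -> R) :
  (forall x, `|f x| <= `|g x|) -> exp_growth g -> exp_growth f.
Proof.
move=> fg [K [c [K0 c0 gK]]]; exists K, c; split=> // x.
exact: le_trans (fg x) (gK x).
Qed.

Lemma exp_growth_bounded (M : R) (f : A -> R) :
  (forall x, `|f x| <= M) -> exp_growth f.
Proof.
move=> fM; exists `|M|, 0; split => // x.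
by rewrite mul0r expR0 mulr1 (le_trans (fM x)) ?ler_norm.
Qed.

Lemma exp_growth_cst (a : R) : exp_growth (fun=> a).
Proof. exact: (@exp_growth_bounded `|a|). Qed.

Lemma exp_growthM (f g : A -> R) :
  exp_growth f -> exp_growth g -> exp_growth (fun x => f x * g x).
Proof.
move=> [K [c [K0 c0 fK]]] [L [e [L0 e0 gL]]].
exists (K * L), (c + e); split; rewrite ?mulr_ge0 ?addr_ge0// => x.
by rewrite normrM mulrDl expRD mulrACA ler_pM.
Qed.

Lemma exp_growthD (f g : A -> R) :
  exp_growth f -> exp_growth g -> exp_growth (fun x => f x + g x).
Proof.
move=> [K [c [K0 c0 fK]]] [L [e [L0 e0 gL]]].
exists (K + L), (c + e); split; rewrite ?addr_ge0// => x.
rewrite (le_trans (ler_normD _ _))// mulrDl lerD//.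
- rewrite (le_trans (fK x))// ler_wpM2l// ler_expR ler_wpM2r// lerDl//.
- rewrite (le_trans (gL x))// ler_wpM2l// ler_expR ler_wpM2r// lerDr//.
Qed.

Lemma exp_growthN (f : A -> R) : exp_growth f -> exp_growth (fun x => - f x).
Proof. by apply: exp_growth_le => x; rewrite normrN. Qed.

Lemma exp_growthB (f g : A -> R) :
  exp_growth f -> exp_growth g -> exp_growth (fun x => f x - g x).
Proof. by move=> ? ?; apply: exp_growthD => //; exact: exp_growthN. Qed.

Lemma exp_growth_sum (J : Type) (r : seq J) (p : pred J) (F : J -> A -> R) :
  (forall j, exp_growth (F j)) -> exp_growth (fun x => \sum_(j <- r | p j) F j x).
Proof.
move=> FG; elim: r => [|j r IHr].
  by under [X in exp_growth X]eq_fun do rewrite big_nil; exact: exp_growth_cst.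
under [X in exp_growth X]eq_fun do rewrite big_cons.
by case: (p j) => //; exact: exp_growthD.
Qed.

Lemma exp_growth_size (f : A -> R) :
  (forall x, `|f x| <= n x) -> exp_growth f.
Proof.
move=> fn; exists 1, 1; split => // x; rewrite !mul1r (le_trans (fn x))//.
by rewrite (le_trans _ (expR_ge1Dx _))// lerDr.
Qed.

End exponential_growth.

Notation exp_bounded := (exp_growth (@Num.norm _ _)).

Section gauss_moments.
Context {R : realType}.
Variable s : R.
Hypothesis s0 : 0 < s.
Local Notation mu := (@lebesgue_measure R).
Local Notation gam := (normal_prob 0 s).

Let sN0 : s != 0. Proof. by rewrite gt_eqF. Qed.

Lemma gauss_mgf (t : R) :
  (\int[gam]_x (expR (t * x))%:E = (expR (t ^+ 2 * s ^+ 2 / 2))%:E)%E.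
Proof.
rewrite ge0_integral_normal_prob; last 2 first.
- by apply/measurable_EFinP; apply: measurableT_comp => //; exact: measurable_funM.
- by move=> x; rewrite lee_fin expR_ge0.
under eq_integral => x _.
  rewrite -EFinM (_ : expR (t * x) * normal_pdf 0 s x =
     expR (t ^+ 2 * s ^+ 2 / 2) * normal_pdf (t * s ^+ 2) s x); last first.
    rewrite !normal_pdfE//= /normal_fun !(mulrCA _ (normal_peak s)) -!expRD.
    by congr (_ * expR _); field.
  rewrite EFinM. over.
rewrite integralZl//; last exact: integrable_normal_pdf.
by rewrite integral_normal_pdf mule1.
Qed.

Lemma integrable_expR (t : R) :
  gam.-integrable [set: R] (EFin \o (fun x => expR (t * x))).
Proof.
apply/integrableP; split.
  by apply/measurable_EFinP; apply: measurableT_comp => //; exact: measurable_funM.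
under eq_integral => x _ do rewrite /= ger0_norm ?expR_ge0//.
by rewrite gauss_mgf ltry.
Qed.

Lemma expR_abs_le (x : R) : expR `|x| <= expR x + expR (- x).
Proof.
have [x0|x0] := lerP 0 x.
- by rewrite ger0_norm// ler_wpDr ?expR_ge0.
- by rewrite ltr0_norm// ler_wpDl ?expR_ge0.
Qed.

Lemma integrable_expR_abs (c : R) : 0 <= c ->
  gam.-integrable [set: R] (EFin \o (fun x => expR (c * `|x|))).
Proof.
move=> c0.
have mE : measurable_fun [set: R] (fun x : R => expR (c * `|x|)).
  by do 2 apply: measurableT_comp => //; apply: measurable_funM => //.
have ig := integrableD measurableT (integrable_expR c) (integrable_expR (- c)).
apply: le_integrable ig => //.
- exact/measurable_EFinP.
- move=> x _ /=; rewrite lee_fin (ger0_norm (expR_ge0 _)).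
  rewrite (ger0_norm (addr_ge0 (expR_ge0 _) (expR_ge0 _))).
  by have := expR_abs_le (c * x); rewrite normrM (ger0_norm c0) mulNr.
Qed.

Lemma exp_bounded_integrable (f : R -> R) : measurable_fun [set: R] f ->
  exp_bounded f -> gam.-integrable [set: R] (EFin \o f).
Proof.
move=> mf [K [c [K0 c0 fK]]].
have ig := integrableZl measurableT K (integrable_expR_abs c0).
apply: le_integrable ig => //.
- exact/measurable_EFinP.
- by move=> x _ /=; rewrite lee_fin (le_trans (fK x))// ler_norm.
Qed.

(** Completing the square in c |x| + |x| - x^2 / (2 s^2) gives the constant. *)
Lemma pdf_decay (c x : R) :
  expR (c * `|x|) * normal_pdf 0 s x <=
  normal_peak s * expR ((c + 1) ^+ 2 * s ^+ 2 / 2) * expR (- `|x|).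
Proof.
rewrite normal_pdfE// mulrCA -mulrA ler_pM2l ?normal_peak_gt0//.
rewrite /normal_fun -!expRD ler_expR subr0.
have -> : x ^+ 2 = `|x| ^+ 2 by rewrite real_normK ?num_real.
rewrite -subr_ge0.
have -> : (c + 1) ^+ 2 * s ^+ 2 / 2 - `|x| - (c * `|x| + - `|x| ^+ 2 / (s ^+ 2 *+ 2))
  = (`|x| - (c + 1) * s ^+ 2) ^+ 2 / (2 * s ^+ 2).
  by field.
by rewrite divr_ge0 ?sqr_ge0// mulr_ge0// sqr_ge0.
Qed.

Lemma derive_normal_pdf (x : R) :
  is_derive x 1 (normal_pdf 0 s) (- (x / s ^+ 2) * normal_pdf 0 s x).
Proof.
rewrite normal_pdfE//= /normal_fun.
apply: is_derive_eq.
by rewrite /GRing.scale/=; field.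
Qed.

(** The density p of the law satisfies p' = - x p / s^2, so that
    (f p)' = (f' - x f / s^2) p. The integral of this derivative over [-n, n] is
    a boundary term, which vanishes as n grows because f p decays. *)
Lemma stein (f f' : R -> R) : (forall x : R, is_derive x 1 f (f' x)) ->
  continuous f' -> exp_bounded f -> exp_bounded f' ->
  (\int[gam]_x (x * f x)%:E = (s ^+ 2)%:E * \int[gam]_x (f' x)%:E)%E.
Proof.
move=> df cf' bf bf'.
have cf : continuous f by move=> x; apply: differentiable_continuous;
  apply/derivable1_diffP; have [] := df x.
have mf : measurable_fun [set: R] f by exact: continuous_measurable_fun.
have mf' : measurable_fun [set: R] f' by exact: continuous_measurable_fun.
have bxf : exp_bounded (fun x => x * f x).
  by apply: exp_growthM => //; exact: exp_growth_size.
have mxf : measurable_fun [set: R] (fun x => x * f x) by exact: measurable_funM.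
have ixf := exp_bounded_integrable mxf bxf.
have if' := exp_bounded_integrable mf' bf'.
pose u (x : R) := f x * normal_pdf 0 s x.
pose u' (x : R) := (f' x - (x * f x) / s ^+ 2) * normal_pdf 0 s x.
have du (x : R) : is_derive x 1 u (u' x).
  have := derive_normal_pdf x => dp.
  apply: is_derive_eq.
  by rewrite /u' /GRing.scale/=; field.
have cp : continuous (normal_pdf 0 s) by exact: continuous_normal_pdf.
have cu : continuous u by move=> x; apply: cvgM; [exact: cf|exact: cp].
have cu' : continuous u'.
  move=> x; apply: cvgM; last exact: cp.
  apply: cvgB; first exact: cf'.
  by apply: cvgM; last exact: cvg_cst; apply: cvgM; [exact: cvg_id|exact: cf].
have iu' : mu.-integrable [set: R] (EFin \o u').
  apply/(@integrable_normal_probP _ 0 s (fun x => f' x - x * f x / s ^+ 2)).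
    by apply: measurable_funB => //; apply: measurable_funM => //; exact: measurable_cst.
  apply: exp_bounded_integrable.
    by apply: measurable_funB => //; apply: measurable_funM => //; exact: measurable_cst.
  by apply: exp_growthB => //; apply: exp_growthM => //; exact: exp_growth_cst.
have [B B0 uB] : exists2 B, 0 <= B & forall x, `|u x| <= B * expR (- `|x|).
  case: bf => K [c [K0 c0 fK]].
  exists (K * (normal_peak s * expR ((c + 1) ^+ 2 * s ^+ 2 / 2))).
    by rewrite !mulr_ge0 ?normal_peak_ge0 ?expR_ge0.
  move=> x; rewrite normrM (ger0_norm (normal_pdf_ge0 _ _ _)).
  apply: le_trans (ler_wpM2r (normal_pdf_ge0 _ _ _) (fK x)) _.
  have := pdf_decay c x; rewrite -!mulrA => h; exact: ler_wpM2l.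
(* The boundary terms at n+1 and at -(n+1) are treated together. *)
have u0 (v : nat -> R) : (forall n, `|v n| = n.+1%:R) -> u (v n) @[n --> \oo] --> (0 : R).
  move=> vn.
  have B0' : B * expR (- n.+1%:R) @[n --> \oo] --> (0 : R).
    rewrite -[X in _ --> X](mulr0 B); apply: cvgM; first exact: cvg_cst.
    have nS : (n.+1%:R : R) @[n --> \oo] --> +oo.
      by rewrite (cvg_shiftS (fun n : nat => n%:R : R)); exact: cvgr_idn.
    exact: (cvg_comp _ _ nS (@cvgr_expR R)).
  apply: (@squeeze_cvgr _ _ _ _ (fun n => - (B * expR (- n.+1%:R))) (fun n =>
    B * expR (- n.+1%:R))) => //.
    by near=> n; rewrite -ler_norml -(vn n).
  by rewrite -[X in _ --> X]oppr0; exact: cvgN.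
pose J (n : nat) : set R := `[- n.+1%:R, n.+1%:R]%classic.
have Iu (n : nat) : (\int[mu]_(x in J n) (u' x)%:E = (u n.+1%:R - u (- n.+1%:R))%:E)%E.
  rewrite (@continuous_FTC2 _ u' u)//.
  - by rewrite gtrN.
  - exact: continuous_subspaceT.
  - split.
    + by move=> x _; have [] := du x.
    + by apply: cvg_at_right_filter; exact: cu.
    + by apply: cvg_at_left_filter; exact: cu.
  - by move=> x _; rewrite derive1E; have [_ ->] := du x.
have Iu0 : (\int[mu]_x (u' x)%:E = 0)%E.
  pose f_ n := (fun x : R => (u' x)%:E) \_ (J n).
  have mu' : measurable_fun [set: R] (EFin \o u').
    by apply/measurable_EFinP; exact: continuous_measurable_fun.
  have [] := @dominated_convergence _ _ _ mu [set: R] measurableT f_ (EFin \o u') (abse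
    \o (EFin \o u')).
  - move=> n; apply: (measurable_restrictT (EFin \o u') _).1.
      exact: measurable_itv.
    exact: measurable_funTS.
  - exact: mu'.
  - apply/aeW => x _; apply: cvg_near_cst.
    near=> n; rewrite /f_ patchE ifT//; apply/mem_set; rewrite /J/= in_itv/= -ler_norml.
    apply: (@le_trans _ _ n%:R); last by rewrite ler_nat.
    near: n; exact: nbhs_infty_ger.
  - exact: integrable_abse.
  - apply/aeW => x n _; rewrite /f_ patchE; case: ifP => // _.
    by rewrite /= normr0 lee_fin normr_ge0.
  move=> _ _ cI.
  have : [sequence (\int[mu]_x f_ n x)%E]_n @ \oo --> 0%E.
    have -> : [sequence (\int[mu]_x f_ n x)%E]_n = EFin \o (fun n =>
      u n.+1%:R - u (- n.+1%:R)).
      by apply/funext => n; rewrite /= -Iu [RHS]integral_mkcond.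
    apply: cvg_EFin; first exact: nearW.
    rewrite -[X in _ --> X](subr0 0); apply: cvgB; apply: u0 => n.
      by rewrite ger0_norm.
    by rewrite normrN ger0_norm.
  exact: cvg_unique cI.
have ip (h : R -> R) : measurable_fun [set: R] h -> exp_bounded h ->
    mu.-integrable [set: R] (EFin \o (fun x => h x * normal_pdf 0 s x)).
  by move=> mh bh; apply/(integrable_normal_probP 0 s mh); exact: exp_bounded_integrable.
rewrite !integral_normal_prob//.
have Ixf := ip _ mxf bxf; have If' := ip _ mf' bf'.
have Eu : (\int[mu]_x (u' x)%:E = \int[mu]_x (f' x * normal_pdf 0 s x)%:E -
    (s ^- 2)%:E * \int[mu]_x (x * f x * normal_pdf 0 s x)%:E)%E.
  rewrite -integralZl// -integralB//; last exact: integrableZl.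
  by apply: eq_integral => x _; rewrite -EFinM -EFinB /u' /=; congr EFin; ring.
move: Eu; rewrite Iu0 -(fineK (integrable_fin_num _ Ixf))// -(fineK (integrable_fin_num
  _ If'))//.
rewrite -EFinM -EFinB => -[] /esym/eqP; rewrite subr_eq0 => /eqP If'E.
by rewrite /= -EFinM; congr EFin; rewrite [X in _ * X]If'E mulrA divff ?mul1r// expf_neq0.
Unshelve. all: by end_near. Qed.

End gauss_moments.

(** * Freezing an independent variable *)

Section freezing.
Context {R : realType} d (T : measurableType d) (P : probability T R).
Variables (nu : probability R R) (X : {RV P >-> R}) (G : set (set T)).
Hypothesis GT : G setT.
Hypothesis GI : setI_closed G.
Hypothesis Gm : G `<=` measurable.
Hypothesis XG : forall (A : set R) (B : set T), measurable A -> G B ->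
  P (X @^-1` A `&` B) = (nu A * P B)%E.

Lemma indep_g_sigma (A : set R) (B : set T) : measurable A -> <<s G >> B ->
  P (X @^-1` A `&` B) = (nu A * P B)%E.
Proof.
move=> mA GB.
have mXA : measurable (X @^-1` A) by rewrite -[X in measurable X]setTI;
  exact: measurable_funP.
have rA : (0 <= fine (nu A))%R by exact: fine_ge0.
have -> : (nu A * P B)%E = mscale (NngNum rA) P B by rewrite /mscale/= fineK
  ?fin_num_measure.
rewrite setIC -/(mrestr P mXA B).
apply: (@g_sigma_algebra_measure_unique _ _ _ G Gm (fun=> setT)) => //.
- by rewrite bigcup_const.
- by move=> C GC; rewrite /= /mrestr /mscale/= fineK ?fin_num_measure// setIC XG.
- by move=> k; rewrite /= /mrestr (le_lt_trans (probability_le1 _ _)) ?ltry ?setTI.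
Qed.

Let TG : measurableType G.-sigma := g_sigma_algebraType G.

Let forget (w : T) : TG := w.

Let joint (w : T) : R * TG := (X w, w).

Let measurable_forget : measurable_fun [set: T] forget.
Proof.
move=> _ B mB; rewrite setTI.
exact: (smallest_sub (@sigma_algebra_measurable _ T) Gm).
Qed.

Let measurable_joint : measurable_fun [set: T] joint.
Proof. by apply/measurable_fun_pair => //; exact: measurable_forget. Qed.

HB.instance Definition _ := isMeasurableFun.Build _ _ _ _ forget measurable_forget.
HB.instance Definition _ := isMeasurableFun.Build _ _ _ _ joint measurable_joint.

Let PG : probability TG R := distribution P forget.
Let PJ : probability (R * TG)%type R := distribution P joint.

(** Conditionally on a sigma-algebra independent of X, a function of X and of
    the outcome is integrated by freezing the outcome: the joint law of X and of
    the identity map is a product measure on the rectangles, hence everywhere. *)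
Lemma freezing (psi : R * TG -> \bar R) :
  measurable_fun [set: R * TG] psi -> (forall z, 0 <= psi z)%E ->
  (\int[P]_w psi (X w, w) = \int[P]_w \int[nu]_x psi (x, w))%E.
Proof.
move=> mpsi psi0.
transitivity (\int[PJ]_z psi z)%E; first by rewrite ge0_integral_distribution.
transitivity (\int[(nu \x PG)%E]_z psi z)%E.
  apply: eq_measure_integral => A mA _; apply/esym.
  apply: product_measure_unique => //= B C mB mC.
  exact: indep_g_sigma.
rewrite fubini_tonelli2//.
rewrite ge0_integral_distribution//.
- exact: measurable_fun_fubini_tonelli_G.
- by move=> y; exact: integral_ge0.
Qed.

End freezing.

(** * Functions of finitely many real coordinates *)

Definition upd {R : Type} {I : eqType} (y : I -> R) (i : I) (x : R) : I -> R :=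
  fun j => if j == i then x else y j.

Lemma upd_same (R : Type) (I : eqType) (y : I -> R) i x : upd y i x i = x.
Proof. by rewrite /upd eqxx. Qed.

Lemma upd_other (R : Type) (I : eqType) (y : I -> R) i x j :
  j != i -> upd y i x j = y j.
Proof. by rewrite /upd => /negbTE ->. Qed.

Lemma upd_id (R : Type) (I : eqType) (y : I -> R) i : upd y i (y i) = y.
Proof. by apply/funext => j; rewrite /upd; case: eqP => // ->. Qed.

Lemma upd_upd (R : Type) (I : eqType) (y : I -> R) i x x' :
  upd (upd y i x) i x' = upd y i x'.
Proof. by apply/funext => j; rewrite /upd; case: eqP. Qed.

Lemma updC (R : Type) (I : eqType) (y : I -> R) i j x x' : i != j ->
  upd (upd y i x) j x' = upd (upd y j x') i x.
Proof.
move=> ij; apply/funext => k; rewrite /upd.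
by have [->|] := eqVneq k j => //; rewrite eq_sym (negbTE ij).
Qed.

Section coordinate_functions.
Context {R : realType} {I : finType}.
Implicit Types f : (I -> R) -> R.

(** Measurability is tested by composition with families of measurable maps.
    This treats on the same footing a random sample, a slice along one
    coordinate and a pair made of both, for which no common sigma-algebra on
    I -> R has to be chosen. *)
Definition meas f := forall d (S : measurableType d) (u : I -> S -> R),
  (forall i, measurable_fun [set: S] (u i)) ->
  measurable_fun [set: S] (fun s => f (fun i => u i s)).

Definition l1 (y : I -> R) := \sum_i `|y i|.

Lemma l1_ge0 y : 0 <= l1 y.
Proof. by apply: sumr_ge0. Qed.

Lemma le_l1 y i : `|y i| <= l1 y.
Proof. by rewrite /l1 (bigD1 i)//= lerDl sumr_ge0. Qed.

Lemma l1_upd y i x : l1 (upd y i x) <= l1 y + `|x|.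
Proof.
rewrite /l1 (bigD1 i)//= upd_same [X in _ <= X + _](bigD1 i)//= addrC lerD2r.
rewrite (eq_bigr (fun j => `|y j|)) ?lerDr// => j ji.
by rewrite upd_other.
Qed.

Definition good f := meas f /\ exp_growth l1 f.

Lemma meas_cst a : meas (fun=> a).
Proof. by move=> d S u mu; exact: measurable_cst. Qed.

Lemma meas_coord i : meas (fun y => y i).
Proof. by move=> d S u mu; exact: mu. Qed.

Lemma measD f h : meas f -> meas h -> meas (fun y => f y + h y).
Proof. by move=> mf mh d S u mu; apply: measurable_funD; [exact: mf|exact: mh]. Qed.

Lemma measM f h : meas f -> meas h -> meas (fun y => f y * h y).
Proof. by move=> mf mh d S u mu; apply: measurable_funM; [exact: mf|exact: mh]. Qed.

Lemma meas_comp (p : R -> R) f : measurable_fun [set: R] p -> meas f ->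
  meas (fun y => p (f y)).
Proof. by move=> mp mf d S u mu; apply: measurableT_comp => //; exact: mf. Qed.

Lemma meas_sum (J : Type) (r : seq J) (p : pred J) (F : J -> (I -> R) -> R) :
  (forall j, meas (F j)) -> meas (fun y => \sum_(j <- r | p j) F j y).
Proof.
move=> mF d S u mu; elim: r => [|j r IHr].
  by under eq_fun do rewrite big_nil; exact: measurable_cst.
under eq_fun do rewrite big_cons; case: (p j) => //.
by apply: measurable_funD => //; exact: mF.
Qed.

Lemma good_cst a : good (fun=> a).
Proof. by split; [exact: meas_cst|exact: exp_growth_cst]. Qed.

Lemma good_coord i : good (fun y => y i).
Proof.
split; first exact: meas_coord.
by apply: exp_growth_size => y; exact: le_l1.
Qed.

Lemma goodD f h : good f -> good h -> good (fun y => f y + h y).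
Proof.
move=> [mf ef] [mh eh]; split; first exact: measD.
by apply: exp_growthD => // y; exact: l1_ge0.
Qed.

Lemma goodM f h : good f -> good h -> good (fun y => f y * h y).
Proof. by move=> [mf ef] [mh eh]; split; [exact: measM|exact: exp_growthM]. Qed.

Lemma goodZ a f : good f -> good (fun y => a * f y).
Proof. by move=> gf; apply: goodM => //; exact: good_cst. Qed.

Lemma goodN f : good f -> good (fun y => - f y).
Proof.
move=> gf; have := goodZ (-1) gf.
by under eq_fun do rewrite mulN1r.
Qed.

Lemma goodB f h : good f -> good h -> good (fun y => f y - h y).
Proof. by move=> gf gh; apply: goodD => //; exact: goodN. Qed.

Lemma goodX f n : good f -> good (fun y => f y ^+ n).
Proof.
move=> gf; elim: n => [|n IHn]; first exact: good_cst.
by under eq_fun do rewrite exprS; exact: goodM.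
Qed.

Lemma good_sum (J : Type) (r : seq J) (p : pred J) (F : J -> (I -> R) -> R) :
  (forall j, good (F j)) -> good (fun y => \sum_(j <- r | p j) F j y).
Proof.
move=> gF; split; first by apply: meas_sum => j; exact: (gF j).1.
by apply: exp_growth_sum => [y|j]; [exact: l1_ge0|exact: (gF j).2].
Qed.

Lemma good_prod (J : Type) (r : seq J) (p : pred J) (F : J -> (I -> R) -> R) :
  (forall j, good (F j)) -> good (fun y => \prod_(j <- r | p j) F j y).
Proof.
move=> gF; elim: r => [|j r IHr].
  by under eq_fun do rewrite big_nil; exact: good_cst.
by under eq_fun do rewrite big_cons; case: (p j) => //; exact: goodM.
Qed.

Lemma good_bounded f M : meas f -> (forall y, `|f y| <= M) -> good f.
Proof. by move=> mf fM; split => //; exact: exp_growth_bounded fM. Qed.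

Lemma good_norm f : good f -> good (fun y => `|f y|).
Proof.
move=> [mf ef]; split; first exact: meas_comp.
by apply: exp_growth_le ef => y; rewrite normr_id.
Qed.

End coordinate_functions.

(** * Families of independent Gaussian variables *)

Section gaussian_law_on_R.
Context {R : realType}.
Variable s : R.

Let idTR : measurableTypeR R -> R := idfun.

#[local] HB.instance Definition _ :=
  @isMeasurableFun.Build _ _ _ _ idTR (@measurable_id _ _ setT).

(** The Borel sets of R carry two displays, one attached to the type R itself
    and one to the domain of the Lebesgue measure; the identity between them
    moves the Gaussian measure from the second to the first. *)
Definition gaussian_law : probability R R := distribution (normal_prob 0 s) idTR.

Lemma ge0_integral_gaussian_law (f : R -> \bar R) :
  measurable_fun [set: R] f -> (forall x, 0 <= f x)%E ->
  (\int[gaussian_law]_x f x = \int[normal_prob 0 s]_x f x)%E.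
Proof. by move=> mf f0; rewrite ge0_integral_distribution. Qed.

End gaussian_law_on_R.

Section gaussian_family.
Context {R : realType} {I : finType} d (T : measurableType d) (P : probability T R).
Variables (s : R) (g : I -> {RV P >-> R}).
Hypothesis s0 : 0 < s.
Hypothesis gdist : forall i (A : set R), measurable A ->
  distribution P (g i) A = normal_prob 0 s A.
Hypothesis gind : mutually_independent [set: I]%SET g.
Local Notation gam := (normal_prob 0 s).

Let cyl (i : I) : set (set T) :=
  [set B | exists2 A : I -> set R, (forall j, measurable (A j)) &
    B = \bigcap_(j in [set j | j != i]) g j @^-1` A j].

Let mpre (i : I) (A : set R) : measurable A -> measurable (g i @^-1` A).
Proof. by move=> mA; rewrite -[X in measurable X]setTI; exact: measurable_funP. Qed.

Let cylT i : cyl i setT.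
Proof.
exists (fun=> setT) => //.
by apply/esym; rewrite -subTset => w _ j _.
Qed.

Let cylI i : setI_closed (cyl i).
Proof.
move=> _ _ [A mA ->] [B mB ->]; exists (fun j => A j `&` B j).
  by move=> j; exact: measurableI.
by rewrite -bigcapI; apply: eq_bigcapr => j _; rewrite preimage_setI.
Qed.

Let cyl_measurable i : cyl i `<=` measurable.
Proof.
move=> _ [A mA ->]; apply: fin_bigcap_measurable.
  exact: finite_finset.
by move=> j _; exact: mpre.
Qed.

Let cyl_indep i (A : set R) (B : set T) : measurable A -> cyl i B ->
  P (g i @^-1` A `&` B) = (gam A * P B)%E.
Proof.
move=> mA [C mC ->].
(* The product formula over all coordinates is compared with the one over the
   coordinates other than i, which gives the mass of the cylinder. *)
have mC' j : measurable (if j == i then A else C j) by case: ifP.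
have := gind (J := [set: I]%SET) (A := fun j =>
  if j == i then A else C j) (subxx _) (fun j _ => mC' j).
have := gind (J := [set~ i]%SET) (A := C) (finset.subsetT _) (fun j _ => mC j).
have -> : \bigcap_(j in [set` [set~ i]%SET]) g j @^-1` C j =
  \bigcap_(j in [set j | j != i]) g j @^-1` C j.
  by apply: eq_bigcapl; split=> j /=; rewrite !inE.
move=> ->.
have -> : \bigcap_(j in [set` [set: I]%SET]) g j @^-1` (if j == i then A else C j) =
   g i @^-1` A `&` \bigcap_(j in [set j | j != i]) g j @^-1` C j.
  apply/seteqP; split=> w.
    move=> h; split; first by have := h i; rewrite eqxx; apply; rewrite /= inE.
    by move=> j /= ji; have := h j; rewrite (negbTE ji); apply; rewrite /= inE.
  by move=> [h1 h2] j _ /=; case: eqP => [->//|/eqP ji]; exact: h2.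
move=> ->.
rewrite (bigD1 i)/= ?inE// eqxx; congr (_ * _)%E; first exact: gdist.
by apply: eq_big => j; rewrite !inE//= => ji; rewrite (negbTE ji).
Qed.

Let cyl_coord i j : j != i ->
  @measurable_fun _ _ (g_sigma_algebraType (cyl i)) R setT (g j).
Proof.
move=> ji _ A mA; rewrite setTI; apply: sub_sigma_algebra.
exists (fun k => if k == j then A else setT) => [k|]; first by case: ifP.
apply/seteqP; split=> w /=.
  by move=> h k _ /=; case: eqP => [->|].
by move=> /(_ j ji) /=; rewrite eqxx.
Qed.

Definition sample (w : T) : I -> R := fun i => g i w.

(** The i-th coordinate is independent of the sigma-algebra generated by the
    others, by the pi-system of their cylinders; it may thus be frozen out and
    integrated separately. All uses of independence go through this fact. *)
Lemma ge0_resample i (f : (I -> R) -> R) : meas f -> (forall y, 0 <= f y) ->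
  (\int[P]_w (f (sample w))%:E =
   \int[P]_w \int[gam]_x (f (upd (sample w) i x))%:E)%E.
Proof.
move=> mf f0.
pose u (j : I) (z : R * g_sigma_algebraType (cyl i)) : R := upd (sample z.2) i z.1 j.
have mu j : measurable_fun setT (u j).
  rewrite /u /upd; case: eqP => [_|/eqP ji]; first exact: measurable_fst.
  by apply: measurableT_comp; [exact: cyl_coord|exact: measurable_snd].
have := freezing (nu := gaussian_law s) (@cylT i) (@cylI i) (@cyl_measurable i)
  (@cyl_indep i) (psi := fun z => (f (fun j => u j z))%:E).
rewrite /u/= => fr.
transitivity (\int[P]_w (f (upd (sample w) i (g i w)))%:E)%E.
  by apply: eq_integral => w _; rewrite -[in LHS](upd_id (sample w) i).
rewrite fr.
- apply: eq_integral => w _; apply: ge0_integral_gaussian_law.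
    apply/measurable_EFinP; apply: (mf _ R (fun j x => upd (sample w) i x j)) => j.
    by rewrite /upd; case: eqP => _ //; exact: measurable_cst.
  by move=> x; rewrite lee_fin.
- by apply/measurable_EFinP; apply: mf.
- by move=> z; rewrite lee_fin.
Qed.

Lemma meas_sample f : meas f -> measurable_fun [set: T] (fun w => f (sample w)).
Proof. by move=> mf; apply: mf => i; exact: measurable_funP. Qed.

Lemma ge0_integral_prod (r : seq I) (h : I -> R -> R) : uniq r ->
  (forall i, measurable_fun [set: R] (h i)) -> (forall i x, 0 <= h i x) ->
  (\int[P]_w (\prod_(i <- r) h i (sample w i))%:E =
   \big[*%E/1%E]_(i <- r) \int[gam]_x (h i x)%:E)%E.
Proof.
move=> + mh h0; elim: r => [_|i r IHr /=/andP[ir ur]].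
  under eq_integral do rewrite big_nil.
  by rewrite integral_cst//= probability_setT mule1 big_nil.
have mp (r' : seq I) : meas (fun y : I -> R => \prod_(j <- r') h j (y j)).
  elim: r' => [|j r' IH].
    by rewrite (_ : (fun y => _) = (fun=> 1)); [exact: meas_cst|apply/funext => y;
      rewrite big_nil].
  rewrite (_ : (fun y => _) = (fun y => h j (y j) * \prod_(k <- r') h k (y k))); last first.
    by apply/funext => y; rewrite big_cons.
  apply: measM => //.
  exact: (meas_comp (mh j) (meas_coord j)).
have p0 (r' : seq I) (y : I -> R) : 0 <= \prod_(j <- r') h j (y j) by apply: prodr_ge0.
rewrite (ge0_resample i (f := fun y => \prod_(j <- i :: r) h j (y j)))//.
under eq_integral => w _.
  under eq_integral => x _.
    rewrite big_cons upd_same.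
    rewrite (eq_big_seq (fun j => h j (sample w j))) => [|j jr]; last first.
      by rewrite upd_other//; apply: contraNneq ir => <-.
    rewrite EFinM muleC; over.
  rewrite ge0_integralZl//=; last 3 first.
    by apply/measurable_EFinP; exact: mh.
    by move=> x _; rewrite lee_fin.
    by rewrite lee_fin p0.
  rewrite muleC; over.
rewrite big_cons ge0_integralZl//=.
- by rewrite IHr.
- by apply/measurable_EFinP; exact: (meas_sample (mp r)).
- by move=> w _; rewrite lee_fin.
- by apply: integral_ge0 => x _; rewrite lee_fin.
Qed.

Lemma integral_expR_linear (t : I -> R) :
  (\int[P]_w (expR (\sum_i t i * sample w i))%:E =
   (expR (s ^+ 2 / 2 * \sum_i t i ^+ 2))%:E)%E.
Proof.
under eq_integral do rewrite expR_sum.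
rewrite (ge0_integral_prod (h := fun i x => expR (t i * x))) ?index_enum_uniq//; last first.
- by move=> i; apply: measurableT_comp => //; exact: measurable_funM.
under eq_bigr do rewrite gauss_mgf//.
rewrite prodEFin -expR_sum; congr (expR _)%:E.
by rewrite mulr_sumr; apply: eq_bigr => i _; ring.
Qed.

(** The dominating function expR (c * l1 y) factorises over the coordinates. *)
Lemma good_integrable f : good f ->
  P.-integrable [set: T] (EFin \o (fun w => f (sample w))).
Proof.
move=> [mf [K [c [K0 c0 fK]]]].
have ml : meas (fun y : I -> R => expR (c * l1 y)).
  apply: (meas_comp (p := fun x => expR (c * x))).
    by apply: measurableT_comp => //; exact: measurable_funM.
  by apply: meas_sum => i; apply: meas_comp => //; exact: meas_coord.
have il : P.-integrable [set: T] (EFin \o (fun w => expR (c * l1 (sample w)))).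
  apply/integrableP; split; first by apply/measurable_EFinP; exact: (meas_sample ml).
  under eq_integral do rewrite /= ger0_norm ?expR_ge0// mulr_sumr expR_sum.
  rewrite (ge0_integral_prod (h := fun _ x => expR (c * `|x|))) ?index_enum_uniq//;
    last first.
    by move=> _; do 2 apply: measurableT_comp => //; apply: measurable_funM => //.
  have /integrableP[_] := integrable_expR_abs s0 c0.
  under eq_integral do rewrite /= ger0_norm ?expR_ge0//.
  have : (0 <= \int[gam]_x (expR (c * `|x|))%:E)%E.
    by apply: integral_ge0 => x _; rewrite lee_fin expR_ge0.
  case: (\int[gam]_x (expR (c * `|x|))%:E)%E => //= a _ _.
  by rewrite prodEFin ltry.
have ig := integrableZl measurableT K il.
apply: le_integrable ig => //.
- by apply/measurable_EFinP; exact: meas_sample.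
- by move=> w _ /=; rewrite lee_fin (le_trans (fK _))// ler_norm.
Qed.

End gaussian_family.

(** * Gaussian expectation and the Efron-Stein inequality *)

Section gaussian_expectation.
Context {R : realType} {I : finType} d (T : measurableType d) (P : probability T R).
Variables (s : R) (g : I -> {RV P >-> R}).
Hypothesis s0 : 0 < s.
Hypothesis gdist : forall i (A : set R), measurable A ->
  distribution P (g i) A = normal_prob 0 s A.
Hypothesis gind : mutually_independent [set: I]%SET g.
Local Notation gam := (normal_prob 0 s).
Implicit Types f h : (I -> R) -> R.

Definition Eg f : R := \int[P]_w f (sample g w).

Definition avg (i : I) f (y : I -> R) : R := \int[gam]_x f (upd y i x).

Let gi := good_integrable s0 gdist gind.

Lemma Eg_cst a : Eg (fun=> a) = a.
Proof. by rewrite /Eg Rintegral_cst//= probability_setT mulr1. Qed.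

Lemma EgD f h : good f -> good h -> Eg (fun y => f y + h y) = Eg f + Eg h.
Proof. by move=> gf gh; rewrite /Eg RintegralD//; exact: gi. Qed.

Lemma EgB f h : good f -> good h -> Eg (fun y => f y - h y) = Eg f - Eg h.
Proof. by move=> gf gh; rewrite /Eg RintegralB//; exact: gi. Qed.

Lemma EgZ a f : good f -> Eg (fun y => a * f y) = a * Eg f.
Proof. by move=> gf; rewrite /Eg RintegralZl//; exact: gi. Qed.

Lemma Eg_sum (J : Type) (r : seq J) (p : pred J) (F : J -> (I -> R) -> R) :
  (forall j, good (F j)) ->
  Eg (fun y => \sum_(j <- r | p j) F j y) = \sum_(j <- r | p j) Eg (F j).
Proof.
move=> gF; elim: r => [|j r IHr].
  rewrite big_nil -[RHS](Eg_cst 0); congr Eg.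
  by apply/funext => y; rewrite big_nil.
rewrite big_cons -IHr; case: ifP => pj.
  rewrite -EgD//; last exact: good_sum.
  by congr Eg; apply/funext => y; rewrite big_cons pj.
by congr Eg; apply/funext => y; rewrite big_cons pj.
Qed.

Lemma Eg_le f h : good f -> good h -> (forall y, f y <= h y) -> Eg f <= Eg h.
Proof.
by move=> gf gh fh; apply: le_Rintegral => //; [exact: gi|exact: gi].
Qed.

Lemma Eg_ge0 f : (forall y, 0 <= f y) -> 0 <= Eg f.
Proof. by move=> f0; apply: Rintegral_ge0. Qed.

Lemma meas_slice i f y : meas f -> measurable_fun [set: R] (fun x => f (upd y i x)).
Proof.
move=> mf; apply: (mf _ R (fun j x => upd y i x j)) => j.
by rewrite /upd; case: eqP => _ //; exact: measurable_cst.
Qed.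

Lemma good_slice i f y : good f -> exp_bounded (fun x => f (upd y i x)).
Proof.
move=> [mf [K [c [K0 c0 fK]]]].
exists (K * expR (c * l1 y)), c; split; rewrite ?mulr_ge0 ?expR_ge0// => x.
rewrite (le_trans (fK _))// -mulrA -expRD -mulrDr ler_wpM2l// ler_expR ler_wpM2l//.
exact: l1_upd.
Qed.

Lemma integrable_slice i f y : good f ->
  gam.-integrable [set: R] (EFin \o (fun x => f (upd y i x))).
Proof.
move=> gf; apply: exp_bounded_integrable => //; last exact: good_slice.
by apply: meas_slice; exact: gf.1.
Qed.

Lemma avgB i f h y : good f -> good h ->
  avg i (fun z => f z - h z) y = avg i f y - avg i h y.
Proof. by move=> gf gh; rewrite /avg RintegralB//; exact: integrable_slice. Qed.

Lemma avgD i f h y : good f -> good h ->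
  avg i (fun z => f z + h z) y = avg i f y + avg i h y.
Proof. by move=> gf gh; rewrite /avg RintegralD//; exact: integrable_slice. Qed.

Lemma avg_cst i a y : avg i (fun=> a) y = a.
Proof. by rewrite /avg Rintegral_cst//= probability_setT mulr1. Qed.

Lemma avg_le i f h y : good f -> good h ->
  (forall x, f (upd y i x) <= h (upd y i x)) -> avg i f y <= avg i h y.
Proof.
by move=> gf gh fh; apply: le_Rintegral => //; exact: integrable_slice.
Qed.

Definition pos_part f : (I -> R) -> R := fun y => (f y + `|f y|) / 2.

Lemma good_pos_part f : good f -> good (pos_part f).
Proof.
move=> gf; apply: goodM; last exact: good_cst.
by apply: goodD => //; exact: good_norm.
Qed.

Lemma pos_part_ge0 f y : 0 <= pos_part f y.
Proof. by rewrite /pos_part divr_ge0// -lerBlDl sub0r -normrN ler_norm. Qed.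

Lemma pos_partB f y : f y = pos_part f y - pos_part (fun z => - f z) y.
Proof. by rewrite /pos_part normrN; field. Qed.

Lemma meas_avg_ge0 i f : meas f -> (forall y, 0 <= f y) -> meas (avg i f).
Proof.
move=> mf f0 d' S u mu.
have mF : measurable_fun [set: R * S]
    (fun z => (f (upd (fun j => u j z.2) i z.1))%:E).
  apply/measurable_EFinP; apply: (mf _ (R * S)%type (fun j z => upd (fun k =>
    u k z.2) i z.1 j)) => j.
  rewrite /upd; case: eqP => _; first exact: measurable_fst.
  by exact: (measurableT_comp (mu j) measurable_snd).
have F0 (z : R * S) : (0 <= (f (upd (fun j => u j z.2) i z.1))%:E)%E by rewrite lee_fin.
have := measurable_fun_fubini_tonelli_G (m1 := gaussian_law s) _ mF F0.
move=> /(measurableT_comp (fine_measurable measurableT));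
  apply: eq_measurable_fun => w _ /=.
rewrite /avg /Rintegral /fubini_G; congr fine.
apply: ge0_integral_gaussian_law => //.
by apply/measurable_EFinP; exact: (meas_slice i (fun j => u j w) mf).
Qed.

(** Measurability in the remaining coordinates comes from Fubini, which is
    available for nonnegative functions; hence the splitting into positive parts. *)
Lemma good_avg i f : good f -> good (avg i f).
Proof.
move=> gf; split.
  rewrite (_ : avg i f = fun y => avg i (pos_part f) y - avg i (pos_part (fun z =>
    - f z)) y).
    apply: measD; first by apply: meas_avg_ge0;
      [exact: (good_pos_part gf).1|exact: pos_part_ge0].
    apply: (meas_comp (p := -%R)) => //.
    apply: meas_avg_ge0; [exact: (good_pos_part (goodN gf)).1|exact: pos_part_ge0].
  apply/funext => y; rewrite -avgB; [|exact: good_pos_part|exact/good_pos_part/goodN].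
  by rewrite /avg; apply: eq_Rintegral => x _; exact: pos_partB.
case: gf => mf [K [c [K0 c0 fK]]].
pose M := \int[gam]_x expR (c * `|x|).
have M0 : 0 <= M by apply: Rintegral_ge0 => x _; exact: expR_ge0.
exists (K * M), c; split; rewrite ?mulr_ge0// => y.
have iE := integrable_expR_abs s0 c0.
have mS := meas_slice i y mf.
have iS : gam.-integrable [set: R] (EFin \o (fun x => f (upd y i x))).
  by apply: integrable_slice; split => //; exists K, c; split.
apply: le_trans (le_normr_Rintegral _ iS) _ => //.
rewrite /M mulrAC -RintegralZl//.
apply: le_Rintegral => //.
- exact: integrable_norm.
- exact: (integrableZl measurableT _ iE).
- move=> x _; rewrite (le_trans (fK _))// -mulrA -expRD -mulrDr ler_wpM2l// ler_expR
  ler_wpM2l//.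
  exact: l1_upd.
Qed.

Lemma Eg_avg_ge0 i f : good f -> (forall y, 0 <= f y) -> Eg (avg i f) = Eg f.
Proof.
move=> gf f0; rewrite /Eg /Rintegral; congr fine.
rewrite (ge0_resample gdist gind i gf.1 f0).
apply: eq_integral => w _; rewrite /avg /Rintegral fineK//.
apply: integrable_fin_num => //; exact: integrable_slice.
Qed.

(** Resampling, extended from nonnegative functions by splitting into positive
    parts. *)
Lemma Eg_avg i f : good f -> Eg (avg i f) = Eg f.
Proof.
move=> gf.
have gp := good_pos_part gf; have gn := good_pos_part (goodN gf).
rewrite (_ : f = fun y => pos_part f y - pos_part (fun z => - f z) y); last first.
  by apply/funext => y; exact: pos_partB.
rewrite (_ : avg i _ = fun y => avg i (pos_part f) y - avg i (pos_part (fun z =>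
  - f z)) y); last first.
  by apply/funext => y; rewrite avgB.
rewrite !EgB//; [|exact: good_avg|exact: good_avg].
by rewrite !Eg_avg_ge0//; exact: pos_part_ge0.
Qed.

(** Average first over the i-th coordinate, where the one-dimensional formula
    of stein applies. *)
Lemma gaussian_ibp i f f' : good f -> good f' ->
  (forall y (x : R), is_derive x 1 (fun x => f (upd y i x)) (f' (upd y i x))) ->
  (forall y, continuous (fun x => f' (upd y i x))) ->
  Eg (fun y => y i * f y) = s ^+ 2 * Eg f'.
Proof.
move=> gf gf' df cf'.
rewrite -(Eg_avg i) ?goodM//; last by apply: goodM => //; exact: good_coord.
rewrite -(Eg_avg i gf') -EgZ; last exact: good_avg.
congr Eg; apply/funext => y; rewrite /avg /Rintegral.
under eq_integral do rewrite upd_same.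
rewrite (stein s0 (df y) (cf' y)); [|exact: good_slice|exact: good_slice].
rewrite fineM//; apply: integrable_fin_num => //; exact: integrable_slice.
Qed.

Lemma Eg_expR_linear (t : I -> R) :
  Eg (fun y => expR (\sum_i t i * y i)) = expR (s ^+ 2 / 2 * \sum_i t i ^+ 2).
Proof.
by rewrite /Eg /Rintegral (integral_expR_linear s0 gdist gind t).
Qed.

Lemma good_expR_linear (t : I -> R) : good (fun y => expR (\sum_i t i * y i)).
Proof.
split.
  apply: meas_comp => //; apply: meas_sum => i.
  exact: (measM (meas_cst (t i)) (meas_coord i)).
exists 1, (\sum_i `|t i|); split => // [|y]; first exact: sumr_ge0.
rewrite mul1r ger0_norm ?expR_ge0// ler_expR (le_trans (ler_norm _))//.
rewrite (le_trans (ler_norm_sum _ _ _))// mulr_suml; apply: ler_sum => i _.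
by rewrite normrM ler_wpM2l// le_l1.
Qed.

Lemma avgZ i a f y : good f -> avg i (fun z => a * f z) y = a * avg i f y.
Proof. by move=> gf; rewrite /avg RintegralZl//; exact: integrable_slice. Qed.

Lemma avg_coord_sqr i y : avg i (fun z => z i ^+ 2) y = s ^+ 2.
Proof.
rewrite /avg /Rintegral.
under eq_integral do rewrite upd_same expr2.
rewrite (stein s0 (f := id) (f' := fun=> 1)).
- by rewrite integral_cst//= probability_setT !mule1.
- by move=> x; exact: cvg_cst.
- exact: exp_growth_size.
- exact: exp_growth_cst.
Qed.

(** A Lipschitz bound in each coordinate separately: such a bound is inherited
    by averages over another coordinate, which lets the variance be estimated one
    coordinate at a time. *)
Definition coord_lipschitz (L : R) f :=
  forall i y x x', `|f (upd y i x) - f (upd y i x')| <= L * `|x - x'|.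

Lemma coord_lipschitz_avg L i f : good f -> coord_lipschitz L f ->
  coord_lipschitz L (avg i f).
Proof.
move=> gf Lf j y.
(* Averaging over the coordinate j itself makes the function constant in it. *)
have half (x x' : R) : avg i f (upd y j x) <= avg i f (upd y j x') + L * `|x - x'|.
  have [->|ij] := eqVneq i j.
    rewrite /avg; under eq_Rintegral do rewrite upd_upd.
    under [X in _ <= X + _]eq_Rintegral do rewrite upd_upd.
    by rewrite lerDl (le_trans _ (Lf j y x x')).
  rewrite {2}/avg -[X in _ + X](avg_cst i (L *
    `|x - x'|) (upd y j x')) /avg -RintegralD//=; last 2 first.
  - exact: integrable_slice.
  - exact: (integrable_slice (f := fun=> L * `|x - x'|) i (upd y j x') (good_cst _)).
  apply: le_Rintegral => //.
  - exact: integrable_slice.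
  - apply: (integrable_slice (f := fun z => f z + L * `|x - x'|) i (upd y j x')).
    by apply: goodD => //; exact: good_cst.
  - move=> z _; rewrite -lerBlDl (le_trans (ler_norm _))//.
    have ji : j != i by rewrite eq_sym.
    by rewrite (updC y x z ji) (updC y x' z ji) Lf.
move=> x x'; rewrite ler_norml; apply/andP; split.
- by rewrite lerBrDl lerBlDr distrC half.
- by rewrite lerBlDl half.
Qed.

(** The variance of f along a coordinate is at most the mean square distance
    of f to its value at 0, which the Lipschitz bound compares with the second
    moment of that coordinate. *)
Lemma avg_variance_le L i f y : good f -> coord_lipschitz L f ->
  avg i (fun z => f z ^+ 2) y - avg i f y ^+ 2 <= L ^+ 2 * s ^+ 2.
Proof.
move=> gf Lf; set a := f (upd y i 0).
have gs : good (fun z => (f z - a) ^+ 2).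
  by apply: goodX; apply: goodB => //; exact: good_cst.
have le1 : avg i (fun z => (f z - a) ^+ 2) y <= L ^+ 2 * s ^+ 2.
  rewrite -(avg_coord_sqr i y) -avgZ; last by apply: goodX; exact: good_coord.
  apply: avg_le => //; first by apply: goodZ; apply: goodX; exact: good_coord.
  move=> x; rewrite upd_same -exprMn -[leLHS]real_normK ?num_real//.
  rewrite -[leRHS]real_normK ?num_real// lerXn2r ?nnegrE// normrM.
  have := Lf i y x 0; rewrite subr0 => /le_trans; apply.
  by rewrite ler_wpM2r// ler_norm.
have E1 : avg i (fun z => (f z - a) ^+ 2) y =
    avg i (fun z => f z ^+ 2) y - 2 * a * avg i f y + a ^+ 2.
  rewrite -(avg_cst i (a ^+ 2) y) -avgZ// -avgB -?avgD.
  - by rewrite /avg; apply: eq_Rintegral => x _; ring.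
  - apply: goodB; [exact: goodX|exact: goodZ].
  - exact: good_cst.
  - exact: goodX.
  - exact: goodZ.
apply: le_trans le1; rewrite E1 -subr_ge0.
have -> : avg i (fun z => f z ^+ 2) y - 2 * a * avg i f y + a ^+ 2 -
  (avg i (fun z => f z ^+ 2) y - avg i f y ^+ 2) = (avg i f y - a) ^+ 2 by ring.
exact: sqr_ge0.
Qed.

Definition avgs (r : seq I) f := foldr avg f r.

(** Martingale decomposition: averaging over one more coordinate lowers the
    second moment by at most the variance along this coordinate. *)
Lemma avgsP L r f : good f -> coord_lipschitz L f ->
  [/\ good (avgs r f), coord_lipschitz L (avgs r f), Eg (avgs r f) = Eg f &
    Eg (fun y => f y ^+ 2) - Eg (fun y => avgs r f y ^+ 2) <=
      (size r)%:R * (L ^+ 2 * s ^+ 2)].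
Proof.
move=> gf Lf; elim: r => [|i r [gh Lh Eh vh]] /=.
  by split => //; rewrite subrr mul0r.
split; [exact: good_avg|exact: coord_lipschitz_avg|by rewrite Eg_avg|].
have gh2 : good (fun y => avgs r f y ^+ 2) by exact: goodX.
have : Eg (fun y => avgs r f y ^+ 2) - Eg (fun y => avg i (avgs r f) y ^+ 2) <=
  L ^+ 2 * s ^+ 2.
  rewrite -(Eg_avg i gh2) -EgB; [|exact: good_avg|exact/goodX/good_avg].
  rewrite -[leRHS]Eg_cst; apply: Eg_le.
  - by apply: goodB; [exact: good_avg|exact/goodX/good_avg].
  - exact: good_cst.
  - by move=> y; exact: avg_variance_le.
by move: vh; rewrite -natr1 mulrDl mul1r; lra.
Qed.

Lemma avgs_dep r f y y' : (forall j, j \notin r -> y j = y' j) ->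
  avgs r f y = avgs r f y'.
Proof.
elim: r y y' => [|i r IHr] y y' /= yy'.
  by congr f; apply/funext => j; exact: yy'.
rewrite /avg; apply: eq_Rintegral => x _; apply: IHr => j jr.
rewrite /upd; have [//|ji] := eqVneq j i.
by apply: yy'; rewrite inE negb_or ji.
Qed.

(** Once all coordinates have been averaged the function is constant, equal to
    the mean, so the total loss of second moment is the variance. *)
Lemma efron_stein L f : good f -> coord_lipschitz L f ->
  Eg (fun y => f y ^+ 2) - Eg f ^+ 2 <= #|I|%:R * (L ^+ 2 * s ^+ 2).
Proof.
move=> gf Lf; have [_ _ EE] := avgsP (enum I) gf Lf.
have cE : avgs (enum I) f = fun=> avgs (enum I) f (fun=> 0).
  by apply/funext => y; apply: avgs_dep => j; rewrite mem_enum.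
by move: EE; rewrite cE !Eg_cst -cardE => <-.
Qed.

End gaussian_expectation.

(** * Partial derivatives and Gibbs averages *)

Section partial_derivatives.
Context {R : realType} {I : finType}.
Implicit Types f h m : (I -> R) -> R.

(** The derivative is given together with the regularity that Gaussian
    integration by parts asks for, so that derivatives can be composed by the
    rules below without proving regularity again. *)
Definition partial (i : I) f f' :=
  [/\ good f, good f',
      forall y (x : R), is_derive x 1 (fun x => f (upd y i x)) (f' (upd y i x)) &
      forall y, continuous (fun x => f' (upd y i x))].

Lemma partial_continuous i f f' y : partial i f f' ->
  continuous (fun x => f (upd y i x)).
Proof.
move=> [_ _ df _] x; apply: differentiable_continuous.
by apply/derivable1_diffP; have [] := df y x.
Qed.

Lemma partial_indep i m : good m -> (forall y x, m (upd y i x) = m y) ->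
  partial i m (fun=> 0).
Proof.
move=> gm mi; split => //; first exact: good_cst.
- by move=> y x; under eq_fun do rewrite mi; exact: is_derive_cst.
- by move=> y x; exact: cvg_cst.
Qed.

Lemma partialD i f f' h h' : partial i f f' -> partial i h h' ->
  partial i (fun y => f y + h y) (fun y => f' y + h' y).
Proof.
move=> [gf gf' df cf] [gh gh' dh ch]; split; [exact: goodD|exact: goodD|..].
- by move=> y x; have := df y x; have := dh y x => ? ?; exact: is_deriveD.
- by move=> y x; apply: cvgD; [exact: cf|exact: ch].
Qed.

Lemma partialM i f f' h h' : partial i f f' -> partial i h h' ->
  partial i (fun y => f y * h y) (fun y => f y * h' y + f' y * h y).
Proof.
move=> pf ph.
have cf' y := partial_continuous (y := y) pf; have ch' y := partial_continuous (y := y) ph.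
move: pf ph => [gf gf' df cf] [gh gh' dh ch]; split; [exact: goodM| |..].
- by apply: goodD; exact: goodM.
- move=> y x; have := df y x; have := dh y x => ? ?.
  by apply: is_derive_eq; rewrite /GRing.scale/= [f' _ * _]mulrC.
- move=> y x; apply: cvgD; apply: cvgM; [exact: cf'|exact: ch|exact: cf|exact: ch'].
Qed.

Lemma partial_eq i f f' h h' : partial i f f' -> f =1 h -> f' =1 h' ->
  partial i h h'.
Proof. by move=> pf /funext <- /funext <-. Qed.

Lemma partialZ i a f f' : partial i f f' ->
  partial i (fun y => a * f y) (fun y => a * f' y).
Proof.
move=> pf.
have pa : partial i (fun=> a) (fun=> 0) by apply: partial_indep => //; exact: good_cst.
apply: (partial_eq (partialM pa pf)) => // y; by rewrite mul0r addr0.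
Qed.

Lemma partial_sum (J : Type) (r : seq J) i (F F' : J -> (I -> R) -> R) :
  (forall j, partial i (F j) (F' j)) ->
  partial i (fun y => \sum_(j <- r) F j y) (fun y => \sum_(j <- r) F' j y).
Proof.
move=> pF; elim: r => [|j r IHr].
  apply: (@partial_eq _ (fun=> 0) (fun=> 0)) => [|y|y]; last 2 first.
  - by rewrite big_nil.
  - by rewrite big_nil.
  by apply: partial_indep => //; exact: good_cst.
by apply: (partial_eq (partialD (pF j) IHr)) => y; rewrite big_cons.
Qed.

Lemma partial_expR_linear i (t : I -> R) :
  partial i (fun y => expR (\sum_j t j * y j)) (fun y => t i * expR (\sum_j t j * y j)).
Proof.
have gE := good_expR_linear t.
have lin y x : \sum_j t j * upd y i x j = t i * x + \sum_(j | j != i) t j * y j.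
  rewrite (bigD1 i)//= upd_same; congr (_ + _).
  by apply: eq_bigr => j ji; rewrite upd_other.
have dE y (x : R) : is_derive x 1 (fun x => expR (\sum_j t j * upd y i x j))
    (t i * expR (\sum_j t j * upd y i x j)).
  rewrite (_ : (fun x => _) = (fun x => expR (t i * x + \sum_(j | j != i) t j * y j)));
    last first.
    by apply/funext => z; rewrite lin.
  by apply: is_derive_eq; rewrite lin /GRing.scale/=; ring.
have cE y : continuous (fun x => expR (\sum_j t j * upd y i x j)).
  move=> x; apply: differentiable_continuous.
  by apply/derivable1_diffP; have [] := dE y x.
split => //; first exact: goodZ.
by move=> y x; apply: cvgM; [exact: cvg_cst|exact: cE].
Qed.

End partial_derivatives.

Section gibbs_measure.
Context {R : realType} {I S : finType}.
Variables (chi : I -> S -> R) (o : S).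
Hypothesis chi2 : forall i x, chi i x ^+ 2 = 1.
Implicit Types (y : I -> R) (a : S -> R).

(** The Hamiltonian is an arbitrary linear combination of characters chi i,
    with values in {-1, 1} (hypothesis chi2) on a finite set of configurations;
    the point o witnesses that this set is inhabited. *)
Definition energy y x := \sum_i chi i x * y i.
Definition weighted_sum a y := \sum_x a x * expR (energy y x).
Definition partition_sum y := weighted_sum (fun=> 1) y.
Definition gibbs a y := weighted_sum a y / partition_sum y.
Definition free_energy y := ln (partition_sum y).

Lemma partition_sum_gt0 y : 0 < partition_sum y.
Proof.
rewrite /partition_sum /weighted_sum (bigD1 o)//= mul1r.
by rewrite ltr_pwDl ?expR_gt0// sumr_ge0// => x _; rewrite mul1r expR_ge0.
Qed.

Lemma partition_sum_neq0 y : partition_sum y != 0.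
Proof. by rewrite gt_eqF// partition_sum_gt0. Qed.

Lemma chi_norm i x : `|chi i x| = 1.
Proof. by apply/eqP; rewrite -(@pexpr_eq1 _ _ 2)// real_normK ?num_real// chi2. Qed.

Lemma energy_norm y x : `|energy y x| <= l1 y.
Proof.
rewrite (le_trans (ler_norm_sum _ _ _))//; apply: ler_sum => i _.
by rewrite normrM chi_norm mul1r.
Qed.

Lemma gibbs_cst c y : gibbs (fun=> c) y = c.
Proof.
rewrite /gibbs /weighted_sum -mulr_sumr -mulrA.
have -> : \sum_x expR (energy y x) = partition_sum y.
  by apply: eq_bigr => x _; rewrite mul1r.
by rewrite divff ?mulr1// partition_sum_neq0.
Qed.

Lemma gibbsD a b y : gibbs (fun x => a x + b x) y = gibbs a y + gibbs b y.
Proof.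
rewrite /gibbs -mulrDl; congr (_ / _); rewrite /weighted_sum -big_split/=.
by apply: eq_bigr => x _; rewrite mulrDl.
Qed.

Lemma gibbsZ c a y : gibbs (fun x => c * a x) y = c * gibbs a y.
Proof.
rewrite /gibbs mulrA; congr (_ / _); rewrite /weighted_sum mulr_sumr.
by apply: eq_bigr => x _; rewrite mulrA.
Qed.

Lemma gibbs_sum (J : Type) (r : seq J) (p : pred J) (a : J -> S -> R) y :
  gibbs (fun x => \sum_(j <- r | p j) a j x) y = \sum_(j <- r | p j) gibbs (a j) y.
Proof.
elim: r => [|j r IHr].
  by rewrite big_nil -[RHS](gibbs_cst 0 y); congr gibbs; apply/funext => x; rewrite big_nil.
rewrite big_cons -IHr; case: ifP => pj.
  by rewrite -gibbsD; congr gibbs; apply/funext => x; rewrite big_cons pj.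
by congr gibbs; apply/funext => x; rewrite big_cons pj.
Qed.

Lemma gibbs_le a b y : (forall x, a x <= b x) -> gibbs a y <= gibbs b y.
Proof.
move=> ab; rewrite /gibbs ler_pM2r ?invr_gt0 ?partition_sum_gt0//.
by apply: ler_sum => x _; rewrite ler_wpM2r ?expR_ge0.
Qed.

Lemma gibbs_norm_le a M y : (forall x, `|a x| <= M) -> `|gibbs a y| <= M.
Proof.
move=> aM; rewrite ler_norml; apply/andP; split.
- rewrite -(gibbs_cst (- M) y); apply: gibbs_le => x.
  by have := aM x; rewrite ler_norml => /andP[].
- rewrite -(gibbs_cst M y); apply: gibbs_le => x.
  by have := aM x; rewrite ler_norml => /andP[].
Qed.

Lemma partial_weighted_sum i a :
  partial i (weighted_sum a) (weighted_sum (fun x => a x * chi i x)).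
Proof.
rewrite /weighted_sum.
apply: (partial_eq (partial_sum _ (fun x =>
  partialZ (a x) (partial_expR_linear i (chi ^~ x))))) => // y.
by apply: eq_bigr => x _; rewrite mulrA.
Qed.

Lemma good_weighted_sum a : good (weighted_sum a).
Proof. by apply: good_sum => x; apply: goodZ; exact: good_expR_linear. Qed.

Lemma meas_free_energy : meas free_energy.
Proof. by apply: meas_comp => //; exact: (good_weighted_sum _).1. Qed.

Lemma inv_partition_sum y : (partition_sum y)^-1 = expR (- free_energy y).
Proof. by rewrite expRN lnK// posrE partition_sum_gt0. Qed.

Lemma meas_inv_partition_sum : meas (fun y => (partition_sum y)^-1).
Proof.
rewrite (_ : (fun y => _) = (fun y => expR (- free_energy y))); last first.
  by apply/funext => y; exact: inv_partition_sum.
apply: (meas_comp (p := fun x => expR (- x))); last exact: meas_free_energy.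
by apply: measurableT_comp.
Qed.

Lemma good_gibbs a : good (gibbs a).
Proof.
apply: (@good_bounded _ _ _ (\sum_x `|a x|)).
  apply: measM; [exact: (good_weighted_sum _).1|exact: meas_inv_partition_sum].
move=> y; apply: gibbs_norm_le => x.
by rewrite (bigD1 x)//= lerDl sumr_ge0.
Qed.

Lemma partition_sum_bounds y :
  #|S|%:R * expR (- l1 y) <= partition_sum y <= #|S|%:R * expR (l1 y).
Proof.
have E c : #|S|%:R * c = \sum_(x : S) c :> R.
  by rewrite sumr_const mulr_natl.
rewrite !E; apply/andP; split; apply: ler_sum => x _; rewrite mul1r ler_expR.
- by rewrite lerNl (le_trans _ (energy_norm y x))// -normrN ler_norm.
- by rewrite (le_trans _ (energy_norm y x))// ler_norm.
Qed.

Let S_gt0 : 0 < #|S|%:R :> R.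
Proof. by rewrite ltr0n; apply/card_gt0P; exists o. Qed.

Lemma good_free_energy : good free_energy.
Proof.
split; first exact: meas_free_energy.
have gl : exp_growth l1 (fun y : I -> R => `|ln #|S|%:R| + l1 y).
  apply: exp_growthD; [exact: l1_ge0|exact: exp_growth_cst|].
  by apply: exp_growth_size => y; rewrite ger0_norm// l1_ge0.
apply: exp_growth_le gl => y.
rewrite [leRHS]ger0_norm ?addr_ge0 ?l1_ge0//.
have /andP[lb ub] := partition_sum_bounds y.
have lnE t : ln (#|S|%:R * expR t) = ln #|S|%:R + t :> R.
  by rewrite lnM ?posrE ?expR_gt0// expRK.
have : ln (#|S|%:R * expR (- l1 y)) <= free_energy y.
  by rewrite ler_ln ?posrE ?mulr_gt0 ?expR_gt0 ?partition_sum_gt0.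
have : free_energy y <= ln (#|S|%:R * expR (l1 y)).
  by rewrite ler_ln ?posrE ?mulr_gt0 ?expR_gt0 ?partition_sum_gt0.
rewrite !lnE => {}ub {}lb.
have := ler_norm (ln (#|S|%:R : R)); have := ler_norm (- ln (#|S|%:R : R)).
rewrite normrN ler_norml => h1 h2; apply/andP; split; lra.
Qed.

Lemma energy_upd y i z x : energy (upd y i z) x =
  chi i x * z + \sum_(j | j != i) chi j x * y j.
Proof.
rewrite /energy (bigD1 i)//= upd_same; congr (_ + _).
by apply: eq_bigr => j ji; rewrite upd_other.
Qed.

(** Changing one coordinate by t changes every exponent by at most |t|. *)
Lemma coord_lipschitz_free_energy : coord_lipschitz 1 free_energy.
Proof.
move=> i y.
have half z z' : free_energy (upd y i z) <= free_energy (upd y i z') + `|z - z'|.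
  rewrite -[`|_|]expRK -lnM ?posrE ?expR_gt0 ?partition_sum_gt0//.
  rewrite ler_ln ?posrE ?mulr_gt0 ?expR_gt0 ?partition_sum_gt0//.
  rewrite mulr_suml; apply: ler_sum => x _.
  rewrite !mul1r -expRD ler_expR !energy_upd addrAC lerD2r -lerBlDl -mulrBr.
  by rewrite (le_trans (ler_norm _))// normrM chi_norm mul1r.
move=> z z'; rewrite mul1r ler_norml; apply/andP; split.
- by rewrite lerBrDl lerBlDr distrC half.
- by rewrite lerBlDl half.
Qed.

(** The derivative of a Gibbs average is a covariance: this single rule
    generates the whole cumulant expansion. *)
Lemma partial_gibbs i a : partial i (gibbs a)
  (fun y => gibbs (fun x => a x * chi i x) y - gibbs a y * gibbs (chi i) y).
Proof.
have [_ _ da ca] := partial_weighted_sum i a.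
have [_ _ dz cz] := partial_weighted_sum i (fun=> 1).
split; first exact: good_gibbs.
- by apply: goodB; [exact: good_gibbs|apply: goodM; exact: good_gibbs].
- move=> y x; have zn := partition_sum_neq0 (upd y i x).
  have dax := da y x; have dzx := dz y x.
  have dV := @is_deriveV _ _ _ _ _ zn dzx.
  apply: (is_derive_eq (is_deriveM dax dV)); rewrite /gibbs /GRing.scale/=.
  have -> : weighted_sum (fun x0 => 1 * chi i x0) (upd y i x) =
    weighted_sum (chi i) (upd y i x).
    by apply: eq_bigr => z _; rewrite mul1r.
  rewrite -/(partition_sum _); move: zn; set p := partition_sum _ => zn.
  by field.
- have ca' b y := partial_continuous (y := y) (partial_weighted_sum i b).
  have cg b y : continuous (fun x => gibbs b (upd y i x)).
    move=> x; apply: cvgM; first exact: ca'.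
    by apply: cvgV; [exact: partition_sum_neq0|exact: ca'].
  by move=> y x; apply: cvgB; [exact: cg|apply: cvgM; exact: cg].
Qed.

Lemma partial_free_energy i : partial i free_energy (gibbs (chi i)).
Proof.
have [_ _ dz cz] := partial_weighted_sum i (fun=> 1).
have pg y := partial_continuous (y := y) (partial_gibbs i (chi i)).
split; [exact: good_free_energy|exact: good_gibbs| |by move=> y; exact: pg].
move=> y x.
have dzx := dz y x.
have z0 := partition_sum_gt0 (upd y i x).
have dl := is_derive1_ln z0.
apply: (is_derive_eq (is_derive1_comp dl dzx)); rewrite /gibbs mulrC; congr (_ / _).
by apply: eq_bigr => z _; rewrite mul1r.
Qed.

End gibbs_measure.

(** * Mean overlap from the convexity of the free energy *)

Section high_temperature_overlap.
Context {R : realType} {I S : finType} d (T : measurableType d) (P : probability T R).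
Variables (s : R) (g : I -> {RV P >-> R}) (chi : I -> S -> R) (o : S).
Hypothesis s0 : 0 < s.
Hypothesis gdist : forall i (A : set R), measurable A ->
  distribution P (g i) A = normal_prob 0 s A.
Hypothesis gind : mutually_independent [set: I]%SET g.
Hypothesis chi2 : forall i x, chi i x ^+ 2 = 1.
Local Notation Eg := (Eg g).
Local Notation F := (free_energy chi).
Local Notation Z := (partition_sum chi).
Local Notation H := (energy chi).

Definition scale (b : R) (y : I -> R) : I -> R := fun i => b * y i.

Lemma good_scale b (f : (I -> R) -> R) : good f -> good (fun y => f (scale b y)).
Proof.
move=> [mf [K [c [K0 c0 fK]]]]; split.
  move=> d' U u mu; apply: (mf _ U (fun i w => b * u i w)) => i.
  exact: measurable_funM.
exists K, (c * `|b|); split; rewrite ?mulr_ge0// => y.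
rewrite (le_trans (fK _))// ler_wpM2l// ler_expR -mulrA ler_wpM2l//.
by rewrite mulr_sumr; apply: ler_sum => i _; rewrite normrM.
Qed.

Let gF : good F. Proof. exact: (good_free_energy o chi2). Qed.
Let gZ : good Z. Proof. exact: good_weighted_sum. Qed.
Let gG a : good (gibbs chi a). Proof. exact: (good_gibbs chi o). Qed.
Let Z0 y : 0 < Z y. Proof. exact: (partition_sum_gt0 chi o). Qed.

Definition mean_energy y := \sum_i y i * gibbs chi (chi i) y.

Lemma mean_energyE y : mean_energy y * Z y = \sum_x H y x * expR (H y x).
Proof.
rewrite /mean_energy mulr_suml.
under eq_bigr do rewrite /gibbs -mulrA divfK ?gt_eqF// /weighted_sum mulr_sumr.
rewrite exchange_big/=; apply: eq_bigr => x _.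
by rewrite /energy mulr_suml; apply: eq_bigr => i _; rewrite mulrA [_ * y i]mulrC.
Qed.

Lemma good_mean_energy : good mean_energy.
Proof. by apply: good_sum => i; apply: goodM => //; exact: good_coord. Qed.

(** Integration by parts in each coordinate. This is where the squares of the
    brackets, that is, the overlap of two replicas, enter. *)
Lemma Eg_mean_energy :
  Eg mean_energy = s ^+ 2 * \sum_i (1 - Eg (fun y => gibbs chi (chi i) y ^+ 2)).
Proof.
rewrite (Eg_sum s0 gdist gind); last by move=> i; apply: goodM => //; exact: good_coord.
rewrite mulr_sumr; apply: eq_bigr => i _.
have [_ gp dp cp] := partial_gibbs chi o i (chi i).
rewrite (gaussian_ibp s0 gdist gind (gG _) gp dp cp); congr (_ * _).
rewrite -[X in _ = X - _](Eg_cst g 1) -(EgB s0 gdist gind).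
- congr Eg; apply/funext => y; rewrite -[in RHS](gibbs_cst chi o 1 y); congr (_ - _).
  by congr (gibbs _ _ _); apply/funext => x; rewrite -expr2 chi2.
- exact: good_cst.
- exact: goodX.
Qed.

(** Convexity of the free energy in the inverse temperature: its graph lies
    above the tangent at 1, whose slope is the mean energy. The proof applies
    1 + t <= expR t under the Gibbs measure. *)
Lemma free_energy_tangent b y : F y - b * mean_energy y <= F (scale (1 - b) y).
Proof.
move: (mean_energy y) (mean_energyE y) => m mE.
rewrite -[_ - _]expRK ler_ln ?posrE ?expR_gt0//.
rewrite expRD lnK ?posrE//.
have tangent x : expR (H y x) * (1 - b * (H y x - m)) * expR (- (b * m)) <=
  1 * expR (H (scale (1 - b) y) x).
  have -> : H (scale (1 - b) y) x = H y x + (- (b * (H y x - m)) + - (b * m)).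
    have -> : H (scale (1 - b) y) x = (1 - b) * H y x.
      by rewrite /energy mulr_sumr; apply: eq_bigr => i _; rewrite /scale mulrCA.
    by ring.
  rewrite mul1r !expRD mulrA ler_wpM2r ?expR_ge0// ler_wpM2l ?expR_ge0//.
  exact: expR_ge1Dx.
apply: le_trans (ler_sum _ (fun x _ => tangent x)).
rewrite -mulr_suml ler_wpM2r ?expR_ge0//.
have -> : \sum_x expR (H y x) * (1 - b * (H y x - m)) =
   (1 + b * m) * Z y - b * \sum_x H y x * expR (H y x).
  rewrite /partition_sum /weighted_sum !mulr_sumr -sumrB; apply: eq_bigr => x _; ring.
rewrite -mE.
have -> : (1 + b * m) * Z y - b * (m * Z y) = Z y by ring.
by [].
Qed.

Let z (b : R) := #|S|%:R * expR (s ^+ 2 * b ^+ 2 * #|I|%:R / 2).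

Let S_gt0 : 0 < #|S|%:R :> R.
Proof. by rewrite ltr0n; apply/card_gt0P; exists o. Qed.

Let z_gt0 b : 0 < z b.
Proof. by rewrite mulr_gt0 ?expR_gt0. Qed.

Lemma Eg_partition_sum b : Eg (fun y => Z (scale b y)) = z b.
Proof.
rewrite /partition_sum /weighted_sum (Eg_sum s0 gdist gind); last first.
  move=> x; apply: (good_scale b (f := fun y => 1 * expR (H y x))).
  by apply: goodZ; exact: good_expR_linear.
rewrite /z -sum1_card natr_sum mulr_suml; apply: eq_bigr => x _.
rewrite mul1r.
have -> : (fun y => 1 * expR (H (scale b y) x)) = (fun y =>
  expR (\sum_i (b * chi i x) * y i)).
  apply/funext => y; rewrite mul1r /energy; congr expR; apply: eq_bigr => i _.
  by rewrite /scale mulrCA mulrA.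
rewrite (Eg_expR_linear s0 gdist gind); congr expR.
under eq_bigr do rewrite exprMn chi2 mulr1.
by rewrite sumr_const -mulr_natl; field.
Qed.

(** Jensen's inequality: ln lies below its tangent at the mean z b. *)
Lemma Eg_free_energy_le b : Eg (fun y => F (scale b y)) <= ln (z b).
Proof.
have gFb : good (fun y => F (scale b y)) by exact: good_scale.
have gZb : good (fun y => Z (scale b y)) by exact: good_scale.
have -> : ln (z b) = Eg (fun y => ln (z b) - 1 + (z b)^-1 * Z (scale b y)).
  rewrite (EgD s0 gdist gind) ?Eg_cst ?(EgZ s0 gdist gind)//; last 2 first.
  - exact: good_cst.
  - exact: goodZ.
  by rewrite Eg_partition_sum mulVf ?gt_eqF// subrK.
apply: (Eg_le s0 gdist gind) => //.
  by apply: goodD; [exact: good_cst|exact: goodZ].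
move=> y.
have : -1 < Z (scale b y) / z b - 1 by rewrite ltrBrDl subrr divr_gt0.
move=> /le_ln1Dx; rewrite addrC subrK ln_div ?posrE// [(z b)^-1 * _]mulrC -/(F _); lra.
Qed.

(** The ratio of the second moment of the partition function to the square of
    its mean. *)
Definition second_moment_ratio : R :=
  (#|S|%:R ^- 2) * \sum_x \sum_x' expR (s ^+ 2 * \sum_i chi i x * chi i x').

Lemma Eg_partition_sum_sqr :
  Eg (fun y => Z y ^+ 2) = second_moment_ratio * z 1 ^+ 2.
Proof.
have E y : Z y ^+ 2 = \sum_x \sum_x' expR (\sum_i (chi i x + chi i x') * y i).
  rewrite expr2 {1}/partition_sum /weighted_sum mulr_suml; apply: eq_bigr => x _.
  rewrite mul1r mulr_sumr; apply: eq_bigr => x' _; rewrite mul1r -expRD.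
  by congr expR; rewrite -big_split; apply: eq_bigr => i _; rewrite mulrDl.
have -> : (fun y => Z y ^+ 2) = (fun y => \sum_x \sum_x' expR (\sum_i (chi i x +
  chi i x') * y i)).
  by apply/funext.
rewrite (Eg_sum s0 gdist gind); last first.
  by move=> x; apply: good_sum => x'; exact: good_expR_linear.
have Sn0 : #|S|%:R != 0 :> R by rewrite gt_eqF.
rewrite /second_moment_ratio /z; set E2 := \sum_x _; set c := expR _.
have -> : #|S|%:R ^- 2 * E2 * (#|S|%:R * c) ^+ 2 = E2 * c ^+ 2 by field.
rewrite /E2 mulr_suml; apply: eq_bigr => x _.
rewrite (Eg_sum s0 gdist gind) => [|x']; last exact: good_expR_linear.
rewrite mulr_suml; apply: eq_bigr => x' _.
rewrite (Eg_expR_linear s0 gdist gind) /c -expRM_natl -expRD; congr expR.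
have -> : \sum_i (chi i x + chi i x') ^+ 2 = 2 * #|I|%:R + 2 * \sum_i chi i x * chi i x'.
  rewrite -sum1_card natr_sum !mulr_sumr -big_split/=; apply: eq_bigr => i _.
  by rewrite sqrrD !chi2 mulr1; ring.
by field.
Qed.

(** Second moment method. If the mean of F were far below ln (z 1), then F would
    deviate much from its mean whenever Z is of the order of its own mean. By the
    bound on the second moment, the part of E Z that comes from the values of Z
    above z 1 / 2 is not carried by events of small probability, whereas the
    Efron-Stein inequality makes large deviations of F unlikely. *)
Lemma Eg_free_energy_ge :
  ln (z 1) - ln 2 - 2 * Num.sqrt (second_moment_ratio * (#|I|%:R * s ^+ 2)) <= Eg F.
Proof.
set kap := second_moment_ratio; set V := #|I|%:R * s ^+ 2.
set m := Eg F; set r := ln (z 1) - ln 2 - m.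
suff : r <= 2 * Num.sqrt (kap * V) by rewrite /r; lra.
have kap0 : 0 <= kap.
  by rewrite mulr_ge0 ?invr_ge0 ?exprn_ge0// sumr_ge0// => x _;
    rewrite sumr_ge0// => x' _; exact: expR_ge0.
have [r0|r0] := lerP r 0; first by rewrite (le_trans r0)// mulr_ge0 ?sqrtr_ge0.
have gs : good (fun y => (F y - m) ^+ 2) by apply: goodX; apply: goodB => //;
  exact: good_cst.
have VF : Eg (fun y => (F y - m) ^+ 2) <= V.
  have := efron_stein s0 gdist gind gF (coord_lipschitz_free_energy o chi2).
  rewrite expr1n mul1r -/V -/m; apply: le_trans.
  have -> : (fun y => (F y - m) ^+ 2) = (fun y => F y ^+ 2 - 2 * m * F y + m ^+ 2).
    by apply/funext => y; ring.
  rewrite (EgD s0 gdist gind) ?Eg_cst ?(EgB s0 gdist gind) ?(EgZ s0 gdist gind) -/m//;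
    do ?[exact: good_cst|exact: goodX|exact: goodZ|apply: goodB => //;
      [exact: goodX|exact: goodZ]].
  by rewrite le_eqVlt; apply/orP; left; apply/eqP; ring.
have kap_gt0 : 0 < kap.
  rewrite mulr_gt0 ?invr_gt0 ?exprn_gt0// (bigD1 o)//= ltr_pwDl//.
    by rewrite (bigD1 o)//= ltr_pwDl ?expR_gt0// sumr_ge0// => x' _; exact: expR_ge0.
  by rewrite sumr_ge0// => x _; rewrite sumr_ge0// => x' _; exact: expR_ge0.
(* The weight l balances l E[Z^2] against E[(F - m)^2] / l. *)
pose l := r / (2 * z 1 * kap).
have l0 : 0 < l by apply: divr_gt0 => //; apply: mulr_gt0 => //; exact: mulr_gt0.
(* Where Z is below half its mean the first term suffices; elsewhere F - m is at
   least r, and the two squares dominate their product. *)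
have pw y : 2 * r * Z y <= r * z 1 + (l * Z y ^+ 2 + l^-1 * (F y - m) ^+ 2).
  have [Zs|Zb] := lerP (Z y) (z 1 / 2).
    have : 0 <= l * Z y ^+ 2 + l^-1 * (F y - m) ^+ 2.
      by rewrite addr_ge0// mulr_ge0 ?sqr_ge0 ?invr_ge0 ?ltW.
    have : r * (2 * Z y) <= r * z 1 by rewrite ler_pM2l//; lra.
    by lra.
  have rF : r <= F y - m.
    rewrite /r lerD2r -ln_div ?posrE// ler_ln ?posrE ?divr_gt0//; exact: ltW.
  have rFZ : 2 * r * Z y <= 2 * (F y - m) * Z y.
    by rewrite ler_pM2r// ler_pM2l.
  have : 0 <= (l * Z y - (F y - m)) ^+ 2 / l by rewrite divr_ge0 ?sqr_ge0 ?ltW.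
  have -> : (l * Z y - (F y - m)) ^+ 2 / l =
    l * Z y ^+ 2 + l^-1 * (F y - m) ^+ 2 - 2 * (F y - m) * Z y.
    by field; rewrite gt_eqF.
  have : 0 < r * z 1 by exact: mulr_gt0.
  by lra.
have : Eg (fun y => 2 * r * Z y) <= Eg (fun y =>
  r * z 1 + (l * Z y ^+ 2 + l^-1 * (F y - m) ^+ 2)).
  apply: (Eg_le s0 gdist gind) => //; first exact: goodZ.
  apply: goodD; first exact: good_cst.
  by apply: goodD; apply: goodZ => //; exact: goodX.
rewrite (EgZ s0 gdist gind)// (EgD s0 gdist gind) ?Eg_cst; last 2 first.
- exact: good_cst.
- by apply: goodD; apply: goodZ => //; exact: goodX.
rewrite (EgD s0 gdist gind) ?(EgZ s0 gdist gind)//; do ?[apply: goodZ => //;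
  exact: goodX|exact: goodX].
rewrite Eg_partition_sum_sqr -/kap.
have -> : Eg Z = z 1.
  rewrite -Eg_partition_sum; congr Eg; apply/funext => y; congr Z.
  by apply/funext => i; rewrite /scale mul1r.
have -> : l * (kap * z 1 ^+ 2) = r * z 1 / 2.
  by rewrite /l; field; rewrite ?gt_eqF.
have lV : l^-1 * Eg (fun y => (F y - m) ^+ 2) <= l^-1 * V by rewrite ler_pM2l// invr_gt0.
move=> h.
have {}h : r * z 1 / 2 <= l^-1 * V by lra.
have {}h : r ^+ 2 <= 4 * (kap * V).
  have e : l^-1 * V = 2 * z 1 * kap * V / r by rewrite /l invf_div mulrAC.
  move: h; rewrite e ler_pdivlMr// => h.
  have : r ^+ 2 * (z 1 / 2) <= 4 * (kap * V) * (z 1 / 2) by move: h; lra.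
  by rewrite ler_pM2r// divr_gt0.
rewrite -(@ler_pXn2r _ 2)// ?nnegrE ?mulr_ge0 ?sqrtr_ge0//; last exact: ltW.
have V0 : 0 <= V by rewrite mulr_ge0 ?sqr_ge0.
rewrite exprMn sqr_sqrtr; last exact: mulr_ge0.
by move: h; lra.
Qed.

(** The mean energy, which contains the mean squared brackets, is bounded from
    below by the tangent inequality between the inverse temperatures 1 - b and 1,
    where the mean free energy is known up to the error of Eg_free_energy_ge. *)
Lemma sum_bracket_sqr_le b : 0 < b ->
  s ^+ 2 * \sum_i Eg (fun y => gibbs chi (chi i) y ^+ 2) <=
  b * (#|I|%:R * s ^+ 2) / 2 +
  (ln 2 + 2 * Num.sqrt (second_moment_ratio * (#|I|%:R * s ^+ 2))) / b.
Proof.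
move=> b0.
have h1 : Eg (fun y => F y - b * mean_energy y) <= Eg (fun y => F (scale (1 - b) y)).
  apply: (Eg_le s0 gdist gind); last exact: free_energy_tangent.
    by apply: goodB => //; apply: goodZ; exact: good_mean_energy.
  exact: good_scale.
move: h1; rewrite (EgB s0 gdist gind)// ?(EgZ s0 gdist gind); last 2 first.
- exact: good_mean_energy.
- by apply: goodZ; exact: good_mean_energy.
rewrite Eg_mean_energy sumrB sumr_const.
move: (\sum_i _) => q h1.
have := Eg_free_energy_le (1 - b); have := Eg_free_energy_ge.
rewrite /z !lnM ?posrE ?expR_gt0// !expRK.
move: (Num.sqrt _) (Eg F) (Eg (fun y => F (scale (1 - b) y))) h1 => v A B h1 h2 h3.
rewrite -(ler_pM2r b0) mulrDl divfK ?gt_eqF//.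
move: h1 h2 h3; rewrite -mulr_natl mulr1.
move: #|I|%:R (ln #|S|%:R) => n lS; move: (s ^+ 2) => t.
rewrite expr1n.
have -> : (1 - b) ^+ 2 = 1 - 2 * b + b ^+ 2 by ring.
nra.
Qed.

End high_temperature_overlap.

(** * Joint cumulants of the Gibbs measure *)

Section joint_cumulants.

(** A formal monomial in brackets: a sign, true standing for -1, and a list of
    blocks. A block is a list of indices of edges and stands for the Gibbs average
    of the product of their characters. *)
Definition block_mono : Type := bool * seq (seq nat).

(** The Leibniz rule, with the derivative (i :: b) - b * (i) of a block b. *)
Fixpoint derive_blocks (i : nat) (m : seq (seq nat)) : seq block_mono :=
  if m is b :: r then
    (false, (i :: b) :: r) :: (true, b :: [:: i] :: r) ::
    [seq (t.1, b :: t.2) | t <- derive_blocks i r]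
  else [::].

Definition derive_mono (i : nat) (t : block_mono) : seq block_mono :=
  [seq (t.1 (+) u.1, u.2) | u <- derive_blocks i t.2].

Fixpoint full_block (k : nat) : seq nat :=
  if k is k'.+1 then k' :: full_block k' else [::].

(** The joint cumulant of k.+1 characters without its leading term: when the
    next derivative is taken, the full_block k yields full_block k.+1, which
    is kept apart, and a product, which joins the remainder. *)
Fixpoint remainder (k : nat) : seq block_mono :=
  if k is k'.+1 then
    (true, [:: full_block k; [:: k]]) :: flatten [seq derive_mono k t | t <- remainder k']
  else [::].

Lemma mem_full_block k j : (j \in full_block k) = (j < k)%N.
Proof. by elim: k => // k IHk; rewrite inE IHk ltnS [in RHS]leq_eqVlt. Qed.

Lemma full_block_uniq k : uniq (full_block k).
Proof. by elim: k => //= k ->; rewrite mem_full_block ltnn. Qed.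

(** A nonempty block which is not the whole cycle. It contains the index 0 and
    misses another one, so some edge of the cycle outside the block follows an
    edge inside it. *)
Definition proper_block (k : nat) (b : seq nat) :=
  [/\ 0%N \in b, uniq b, all (fun j => j <= k)%N b & exists2 j, (j <= k)%N & j \notin b].

Lemma size_derive_blocks i m : size (derive_blocks i m) = (2 * size m)%N.
Proof. by elim: m => //= b r IHr; rewrite size_map IHr mulnS. Qed.

Lemma derive_blocks_size i m t : t \in derive_blocks i m -> (size t.2 <= (size m).+1)%N.
Proof.
elim: m t => //= b r IHr t; rewrite !inE => /or3P[/eqP ->|/eqP ->|] //=.
by move=> /mapP[u ur ->] /=; rewrite ltnS IHr.
Qed.

Lemma derive_blocks_head i b r t : t \in derive_blocks i (b :: r) ->
  head [::] t.2 = b \/ head [::] t.2 = i :: b.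
Proof.
rewrite /= !inE => /or3P[/eqP ->|/eqP ->|/mapP[u _ ->]] /=; by [right|left].
Qed.

(** The first block of each monomial starts as some full_block j, without the
    index j, and can only grow by the index of the current derivative, so that j
    is missed forever. *)
Lemma remainderP k t : t \in remainder k ->
  (size t.2 <= k.+1)%N /\ proper_block k (head [::] t.2).
Proof.
elim: k t => // k IHk t; rewrite [remainder _]/= inE => /orP[/eqP -> /=|].
  split => //; split.
  - by rewrite (mem_full_block k.+1).
  - exact: (full_block_uniq k.+1).
  - by apply/allP => j; rewrite (mem_full_block k.+1) => /ltnW.
  - by exists k.+1 => //; rewrite (mem_full_block k.+1) ltnn.
move=> /flattenP[_ /mapP[u uk ->]] /mapP[w wu ->] /=.
have [su [u0 uu ule [j jk ju]]] := IHk _ uk.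
split; first by rewrite (leq_trans (derive_blocks_size wu)).
case: u {uk} u0 uu ule ju wu su => a [|b r] //= u0 uu ule ju wu su.
have kb : k.+1 \notin b.
  by apply/negP => /(allP ule); rewrite ltnn.
have ule' : all (fun j => j <= k.+1)%N b.
  by apply/allP => x /(allP ule) /leqW.
have [->|->] := derive_blocks_head wu; split => //.
- by exists j => //; exact: leqW.
- by rewrite /= kb.
- by rewrite /= leqnn.
- by exists j; [exact: leqW|rewrite inE negb_or ju andbT neq_ltn ltnS jk].
Qed.

(** The derivative of a product of at most k.+1 blocks has at most 2 (k+1)
    monomials. *)
Lemma size_remainder k : (size (remainder k) <= (2 * k.+1) ^ k)%N.
Proof.
elim: k => // k IHk; rewrite [remainder _]/= [size _]/= size_flatten /shape -map_comp.
have h (r : seq block_mono) : (forall t, t \in r -> (size t.2 <= k.+1)%N) ->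
    (sumn [seq (size \o derive_mono k.+1) t | t <- r] <= (2 * k.+1) * size r)%N.
  elim: r => [_|t r IHr tr]; first by rewrite muln0.
  rewrite /= mulnS leq_add//; last by apply: IHr => u ur; apply: tr; rewrite inE ur orbT.
  by rewrite size_map size_derive_blocks leq_mul2l/= tr// mem_head.
have := h (remainder k) (fun t tk => (remainderP tk).1).
move=> h1.
have h2 : ((2 * k.+1) * size (remainder k) <= (2 * k.+1) ^ k.+1)%N.
  by rewrite expnS leq_mul2l IHk orbT.
have h3 : ((2 * k.+1) ^ k.+1 < (2 * k.+2) ^ k.+1)%N.
  by rewrite ltn_exp2r// ltn_mul2l ltnSn.
exact: leq_ltn_trans (leq_trans h1 h2) h3.
Qed.

End joint_cumulants.

Section cumulant_expansion.
Context {R : realType} {I S : finType} d (T : measurableType d) (P : probability T R).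
Variables (s : R) (g : I -> {RV P >-> R}) (chi : I -> S -> R) (o : S).
Hypothesis s0 : 0 < s.
Hypothesis gdist : forall i (A : set R), measurable A ->
  distribution P (g i) A = normal_prob 0 s A.
Hypothesis gind : mutually_independent [set: I]%SET g.
Hypothesis chi2 : forall i x, chi i x ^+ 2 = 1.
Local Notation Eg := (Eg g).
Local Notation F := (free_energy chi).
Variable e : nat -> I.

Definition block_prod (b : seq nat) (x : S) : R := \prod_(j <- b) chi (e j) x.
Definition bracket (b : seq nat) y := gibbs chi (block_prod b) y.
Definition eval_blocks (m : seq (seq nat)) y := \prod_(b <- m) bracket b y.
Definition eval_poly (p : seq block_mono) y :=
  \sum_(t <- p) (-1) ^+ t.1 * eval_blocks t.2 y.
Definition cumulant (k : nat) y := bracket (full_block k.+1) y + eval_poly (remainder k) y.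

Lemma block_prod_norm b x : `|block_prod b x| = 1.
Proof.
rewrite normr_prod big1// => j _; exact: (chi_norm chi2).
Qed.

Lemma bracket_norm_le b y : `|bracket b y| <= 1.
Proof. by apply: (gibbs_norm_le chi o) => x; rewrite block_prod_norm. Qed.

Lemma partial_bracket i b :
  partial (e i) (bracket b) (fun y => bracket (i :: b) y - bracket b y * bracket [:: i] y).
Proof.
apply: (partial_eq (partial_gibbs chi o (e i) (block_prod b))) => // y.
congr (_ - _ * _); congr (gibbs _ _ _); apply/funext => x.
- by rewrite /block_prod big_cons mulrC.
- by rewrite /block_prod big_seq1.
Qed.

Lemma partial_eval_blocks i m :
  partial (e i) (eval_blocks m) (eval_poly (derive_blocks i m)).
Proof.
elim: m => [|b r IHr].
  apply: (@partial_eq _ _ _ (fun=> 1) (fun=> 0)) => [|y|y].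
  - by apply: partial_indep => //; exact: good_cst.
  - by rewrite /eval_blocks big_nil.
  - by rewrite /eval_poly big_nil.
apply: (partial_eq (partialM (partial_bracket i b) IHr)) => y.
  by rewrite /eval_blocks big_cons.
rewrite /eval_poly /= !big_cons big_map /eval_blocks !big_cons/=.
have -> : \sum_(t <- derive_blocks i r) (-1) ^+ t.1 * \prod_(c <- b :: t.2) bracket c y =
   bracket b y * \sum_(t <- derive_blocks i r) (-1) ^+ t.1 * \prod_(c <- t.2) bracket c y.
  by rewrite mulr_sumr; apply: eq_bigr => t _; rewrite big_cons mulrCA.
rewrite expr0 expr1 ?big_nil; ring.
Qed.

Lemma partial_eval_mono i (t : block_mono) :
  partial (e i) (fun y => (-1) ^+ t.1 * eval_blocks t.2 y) (eval_poly (derive_mono i t)).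
Proof.
apply: (partial_eq (partialZ ((-1) ^+ t.1) (partial_eval_blocks i t.2))) => // y.
rewrite /eval_poly mulr_sumr big_map; apply: eq_bigr => u _.
by rewrite signr_addb mulrA.
Qed.

Lemma partial_cumulant k : partial (e k.+1) (cumulant k) (cumulant k.+1).
Proof.
have p2 : partial (e k.+1) (eval_poly (remainder k))
    (fun y => \sum_(t <- remainder k) eval_poly (derive_mono k.+1 t) y).
  by apply: partial_sum => t; exact: partial_eval_mono.
apply: (partial_eq (partialD (partial_bracket k.+1 (full_block k.+1)) p2)) => // y.
rewrite /cumulant {2}/eval_poly [remainder k.+1]/= big_cons big_flatten big_map.
rewrite /eval_blocks big_cons big_seq1 expr1 -addrA mulN1r.
by congr (_ + (_ + _)).
Qed.

Lemma partial_free_energy_cumulant : partial (e 0) F (cumulant 0).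
Proof.
apply: (partial_eq (partial_free_energy o chi2 (e 0))) => // y.
rewrite /cumulant /eval_poly big_nil addr0; congr (gibbs _ _ _).
by apply/funext => x; rewrite /block_prod big_seq1.
Qed.

Lemma good_cumulant k : good (cumulant k).
Proof. by case: k => [|k]; [case: partial_free_energy_cumulant|case: (partial_cumulant
  k)]. Qed.

Lemma good_coord_prod (r : seq nat) : good (fun y : I -> R => \prod_(j <- r) y (e j)).
Proof. by apply: good_prod => j; exact: good_coord. Qed.

(** Integration by parts in a coordinate that occurs only once in the product. *)
Lemma ibp_step i (r : seq nat) f f' : partial (e i) f f' ->
  (forall j, j \in r -> e j != e i) ->
  Eg (fun y => f y * \prod_(j <- i :: r) y (e j)) =
  s ^+ 2 * Eg (fun y => f' y * \prod_(j <- r) y (e j)).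
Proof.
move=> pf er.
have pm : partial (e i) (fun y : I -> R => \prod_(j <- r) y (e j)) (fun=> 0).
  apply: partial_indep; first exact: good_coord_prod.
  by move=> y x; apply: eq_big_seq => j jr; rewrite upd_other ?er.
have [gh gh' dh ch] := partialM pf pm.
have -> : (fun y => f y * \prod_(j <- i :: r) y (e j)) =
    (fun y => y (e i) * (f y * \prod_(j <- r) y (e j))).
  by apply/funext => y; rewrite big_cons mulrCA.
rewrite (gaussian_ibp s0 gdist gind gh gh' dh ch); congr (_ * Eg _).
by apply/funext => y; rewrite mulr0 add0r.
Qed.

(** The successive coordinates are removed one at a time, each of them turning
    the current derivative of F into the next. *)
Lemma Eg_free_energy_prod k :
  (forall i j, (i <= k)%N -> (j <= k)%N -> e i = e j -> i = j) ->
  Eg (fun y => F y * \prod_(0 <= j < k.+1) y (e j)) = s ^+ (2 * k.+1) * Eg (cumulant k).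
Proof.
move=> einj.
have ne i j : (i < j)%N -> (j <= k)%N -> e j != e i.
  move=> ij jk; apply/eqP => eij.
  have ji := einj _ _ jk (leq_trans (ltnW ij) jk) eij.
  by move: ij; rewrite ji ltnn.
have iotaE j : (j <= k)%N -> index_iota j k.+1 = j :: index_iota j.+1 k.+1.
  by move=> jk; rewrite /index_iota subSS subSn.
have step j : (j <= k)%N ->
    Eg (fun y => F y * \prod_(0 <= j < k.+1) y (e j)) =
    s ^+ (2 * j.+1) * Eg (fun y => cumulant j y * \prod_(j.+1 <= l < k.+1) y (e l)).
  elim: j => [_|j IHj jk].
    rewrite iotaE//.
    rewrite (ibp_step partial_free_energy_cumulant)// => j.
    by rewrite mem_index_iota ltnS => /andP[j0 jk]; exact: ne.
  rewrite (IHj (ltnW jk)).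
  rewrite iotaE//.
  rewrite (ibp_step (partial_cumulant j)).
    by rewrite mulrA -exprD; congr (_ ^+ _ * _); rewrite [in RHS]mulnS addnC.
  by move=> l; rewrite mem_index_iota ltnS => /andP[jl lk]; exact: ne.
rewrite (step k)//; congr (_ * Eg _); apply/funext => y.
by rewrite big_geq// mulr1.
Qed.

(** When the characters of the whole cycle multiply to 1 the leading term is 1.
    In the other terms all factors but the first are bounded by 1. *)
Lemma cumulant_remainder_le k y : (forall x, block_prod (full_block k.+1) x = 1) ->
  1 - cumulant k y <= \sum_(t <- remainder k) `|bracket (head [::] t.2) y|.
Proof.
move=> full1.
have -> : cumulant k y = 1 + eval_poly (remainder k) y.
  rewrite /cumulant; congr (_ + _); rewrite -[RHS](gibbs_cst chi o 1 y).
  by congr (gibbs _ _ _); apply/funext => x; rewrite full1.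
rewrite opprD addrA subrr sub0r (le_trans (ler_norm _))// normrN.
rewrite (le_trans (ler_norm_sum _ _ _))//; apply: ler_sum => -[a m] _ /=.
rewrite normrM normrX normrN1 expr1n mul1r /eval_blocks.
case: m => [|b r] /=; first by rewrite big_nil /bracket /block_prod;
  under eq_fun do rewrite big_nil; rewrite (gibbs_cst chi o).
rewrite big_cons normrM ler_piMr// normr_prod.
by apply: prodr_ile1 => c _; rewrite normr_ge0 bracket_norm_le.
Qed.

End cumulant_expansion.

(** * Edges and cycles of the complete graph *)

Section edges.
Variable N : nat.

Definition edge := {p : 'I_N * 'I_N | (p.1 < p.2)%N}.

Variable e0 : edge.

(** The default value e0 is returned on the diagonal only. *)
Definition edge_of (a b : 'I_N) : edge :=
  insubd e0 (if (a < b)%N then (a, b) else (b, a)).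

Lemma val_edge_of a b : a != b ->
  val (edge_of a b) = if (a < b)%N then (a, b) else (b, a).
Proof.
move=> ab; rewrite val_insubd; have [ab'|ba] := ltnP a b => /=; first by rewrite ab'.
by rewrite ltn_neqAle ba andbT eq_sym ab.
Qed.

Lemma edge_ofP a b c d : a != b -> c != d -> edge_of a b = edge_of c d ->
  (a = c /\ b = d) \/ (a = d /\ b = c).
Proof.
move=> ab cd /(congr1 val); rewrite !val_edge_of//.
by case: ltnP => _; case: ltnP => _ [-> ->]; auto.
Qed.

Lemma sum_edge_of (R : realType) (f : edge -> R) :
  \sum_(a < N) \sum_(b < N | a != b) f (edge_of a b) = 2 * \sum_e f e.
Proof.
(* Ordered pairs a < b are the edges, and swapping a and b gives the other half. *)
have half : \sum_(a < N) \sum_(b < N | (a < b)%N) f (edge_of a b) = \sum_e f e.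
  rewrite pair_big_dep/= (reindex (val : edge -> _))/=; last first.
    exists (insubd e0) => [e _|p pP]; first by rewrite valKd.
    by rewrite insubdK.
  apply: eq_big => [e|e _]; first by rewrite (valP e).
  congr f; apply: val_inj; rewrite val_edge_of.
    by case: e => -[a b] /= ab; rewrite ab.
  by apply/eqP => h; have := valP e; rewrite h ltnn.
rewrite mulr_natl mulr2n -{1}half -half [X in _ =
  _ + X](exchange_big_dep xpredT)//= -big_split/=.
apply: eq_bigr => a _.
rewrite (bigID (fun b : 'I_N => (a < b)%N))/=; congr (_ + _).
  by apply: eq_bigl => b; rewrite andb_idl// ltn_neqAle => /andP[].
apply: eq_big => [b|b].
  by rewrite -leqNgt ltn_neqAle eq_sym.
move=> /andP[ab nab]; congr f; apply: val_inj; rewrite !val_edge_of// 1?eq_sym//.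
move: nab; case: ltngtP => // h _.
by move: ab; rewrite (val_inj h) eqxx.
Qed.

End edges.

Section cycles.
Variables (N m : nat) (e0 : edge N).
Hypothesis m2 : (2 <= m)%N.
Implicit Types v w : {ffun 'I_m.+1 -> 'I_N}.

Definition cycle_edge v (i : 'I_m.+1) := edge_of e0 (v i) (v (ordS i)).

Definition cycle_edges v := [set cycle_edge v i | i : 'I_m.+1].

Lemma ordS_val (i : 'I_m.+1) : ordS i = (if i == m :> nat then 0 else i.+1) :> nat.
Proof.
rewrite /=; case: eqP => [->|/eqP im]; first by rewrite modnn.
by rewrite modn_small// ltnS ltn_neqAle im -ltnS ltn_ord.
Qed.

Lemma ordS_neq (i : 'I_m.+1) : i != ordS i.
Proof.
apply/eqP => /(congr1 (@nat_of_ord m.+1)); rewrite ordS_val.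
by case: eqP => [im|_]; lia.
Qed.

Lemma ordSS_neq (i : 'I_m.+1) : i != ordS (ordS i).
Proof.
apply/eqP => /(congr1 (@nat_of_ord m.+1)); rewrite !ordS_val.
by do !case: eqP; lia.
Qed.

Lemma cycle_edge_neq v i : injective v -> v i != v (ordS i).
Proof. by move=> vi; rewrite (inj_eq vi) ordS_neq. Qed.

(** Two edges v i -- v (i+1) and v j -- v (j+1) that agree with opposite
    orientations would force i = i + 2, impossible on a cycle of length at least 3. *)
Lemma cycle_edge_inj v : injective v -> injective (cycle_edge v).
Proof.
move=> vi i j /edge_ofP; case; rewrite ?cycle_edge_neq//.
  by move=> [/vi].
move=> [/vi ij /vi ji]; have := ordSS_neq i; by rewrite ji -ij eqxx.
Qed.

Lemma card_cycle_edges v : injective v -> #|cycle_edges v| = m.+1.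
Proof. by move=> vi; rewrite card_imset ?card_ord//; exact: cycle_edge_inj. Qed.

(** Each further vertex is the neighbour of the last one which is not its
    predecessor. *)
Lemma cycle_determined v w : injective v -> injective w ->
  cycle_edges v = cycle_edges w -> v ord0 = w ord0 ->
  v (ordS ord0) = w (ordS ord0) -> v = w.
Proof.
move=> vi wi evw e0' e1'.
have step n : (n < m)%N -> v (inord n) = w (inord n) /\ v (inord n.+1) = w (inord n.+1).
  have inordS k : (k < m)%N -> inord k.+1 = ordS (inord k) :> 'I_m.+1.
    move=> km; apply: ord_inj; rewrite ordS_val !inordK ?ltnS//; last exact: ltnW.
    by rewrite ltn_eqF.
  elim: n => [_|n IHn nm].
    have -> : inord 0 = ord0 :> 'I_m.+1 by apply: val_inj; rewrite /= inordK.
    have -> : inord 1 = ordS ord0 :> 'I_m.+1.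
      by rewrite inordS ?(leq_trans _ m2)//; congr ordS; apply: val_inj; rewrite /= inordK.
    by [].
  have [E1 E2] := IHn (ltnW nm); split => //.
  rewrite inordS//; set i := inord n.+1 in E2 *.
  have iE : i = ordS (inord n) by rewrite /i inordS// ltnW.
  have : cycle_edge v i \in cycle_edges w by rewrite -evw imset_f.
  move=> /imsetP[j _ /edge_ofP]; case; rewrite ?cycle_edge_neq// => -[h1 h2].
    by rewrite h2; congr (w (ordS _)); apply: wi; rewrite -h1 E2.
  have : ordS j = i by apply: wi; rewrite -h1 E2.
  rewrite iE => /(can_inj (@ordSK _)) ji.
  move: h2; rewrite ji -E1 => /vi; rewrite iE => h.
  by have := ordSS_neq (inord n); rewrite h eqxx.
apply/ffunP => i.
have [im|im] := ltnP i m.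
  by have [] := step i im; rewrite inord_val.
have iE : i = inord m by apply: val_inj; rewrite /= inordK//; apply/eqP;
  rewrite eqn_leq im -ltnS ltn_ord.
have mS : m.-1.+1 = m by rewrite prednK// ltnW.
by have [|_] := step m.-1; rewrite mS// -iE.
Qed.

(** By cycle_determined, a labelling of the cycle is known from its first edge
    and the orientation of this edge. *)
Lemma card_same_cycle v : injective v ->
  (#|[set w : {ffun 'I_m.+1 -> 'I_N} | injectiveb w & cycle_edges w == cycle_edges v]|
    <= 2 * m.+1)%N.
Proof.
move=> vi; set A := [set w | _ & _].
pose f w : 'I_N * 'I_N := (w ord0, w (ordS ord0)).
have finj : {in A &, injective f}.
  move=> w w'; rewrite !inE => /andP[/injectiveP wi /eqP ew] /andP[/injectiveP wi' /eqP
    ew'] [h1 h2].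
  by apply: cycle_determined => //; rewrite ew ew'.
rewrite -(card_in_imset finj).
pose D := [set (v i, v (ordS i)) | i : 'I_m.+1] :|: [set (v (ordS i), v i) | i : 'I_m.+1].
apply: (@leq_trans #|D|).
  apply: subset_leq_card; apply/fintype.subsetP => _ /imsetP[w + ->].
  rewrite inE => /andP[/injectiveP wi /eqP ew].
  have : cycle_edge w ord0 \in cycle_edges v by rewrite -ew imset_f.
  move=> /imsetP[j _ /edge_ofP]; case; rewrite ?cycle_edge_neq// => -[h1 h2].
    by rewrite inE; apply/orP; left; apply/imsetP; exists j => //; rewrite /f h1 h2.
  by rewrite inE; apply/orP; right; apply/imsetP; exists j => //; rewrite /f h1 h2.
rewrite (leq_trans (leq_card_setU _ _))// mul2n -addnn leq_add//.
- by rewrite (leq_trans (leq_imset_card _ _))// card_ord.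
- by rewrite (leq_trans (leq_imset_card _ _))// card_ord.
Qed.

End cycles.

(** * Products of spins averaged over all cycles *)

Section block_averages.
Context {R : realType}.
Variables (N m : nat).

Lemma prod_block_ord (b : seq nat) (f : 'I_m.+1 -> R) : uniq b ->
  all (fun j => j <= m)%N b ->
  \prod_(i <- b) f (inord i) = \prod_(i < m.+1 | (i : nat) \in b) f i.
Proof.
move=> ub ble.
have pb : perm_eq b [seq i <- iota 0 m.+1 | i \in b].
  apply: uniq_perm => // [|i]; first by rewrite filter_uniq// iota_uniq.
  rewrite mem_filter mem_iota /= add0n ltnS.
  by case ib : (i \in b) => //=; rewrite (allP ble).
rewrite (perm_big _ pb) big_filter.
rewrite -[iota 0 m.+1]/(index_iota 0 m.+1) big_mkord.
by apply: eq_bigr => i _; rewrite inord_val.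
Qed.

(** Some vertex lies on exactly one edge of a proper block; as the sum over all
    v factorises over the vertices, its position contributes the factor
    \sum_a u a, and each of the m other vertices at most N. In the application u
    is the product of two replicas, and this factor is N times their overlap. *)
Lemma sum_block_prod_le (b : seq nat) (u : 'I_N -> R) :
  (forall a, `|u a| = 1) -> proper_block m b ->
  \sum_(v : {ffun 'I_m.+1 -> 'I_N})
     \prod_(i <- b) (u (v (inord i)) * u (v (ordS (inord i)))) <=
  N%:R ^+ m * `|\sum_a u a|.
Proof.
move=> u1 [b0 ub ble [j1 j1m j1b]].
(* j is the least index outside the block; the vertex v j lies on the edges j-1
   and j, of which only the first belongs to the block. *)
have [j [jm jb jpred]] : exists j, [/\ (0 < j <= m)%N, j \notin b & j.-1 \in b].
  have ex : exists j, j \notin b by exists j1.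
  have [j jb jmin] := ex_minnP ex.
  have j0 : (0 < j)%N by case: (j) jb => //; rewrite b0.
  exists j; split => //; first by rewrite j0 (leq_trans (jmin _ j1b)).
  by apply: contraT => /jmin; rewrite -ltnS prednK// ltnn.
(* The factors of the product are regrouped by vertices: v i occurs in the edges
   i and i - 1. *)
pose h (i : 'I_m.+1) (a : 'I_N) : R :=
  (if (i : nat) \in b then u a else 1) * (if (ord_pred i : nat) \in b then u a else 1).
have E (v : {ffun 'I_m.+1 -> 'I_N}) : \prod_(i <- b) (u (v (inord i)) *
  u (v (ordS (inord i)))) = \prod_(i < m.+1) h i (v i).
  rewrite (prod_block_ord (fun i => u (v i) * u (v (ordS i))))//.
  rewrite !big_split/=; congr (_ * _); first by rewrite big_mkcond.
  rewrite (reindex_inj (@ord_pred_inj _))/= big_mkcond/=.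
  by apply: eq_bigr => i _; rewrite ord_predK.
under eq_bigr do rewrite E.
rewrite -bigA_distr_bigA/= (le_trans (ler_norm _))// normr_prod.
pose jo : 'I_m.+1 := inord j.
have joE : jo = j :> nat by rewrite inordK// ltnS; case/andP: jm.
have jpE : ord_pred jo = j.-1 :> nat.
  rewrite /= joE; case/andP: jm => j0 jm.
  by rewrite (_ : (j + m.+1).-1 = j.-1 + m.+1)%N ?modnDr ?modn_small//; lia.
rewrite (bigD1 jo)//= mulrC ler_pM//.
- by apply: prodr_ge0.
- have -> : N%:R ^+ m = \prod_(i < m.+1 | i != jo) N%:R :> R.
    rewrite prodr_const; congr (_ ^+ _).
    by have := cardC1 jo; rewrite card_ord /= => {1}<-; apply: eq_card => i; rewrite !inE.
  apply: ler_prod => i _; rewrite normr_ge0 (le_trans (ler_norm_sum _ _ _))//.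
  rewrite -[X in _ <= X%:R]card_ord -sum1_card natr_sum; apply: ler_sum => a _.
  by rewrite /h normrM; do 2 case: ifP; rewrite ?u1 ?normr1 ?mulr1.
- rewrite le_eqVlt; apply/orP; left; apply/eqP; congr `|_|; apply: eq_bigr => a _.
  by rewrite /h joE (negbTE jb) jpE jpred mul1r.
Qed.

(** Along the whole cycle every vertex occurs twice. *)
Lemma full_block_prod (v : {ffun 'I_m.+1 -> 'I_N}) (u : 'I_N -> R) :
  (forall a, u a ^+ 2 = 1) ->
  \prod_(i <- full_block m.+1) (u (v (inord i)) * u (v (ordS (inord i)))) = 1.
Proof.
move=> u2.
rewrite (prod_block_ord (fun i => u (v i) * u (v (ordS i)))).
- under eq_bigl do rewrite mem_full_block ltn_ord.
  rewrite big_split/= -(reindex_inj (@ordS_inj _) (P := xpredT) (F := fun i => u (v i))).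
  by rewrite -big_split/= big1// => i _; rewrite -expr2 u2.
- exact: full_block_uniq.
- by apply/allP => j; rewrite mem_full_block ltnS.
Qed.

End block_averages.

(** * Exponential moments of sums of random signs *)

(** Subgaussianity of a random sign. The function
    x |-> - (expR x + expR (- x)) * expR (- x^2 / 2) increases on the positive
    axis, since x cosh x >= sinh x there. *)
Lemma cosh_le (R : realType) (w : R) : expR w + expR (- w) <= 2 * expR (w ^+ 2 / 2).
Proof.
wlog w0 : w / 0 <= w => [wlg|].
  have [|/ltW w0] := lerP 0 w; first exact: wlg.
  by have := wlg (- w); rewrite oppr_ge0 opprK sqrrN addrC; exact.
pose A x : R := x * (expR x + expR (- x)) - (expR x - expR (- x)).
have dA (x : R) : is_derive x 1 A (x * (expR x - expR (- x))).
  by apply: is_derive_eq; rewrite /GRing.scale/=; ring.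
have A0 x : 0 <= x -> 0 <= A x.
  move=> x0; have <- : A 0 = 0 by rewrite /A mul0r oppr0 subrr subr0.
  apply: (ger0_derive1_ndecry (a := 0)) => //.
  - move=> z; rewrite in_itv/= andbT => z0; rewrite derive1E; have [_ ->] := dA z.
    by rewrite mulr_ge0 ?(ltW z0)// subr_ge0 ler_expR; move: z0; lra.
  - by apply: continuous_subspaceT => z; apply: differentiable_continuous;
      apply/derivable1_diffP; have [] := dA z.
pose B x : R := - (expR x + expR (- x)) * expR (- (x ^+ 2 / 2)).
have dB (x : R) : is_derive x 1 B (A x * expR (- (x ^+ 2 / 2))).
  by apply: is_derive_eq; rewrite /GRing.scale/= /A; field.
have : B 0 <= B w.
  apply: (ger0_derive1_ndecry (a := 0)) => //.
  - move=> z; rewrite in_itv/= andbT => z0; rewrite derive1E; have [_ ->] := dB z.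
    by rewrite mulr_ge0 ?expR_ge0// A0// ltW.
  - by apply: continuous_subspaceT => z; apply: differentiable_continuous;
      apply/derivable1_diffP; have [] := dB z.
have -> : B 0 = - 2 by rewrite /B oppr0 expr0n/= mul0r oppr0 expR0 mulr1.
by rewrite /B mulNr lerN2 [expR (- (w ^+ 2 / 2))]expRN ler_pdivrMr ?expR_gt0.
Qed.

(** Up to the factor (1 - a)^(-1/2), the integrand is the normal density of
    variance 1 / (1 - a). *)
Lemma gauss_quadratic (R : realType) (a : R) : 0 <= a < 1 ->
  (\int[normal_prob 0 1]_x (expR (a * x ^+ 2 / 2))%:E = (Num.sqrt (1 - a))^-1%:E)%E.
Proof.
move=> /andP[a0 a1]; have b0 : 0 < 1 - a by rewrite subr_gt0.
rewrite ge0_integral_normal_prob; last 2 first.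
- apply/measurable_EFinP; apply: measurableT_comp => //.
  by apply: measurable_funM => //; apply: measurable_funM => //; exact: measurable_funX.
- by move=> x; rewrite lee_fin expR_ge0.
set sg := (Num.sqrt (1 - a))^-1.
have sg0 : 0 < sg by rewrite invr_gt0 sqrtr_gt0.
have sg2 : sg ^+ 2 = (1 - a)^-1 by rewrite /sg exprVn sqr_sqrtr// ltW.
under eq_integral => x _.
  rewrite -EFinM (_ : expR (a * x ^+ 2 / 2) * normal_pdf 0 1 x =
    sg * normal_pdf 0 sg x); last first.
    rewrite !normal_pdfE ?oner_neq0 ?gt_eqF//= /normal_fun mulrCA [RHS]mulrA.
    congr (_ * _).
      rewrite /normal_peak expr1n mul1r -mulrnAr sqrtrM ?sqr_ge0// sqrtr_sqr (gtr0_norm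
        sg0).
      by rewrite invfM mulrA divff ?mul1r ?gt_eqF.
    rewrite -expRD !subr0; congr expR; rewrite sg2; field.
    by rewrite gt_eqF// gt_eqF.
  rewrite EFinM; over.
rewrite integralZl//; last exact: integrable_normal_pdf.
by rewrite integral_normal_pdf mule1.
Qed.

Section rademacher_sums.
Context {R : realType} (N : nat).
Local Notation S := {ffun 'I_N -> bool}.

Lemma spin_norm (x : S) a : `|spin R x a| = 1.
Proof. by rewrite /spin normrX normrN1 expr1n. Qed.

Lemma sum_exp_spin_le (u : 'I_N -> R) (z : R) : (forall a, `|u a| = 1) ->
  \sum_(x : S) expR (z * \sum_a u a * spin R x a) <= 2 ^+ N * expR (N%:R * z ^+ 2 / 2).
Proof.
move=> u1.
have -> : \sum_(x : S) expR (z * \sum_a u a * spin R x a) =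
    \prod_(a < N) \sum_(b : bool) expR (z * (u a * (-1) ^+ b)).
  rewrite bigA_distr_bigA/=; apply: eq_bigr => x _.
  by rewrite mulr_sumr expR_sum.
have -> : 2 ^+ N * expR (N%:R * z ^+ 2 / 2) = \prod_(a < N) (2 * expR (z ^+ 2 / 2)).
  by rewrite prodr_const card_ord exprMn -expRM_natl mulrA.
apply: ler_prod => a _; rewrite sumr_ge0 => [|b _]; last exact: expR_ge0.
rewrite big_bool expr0 expr1 /= mulr1 !mulrN1 mulrN addrC.
have -> : z ^+ 2 = (z * u a) ^+ 2.
  by rewrite exprMn -[u a ^+ 2]real_normK ?num_real// u1 expr1n mulr1.
exact: cosh_le.
Qed.

(** At the critical inverse temperature the quadratic exponential moment of a
    Gaussian diverges. Its version with the variance parameter 1 - 1/N is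
    Num.sqrt N, by linearising the square with an auxiliary Gaussian variable; as
    the sum is at most N in absolute value, the missing 1/N costs a bounded
    factor. *)
Lemma sum_exp_sqr_spin_le (u : 'I_N -> R) : (1 < N)%N -> (forall a, `|u a| = 1) ->
  \sum_(x : S) expR ((\sum_a u a * spin R x a) ^+ 2 / (2 * N%:R)) <=
  2 ^+ N * (2 * Num.sqrt N%:R).
Proof.
move=> N1 u1.
have N0 : 0 < N%:R :> R by rewrite ltr0n ltnW.
pose a : R := 1 - N%:R^-1.
have a01 : 0 <= a < 1.
  by rewrite /a subr_ge0 invf_le1// ler1n ltnW//= ltrBlDr ltrDl invr_gt0.
pose t := Num.sqrt (a / N%:R).
have t2 : t ^+ 2 = a / N%:R.
  by rewrite sqr_sqrtr// divr_ge0//; case/andP: a01.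
pose U (x : S) := \sum_a u a * spin R x a.
have U_le x : U x ^+ 2 <= N%:R ^+ 2.
  rewrite -[leLHS]real_normK ?num_real// lerXn2r ?nnegrE// (le_trans (ler_norm_sum _ _
    _))//.
  rewrite -[X in _ <= X%:R]card_ord -sum1_card natr_sum; apply: ler_sum => b _.
  by rewrite normrM u1 spin_norm mulr1.
have e2 : expR (2^-1) <= 2 :> R.
  have e1 : expR (- 2^-1) >= 2^-1 :> R by have := expR_ge1Dx (- 2^-1 : R); lra.
  by rewrite -[leRHS]invrK -[leLHS]invrK lef_pV2 ?posrE ?invr_gt0 ?expR_gt0// -expRN.
(* The exponent splits as t^2 U^2 / 2 + U^2 / (2 N^2), the last term being at
   most 1/2. *)
have step1 x : expR (U x ^+ 2 / (2 * N%:R)) <= 2 * expR (t ^+ 2 * U x ^+ 2 / 2).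
  have -> : U x ^+ 2 / (2 * N%:R) = t ^+ 2 * U x ^+ 2 / 2 + U x ^+ 2 / N%:R ^+ 2 / 2.
    by rewrite t2 /a; field; rewrite gt_eqF.
  rewrite expRD mulrC ler_wpM2r ?expR_ge0// (le_trans _ e2)// ler_expR.
  by rewrite ler_pdivrMr// mulVf// ler_pdivrMr ?exprn_gt0// mul1r.
apply: (@le_trans _ _ (2 * \sum_x expR (t ^+ 2 * U x ^+ 2 / 2))).
  by rewrite mulr_sumr; apply: ler_sum => x _; exact: step1.
rewrite mulrCA ler_pM2l//.
rewrite -lee_fin.
have mE (c : R) : measurable_fun [set: R] (fun z : R => expR (c * z)).
  by apply: measurableT_comp => //; exact: measurable_funM.
have -> : (\sum_x expR (t ^+ 2 * U x ^+ 2 / 2))%:E =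
   (\int[normal_prob 0 1]_z (\sum_x expR (t * U x * z))%:E)%E.
  under eq_integral do rewrite -sumEFin.
  rewrite ge0_integral_sum//; last by move=> x; apply/measurable_EFinP; exact: mE.
  rewrite -[LHS]sumEFin; apply: eq_bigr => x _.
  by rewrite gauss_mgf// expr1n mulr1 exprMn.
have -> : (2 ^+ N * Num.sqrt N%:R)%:E =
   (\int[normal_prob 0 1]_z ((2 ^+ N)%:E * (expR (a * z ^+ 2 / 2))%:E))%E.
  rewrite ge0_integralZl ?lee_fin ?exprn_ge0//; last first.
    apply/measurable_EFinP; apply: measurableT_comp => //.
    by apply: measurable_funM => //; apply: measurable_funM => //; exact: measurable_funX.
  rewrite gauss_quadratic// EFinM; congr (_ * _%:E)%E.
  by rewrite /a opprB addrC subrK sqrtrV ?invrK.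
apply: ge0_le_integral => //.
- by move=> z _; rewrite lee_fin sumr_ge0// => x _; exact: expR_ge0.
- by apply/measurable_EFinP; apply: measurable_sum => x; exact: mE.
- by apply: emeasurable_funM => //; apply/measurable_EFinP; apply: measurableT_comp => //;
    apply: measurable_funM => //; apply: measurable_funM => //; exact: measurable_funX.
- move=> z _; rewrite -EFinM lee_fin.
  have := sum_exp_spin_le (t * z) u1.
  have -> : N%:R * (t * z) ^+ 2 / 2 = a * z ^+ 2 / 2.
    by rewrite exprMn t2; field; rewrite gt_eqF.
  by apply: le_trans; apply: ler_sum => x _; rewrite -/(U x) mulrAC.
Qed.

End rademacher_sums.

(** * Overlap of the Sherrington-Kirkpatrick model *)

Section sk_overlap.
Context {R : realType} (N : nat) (e0 : edge N).
Context d (T : measurableType d) (P : probability T R).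
Variables (s : R) (g : edge N -> {RV P >-> R}).
Local Notation S := {ffun 'I_N -> bool}.
Hypothesis N1 : (1 < N)%N.
Hypothesis s0 : 0 < s.
Hypothesis sN : s ^+ 2 = N%:R^-1.
Hypothesis gdist : forall i (A : set R), measurable A ->
  distribution P (g i) A = normal_prob 0 s A.
Hypothesis gind : mutually_independent [set: edge N]%SET g.
Local Notation Eg := (Eg g).

Definition edge_spin (e : edge N) (x : S) : R := spin R x (val e).1 * spin R x (val e).2.

Local Notation gb := (gibbs edge_spin).

Let o : S := [ffun=> false].

Lemma spin_sqr (x : S) a : spin R x a ^+ 2 = 1.
Proof. by rewrite -[LHS]real_normK ?num_real// spin_norm expr1n. Qed.

Lemma edge_spin_sqr e (x : S) : edge_spin e x ^+ 2 = 1.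
Proof. by rewrite /edge_spin exprMn !spin_sqr mulr1. Qed.

Lemma edge_spinE a b (x : S) : a != b ->
  edge_spin (edge_of e0 a b) x = spin R x a * spin R x b.
Proof. by move=> ab; rewrite /edge_spin val_edge_of//; case: ifP => //= _;
  rewrite mulrC. Qed.

Let N0 : 0 < N%:R :> R. Proof. by rewrite ltr0n ltnW. Qed.

Lemma card_edge_le : #|{: edge N}|%:R * s ^+ 2 <= N%:R / 2.
Proof.
rewrite sN ler_pdivrMr//.
have : \sum_(a < N) \sum_(b < N | a != b) (1 : R) <= N%:R * N%:R.
  have NE : N%:R = \sum_(a < N) (1 : R) by rewrite sumr_const card_ord.
  rewrite [in leRHS]NE mulr_suml; apply: ler_sum => a _.
  by rewrite mul1r big_mkcond; apply: ler_sum => b _; case: ifP.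
by rewrite (sum_edge_of e0 (fun=> 1 : R)) sumr_const; lra.
Qed.

(** The energies of two configurations at overlap q have covariance
    (N q^2 - 1) / 2, so that the sum reduces, for fixed x, to sum_exp_sqr_spin_le. *)
Lemma sk_second_moment : second_moment_ratio s edge_spin <= 2 * Num.sqrt N%:R.
Proof.
rewrite /second_moment_ratio.
have cS : #|{: S}|%:R = 2 ^+ N :> R by rewrite card_ffun card_bool card_ord natrX.
have step (x : S) : \sum_x' expR (s ^+ 2 * \sum_i edge_spin i x * edge_spin i x') <=
    2 ^+ N * (2 * Num.sqrt N%:R).
  apply: le_trans (sum_exp_sqr_spin_le N1 (spin_norm x)).
  apply: ler_sum => x' _; rewrite ler_expR sN.
  have := sum_edge_of e0 (fun e => edge_spin e x * edge_spin e x').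
  set q := (X in _ = 2 * X) => qE.
  have : (\sum_a spin R x a * spin R x' a) ^+ 2 = N%:R + 2 * q.
    rewrite -qE expr2 big_distrlr/=.
    rewrite (eq_bigr (fun a => 1 + \sum_(b < N | a != b) edge_spin (edge_of e0 a b) x *
      edge_spin (edge_of e0 a b) x')).
      by rewrite big_split/= sumr_const card_ord.
    move=> a _; rewrite (bigD1 a)//=; congr (_ + _).
      by rewrite -expr2 exprMn !spin_sqr mulr1.
    apply: eq_big => [b|b ba]; first by rewrite eq_sym.
    by rewrite !edge_spinE 1?eq_sym//; ring.
  (* The constant 1/2 comes from the diagonal terms and is dropped. *)
  move=> ->; have -> : (N%:R + 2 * q) / (2 * N%:R) = 2^-1 + N%:R^-1 * q.
    by field; rewrite gt_eqF.
  by rewrite lerDr.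
rewrite cS mulrC ler_pdivrMr ?exprn_gt0//.
apply: le_trans (ler_sum _ (fun x _ => step x)) _.
rewrite sumr_const -[_ *+ _]mulr_natl.
by rewrite (_ : #|_| = #|{: S}|)// cS; lra.
Qed.

(** The Gibbs average of the squared scalar product of two replicas; see
    overlap_sqr_replicas. *)
Definition overlap_sqr (y : edge N -> R) :=
  \sum_(a < N) \sum_(b < N) gb (fun x => spin R x a * spin R x b) y ^+ 2.

Lemma good_gb a : good (gb a). Proof. exact: (good_gibbs edge_spin o). Qed.

Lemma good_overlap_sqr : good overlap_sqr.
Proof. by apply: good_sum => a; apply: good_sum => b; apply: goodX; exact: good_gb. Qed.

Lemma overlap_sqrE y : overlap_sqr y = N%:R + 2 * \sum_e gb (edge_spin e) y ^+ 2.
Proof.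
rewrite -(sum_edge_of e0) /overlap_sqr.
rewrite (eq_bigr (fun a => 1 + \sum_(b < N |
  a != b) gb (edge_spin (edge_of e0 a b)) y ^+ 2)).
  by rewrite big_split/= sumr_const card_ord.
move=> a _; rewrite (bigD1 a)//=; congr (_ + _).
  have -> : (fun x : S => spin R x a * spin R x a) = (fun=> 1).
    by apply/funext => x; rewrite -expr2 spin_sqr.
  by rewrite (gibbs_cst edge_spin o) expr1n.
apply: eq_big => [b|b ba]; first by rewrite eq_sym.
congr (gibbs _ _ _ ^+ 2); apply/funext => x.
by rewrite edge_spinE// eq_sym.
Qed.

(** With u = N^(1/32) and tangent parameter u^(-4), the two error terms of
    sum_bracket_sqr_le are both of order u^28 = N^(7/8), which leaves a gain of
    u^(-4) over the trivial bound N^2. *)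
Lemma Eg_overlap_sqr_le (u : R) : 1 <= u -> u ^+ 32 = N%:R ->
  Eg overlap_sqr <= 9 * N%:R ^+ 2 * u ^- 4.
Proof.
move=> u1 uN; have u0 : 0 < u by exact: lt_le_trans u1.
have un n : 0 <= u ^+ n by rewrite exprn_ge0// ltW.
have -> : overlap_sqr = fun y => N%:R + 2 * \sum_e gb (edge_spin e) y ^+ 2.
  by apply/funext => y; exact: overlap_sqrE.
have gq e : good (fun y => gb (edge_spin e) y ^+ 2) by apply: goodX; exact: good_gb.
rewrite (EgD s0 gdist gind) ?Eg_cst ?(EgZ s0 gdist gind) ?(Eg_sum s0 gdist gind)//;
  last 3 first.
- exact: good_sum.
- exact: good_cst.
- by apply: goodZ; exact: good_sum.
have b0 : 0 < u ^- 4 by rewrite invr_gt0 exprn_gt0.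
have := sum_bracket_sqr_le o s0 gdist gind edge_spin_sqr b0.
set q := \sum_i _; set V := #|{: edge N}|%:R * s ^+ 2; set v := Num.sqrt _.
have V_le : V <= N%:R / 2 by exact: card_edge_le.
have v_le : v <= u ^+ 24.
  rewrite -[u ^+ 24]ger0_norm// -sqrtr_sqr; apply: ler_wsqrtr.
  have sq : Num.sqrt N%:R = u ^+ 16.
    by rewrite -uN (exprM u 16 2) sqrtr_sqr ger0_norm.
  have h := sk_second_moment; rewrite sq in h.
  have V0 : 0 <= V by rewrite mulr_ge0 ?sqr_ge0.
  apply: le_trans (ler_pM _ V0 h V_le) _.
    by rewrite mulr_ge0 ?invr_ge0 ?exprn_ge0// sumr_ge0// => x _;
      rewrite sumr_ge0// => x' _; exact: expR_ge0.
  rewrite -uN le_eqVlt; apply/orP; left; apply/eqP; by field.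
have ln2 : ln 2 <= u ^+ 24 :> R.
  apply: (@le_trans _ _ 1); last by rewrite exprn_ege1.
  by have := @le_ln1Dx R 1; rewrite -[1 + 1]/(2 : R); apply; lra.
rewrite sN invrK => h.
have {}h : N%:R^-1 * q <= 4 * (u ^+ 28).
  apply: le_trans h _.
  have : u ^- 4 * V / 2 <= u ^- 4 * (N%:R / 2) / 2 by rewrite ler_pM2r// ler_pM2l.
  have : (ln 2 + 2 * v) * u ^+ 4 <= 3 * u ^+ 24 *
    u ^+ 4 by rewrite ler_pM2r ?exprn_gt0//; lra.
  have -> : u ^- 4 * (N%:R / 2) / 2 = u ^+ 28 / 4.
    by rewrite -uN; field; rewrite gt_eqF.
  have -> : 3 * u ^+ 24 * u ^+ 4 = 3 * u ^+ 28 by ring.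
  have := un 28%N.
  by lra.
move: h; rewrite ler_pdivrMl// => h.
have -> : 9 * N%:R ^+ 2 * u ^- 4 = 9 * (N%:R * u ^+ 28).
  rewrite -uN; field; by rewrite gt_eqF.
have : N%:R <= N%:R * u ^+ 28 by rewrite ler_pMr// exprn_ege1.
lra.
Qed.

End sk_overlap.

(** * Cumulants along cycles *)

Section cycle_brackets.
Context {R : realType} (N : nat) (e0 : edge N).
Context d (T : measurableType d) (P : probability T R).
Variables (s : R) (g : edge N -> {RV P >-> R}).
Local Notation S := {ffun 'I_N -> bool}.
Hypothesis N1 : (1 < N)%N.
Hypothesis s0 : 0 < s.
Hypothesis sN : s ^+ 2 = N%:R^-1.
Hypothesis gdist : forall i (A : set R), measurable A ->
  distribution P (g i) A = normal_prob 0 s A.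
Hypothesis gind : mutually_independent [set: edge N]%SET g.
Local Notation Eg := (Eg g).
Local Notation chi := (@edge_spin R N).
Local Notation gb := (gibbs chi).

Let o : S := [ffun=> false].

Let N0 : 0 < N%:R :> R. Proof. by rewrite ltr0n ltnW. Qed.

Lemma overlap_sqr_replicas (y : edge N -> R) :
  gb (fun x => gb (fun x' => (\sum_a spin R x a * spin R x' a) ^+ 2) y) y = overlap_sqr y.
Proof.
have E x : gb (fun x' => (\sum_a spin R x a * spin R x' a) ^+ 2) y =
    \sum_a \sum_b (gb (fun x' => spin R x' a * spin R x' b) y) * (spin R x a * spin R x b).
  rewrite -[LHS]/(gb _ y).
  rewrite (_ : (fun x' => _) = (fun x' => \sum_a \sum_b (spin R x a * spin R x b) *
    (spin R x' a * spin R x' b))).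
    rewrite (gibbs_sum chi o); apply: eq_bigr => a _.
    by rewrite (gibbs_sum chi o); apply: eq_bigr => b _; rewrite gibbsZ mulrC.
  apply/funext => x'; rewrite expr2 big_distrlr/=; apply: eq_bigr => a _;
    apply: eq_bigr => b _.
  by rewrite mulrACA.
rewrite (_ : (fun x => _) = (fun x => \sum_a \sum_b (gb (fun x' =>
  spin R x' a * spin R x' b) y) * (spin R x a * spin R x b))); last by apply/funext.
rewrite (gibbs_sum chi o) /overlap_sqr; apply: eq_bigr => a _.
by rewrite (gibbs_sum chi o); apply: eq_bigr => b _; rewrite gibbsZ expr2.
Qed.

Section fixed_length.
Variable m : nat.
Hypothesis m2 : (2 <= m)%N.
Local Notation cyc := {ffun 'I_m.+1 -> 'I_N}.

Definition edge_seq (v : cyc) (i : nat) : edge N := cycle_edge e0 v (inord i).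

Definition spin_block (b : seq nat) (v : cyc) (x : S) : R :=
  \prod_(i <- b) (spin R x (v (inord i)) * spin R x (v (ordS (inord i)))).

Lemma block_prod_cycle b (v : cyc) x : injective v ->
  block_prod chi (edge_seq v) b x = spin_block b v x.
Proof.
move=> vi; apply: eq_bigr => i _.
by rewrite /edge_seq /cycle_edge edge_spinE// cycle_edge_neq.
Qed.

(** The square of a bracket involves two independent replicas; summed over all
    positions of the vertices it is controlled by their overlap. *)
Lemma sum_bracket_sqr_replicas b (ep : R) y : 0 < ep -> proper_block m b ->
  \sum_(v : cyc) gb (spin_block b v) y ^+ 2 <=
  N%:R ^+ m * (N%:R * ep + overlap_sqr y / (N%:R * ep)) / 2.
Proof.
move=> ep0 bp.
have Ne : 0 < N%:R * ep by exact: mulr_gt0.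
have -> : \sum_(v : cyc) gb (spin_block b v) y ^+ 2 =
    gb (fun x => gb (fun x' => \sum_(v : cyc) spin_block b v x * spin_block b v x') y) y.
  have E x : gb (fun x' => \sum_(v : cyc) spin_block b v x * spin_block b v x') y =
     \sum_(v : cyc) gb (spin_block b v) y * spin_block b v x.
    by rewrite (gibbs_sum chi o); apply: eq_bigr => v _; rewrite gibbsZ mulrC.
  rewrite (_ : (fun x => _) = (fun x => \sum_(v : cyc) gb (spin_block b v) y *
    spin_block b v x)); last by apply/funext.
  by rewrite (gibbs_sum chi o); apply: eq_bigr => v _; rewrite gibbsZ expr2.
pose D : R := N%:R ^+ m / 2.
apply: (@le_trans _ _ (gb (fun x => gb (fun x' => D * (N%:R * ep) +
   (D / (N%:R * ep)) * (\sum_a spin R x a * spin R x' a) ^+ 2) y) y)).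
  apply: (gibbs_le chi o) => x; apply: (gibbs_le chi o) => x'.
  have u1 a : `|spin R x a * spin R x' a| = 1 by rewrite normrM !spin_norm mulr1.
  have := sum_block_prod_le u1 bp.
  rewrite (eq_bigr (fun v : cyc => spin_block b v x * spin_block b v x')); last first.
    by move=> v _; rewrite /spin_block -big_split; apply: eq_bigr => i _; rewrite mulrACA.
  move=> /le_trans; apply.
  (* Young inequality with the weight N ep. *)
  set U := \sum_a _.
  have : 0 <= (`|U| - N%:R * ep) ^+ 2 / (N%:R * ep) by rewrite divr_ge0 ?sqr_ge0 ?ltW.
  have -> : (`|U| - N%:R * ep) ^+ 2 / (N%:R * ep) =
     `|U| ^+ 2 / (N%:R * ep) + N%:R * ep - 2 * `|U|.
    by field; rewrite !gt_eqF.
  rewrite real_normK ?num_real// => h.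
  have h2 : `|U| <= (N%:R * ep + U ^+ 2 / (N%:R * ep)) / 2 by lra.
  apply: le_trans (ler_wpM2l (exprn_ge0 m (ltW N0)) h2) _.
  by rewrite le_eqVlt; apply/orP; left; apply/eqP; rewrite /D; ring.
rewrite (_ : (fun x => _) = (fun x => D * (N%:R * ep) +
   (D / (N%:R * ep)) * gb (fun x' => (\sum_a spin R x a * spin R x' a) ^+ 2) y));
     last first.
  by apply/funext => x; rewrite gibbsD (gibbs_cst chi o) gibbsZ.
rewrite gibbsD (gibbs_cst chi o) gibbsZ overlap_sqr_replicas.
by rewrite le_eqVlt; apply/orP; left; apply/eqP; rewrite /D; ring.
Qed.

(** The Cauchy-Schwarz inequality, in the form of two Young inequalities, turns
    the overlap bound of order u^(-4) into one of order u^(-2) for the squares of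
    the brackets and then of order u^(-1) for their absolute values. *)
Lemma sum_Eg_bracket_le b (u : R) : 1 <= u -> u ^+ 32 = N%:R -> proper_block m b ->
  \sum_(v : cyc | injectiveb v) Eg (fun y => `|bracket chi (edge_seq v) b y|) <=
  3 * N%:R ^+ m.+1 / u.
Proof.
move=> u1 uN bp; have u0 : 0 < u by exact: lt_le_trans u1.
have gsb v : good (gb (spin_block b v)) by exact: good_gb.
have gs2 v : good (fun y => gb (spin_block b v) y ^+ 2) by exact: goodX.
have one (v : cyc) : injectiveb v ->
    Eg (fun y => `|bracket chi (edge_seq v) b y|) <=
    u^-1 / 2 + u / 2 * Eg (fun y => gb (spin_block b v) y ^+ 2).
  move=> /injectiveP vi.
  rewrite -[X in X + _](Eg_cst g) -(EgZ s0 gdist gind)// -(EgD s0 gdist gind); last 2 first.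
  - exact: good_cst.
  - exact: goodZ.
  have -> : bracket chi (edge_seq v) b = gb (spin_block b v).
    by rewrite /bracket; congr (gibbs _); apply/funext => x; exact: block_prod_cycle.
  apply: (Eg_le s0 gdist gind).
  - exact: good_norm.
  - by apply: goodD; [exact: good_cst|exact: goodZ].
  (* Young inequality with the weight u^(-1). *)
  - move=> y; set G := gb _ y.
    have : 0 <= (`|G| - u^-1) ^+ 2 * u by rewrite mulr_ge0 ?sqr_ge0 ?ltW.
    have -> : (`|G| - u^-1) ^+ 2 * u = u * `|G| ^+ 2 + u^-1 - 2 * `|G|.
      by field; rewrite gt_eqF.
    rewrite real_normK ?num_real//; lra.
apply: le_trans (ler_sum _ one) _.
have all_v : \sum_(v : cyc | injectiveb v) (u^-1 / 2 + u / 2 * Eg (fun y =>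
  gb (spin_block b v) y ^+ 2)) <=
    \sum_(v : cyc) (u^-1 / 2 + u / 2 * Eg (fun y => gb (spin_block b v) y ^+ 2)).
  rewrite big_mkcond; apply: ler_sum => v _; case: ifP => // _.
  rewrite addr_ge0 ?mulr_ge0 ?divr_ge0 ?invr_ge0 ?(ltW u0)//.
  by apply: Eg_ge0 => y; exact: sqr_ge0.
apply: le_trans all_v _.
rewrite big_split/= sumr_const card_ffun !card_ord -mulr_sumr -(Eg_sum s0 gdist gind)//.
(* The weight ep = u^(-2) balances ep against u^(-4) / ep. *)
have e2 : 0 < u ^- 2 by rewrite invr_gt0 exprn_gt0.
have := Eg_overlap_sqr_le e0 N1 s0 sN gdist gind u1 uN.
set Q := Eg (@overlap_sqr R N) => Q_le.
have h : Eg (fun y => \sum_(v : cyc) gb (spin_block b v) y ^+ 2) <=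
    N%:R ^+ m * (N%:R * u ^- 2 + Q / (N%:R * u ^- 2)) / 2.
  have -> : N%:R ^+ m * (N%:R * u ^- 2 + Q / (N%:R * u ^- 2)) / 2 =
     Eg (fun y => N%:R ^+ m * (N%:R * u ^- 2) / 2 + N%:R ^+ m / (N%:R *
       u ^- 2) / 2 * overlap_sqr y).
    rewrite (EgD s0 gdist gind) ?(EgZ s0 gdist gind) ?Eg_cst; first (by rewrite /Q; ring);
      by [exact: good_overlap_sqr|exact: good_cst|apply: goodZ; exact: good_overlap_sqr].
  apply: (Eg_le s0 gdist gind).
  - exact: good_sum.
  - apply: goodD; [exact: good_cst|apply: goodZ; exact: good_overlap_sqr].
  - move=> y; apply: le_trans (sum_bracket_sqr_replicas y e2 bp) _.
    by rewrite le_eqVlt; apply/orP; left; apply/eqP; ring.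
have h2 : N%:R ^+ m * (N%:R * u ^- 2 + Q / (N%:R * u ^- 2)) / 2 <=
  5 * N%:R ^+ m.+1 * u ^- 2.
  have Q2 : Q / (N%:R * u ^- 2) <= 9 * N%:R * u ^- 2.
    rewrite ler_pdivrMr ?mulr_gt0// (le_trans Q_le)//.
    by rewrite le_eqVlt; apply/orP; left; apply/eqP; field; rewrite gt_eqF.
  have Nm : 0 < N%:R ^+ m :> R by rewrite exprn_gt0.
  have h3 : N%:R ^+ m * (N%:R * u ^- 2 + Q / (N%:R * u ^- 2)) <=
    N%:R ^+ m * (10 * N%:R * u ^- 2).
    by rewrite ler_pM2l//; lra.
  apply: (@le_trans _ _ (N%:R ^+ m * (10 * N%:R * u ^- 2) / 2)); first by rewrite ler_pM2r.
  by rewrite le_eqVlt; apply/orP; left; apply/eqP; rewrite [N%:R ^+ m.+1]exprS; field;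
    rewrite gt_eqF.
have h4 : u / 2 * Eg (fun y => \sum_(v : cyc) gb (spin_block b v) y ^+ 2) <=
    u / 2 * (5 * N%:R ^+ m.+1 * u ^- 2).
  by rewrite ler_pM2l ?divr_gt0// (le_trans h).
apply: le_trans (lerD (lexx _) h4) _.
rewrite -[_ *+ _]mulr_natr natrX.
by rewrite le_eqVlt; apply/orP; left; apply/eqP; field; rewrite gt_eqF.
Qed.

(** The number of injective labellings is the falling factorial; each of them
    contributes 1, up to the remainder. *)
Lemma sum_Eg_cumulant_ge (u : R) : 1 <= u -> u ^+ 32 = N%:R ->
  (N ^_ m.+1)%:R - ((2 * m.+1) ^ m)%:R * (3 * N%:R ^+ m.+1 / u) <=
  \sum_(v : cyc | injectiveb v) Eg (cumulant chi (edge_seq v) m).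
Proof.
move=> u1 uN; have u0 : 0 < u by exact: lt_le_trans u1.
have -> : (N ^_ m.+1)%:R = \sum_(v : cyc | injectiveb v) (1 : R).
  rewrite sumr_const; congr (_%:R).
  have := card_inj_ffuns 'I_m.+1 'I_N; rewrite !card_ord => <-.
  by apply: eq_card => v; rewrite inE.
rewrite lerBlDr -lerBlDl -sumrB.
have one (v : cyc) : injectiveb v -> 1 - Eg (cumulant chi (edge_seq v) m) <=
    \sum_(t <- remainder m) Eg (fun y => `|bracket chi (edge_seq v) (head [::] t.2) y|).
  move=> /injectiveP vi.
  have gc : good (cumulant chi (edge_seq v) m) by exact: (good_cumulant o
    (@edge_spin_sqr R N)).
  have gbr b : good (fun y => `|bracket chi (edge_seq v) b y|) by apply: good_norm;
    exact: good_gb.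
  rewrite -[X in X - _](Eg_cst g) -(EgB s0 gdist gind)//; last exact: good_cst.
  rewrite -(Eg_sum s0 gdist gind)//; apply: (Eg_le s0 gdist gind).
  - by apply: goodB => //; exact: good_cst.
  - exact: good_sum.
  - move=> y; apply: (cumulant_remainder_le o (@edge_spin_sqr R N)) => x.
    by rewrite block_prod_cycle// /spin_block full_block_prod// => a; exact: spin_sqr.
apply: le_trans (ler_sum _ one) _.
rewrite exchange_big/=.
apply: (@le_trans _ _ (\sum_(t <- remainder m) 3 * N%:R ^+ m.+1 / u)).
  rewrite big_seq [leRHS]big_seq; apply: ler_sum => t tm.
  by apply: sum_Eg_bracket_le => //; have [] := remainderP tm.
rewrite big_const_seq count_predT iter_addr_0 -[_ *+ size _]mulr_natl ler_wpM2r//.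
  by rewrite !mulr_ge0 ?invr_ge0 ?exprn_ge0 ?(ltW u0)// ltW.
by rewrite ler_nat size_remainder.
Qed.

End fixed_length.

End cycle_brackets.

(** * Orthogonality of Gaussian monomials *)

Section gaussian_monomials.
Context {R : realType} {I : finType} d (T : measurableType d) (P : probability T R).
Variables (s : R) (g : I -> {RV P >-> R}).
Hypothesis s0 : 0 < s.
Hypothesis gdist : forall i (A : set R), measurable A ->
  distribution P (g i) A = normal_prob 0 s A.
Hypothesis gind : mutually_independent [set: I]%SET g.
Local Notation Eg := (Eg g).
Implicit Types A B : {set I}.

Lemma partial_ibp i (f f' : (I -> R) -> R) : partial i f f' ->
  Eg (fun y => y i * f y) = s ^+ 2 * Eg f'.
Proof. by move=> [gf gf' df cf]; exact: (gaussian_ibp s0 gdist gind gf gf' df cf). Qed.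

Lemma partial_coord i : partial i (fun y : I -> R => y i) (fun=> 1).
Proof.
split; [exact: good_coord|exact: good_cst| |].
- by move=> y x; under eq_fun do rewrite upd_same; exact: is_derive_id.
- by move=> y x; exact: cvg_cst.
Qed.

Definition monomial A (y : I -> R) : R := \prod_(i in A) y i.

Lemma good_monomial A : good (monomial A).
Proof. by apply: good_prod => i; exact: good_coord. Qed.

Lemma monomial_upd A i y x : i \notin A -> monomial A (upd y i x) = monomial A y.
Proof.
move=> iA; apply: eq_bigr => j jA; rewrite upd_other//.
by apply: contraNneq iA => <-.
Qed.

Lemma monomialD1 A i y : i \in A -> monomial A y = y i * monomial (A :\ i)%SET y.
Proof. by move=> iA; rewrite /monomial (big_setD1 i). Qed.

Lemma partial_monomial_indep i A : i \notin A -> partial i (monomial A) (fun=> 0).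
Proof.
move=> iA; apply: partial_indep; first exact: good_monomial.
by move=> y x; exact: monomial_upd.
Qed.

Let Eg_monomialM_neq A B i : i \in A -> i \notin B ->
  Eg (fun y => monomial A y * monomial B y) = 0.
Proof.
move=> iA iB.
have -> : (fun y => monomial A y * monomial B y) =
    (fun y => y i * (monomial (A :\ i)%SET y * monomial B y)).
  by apply/funext => y; rewrite (monomialD1 _ iA) mulrA.
have iA' : i \notin (A :\ i)%SET by rewrite !inE eqxx.
rewrite (partial_ibp (partialM (partial_monomial_indep iA') (partial_monomial_indep iB))).
have -> : (fun y => monomial (A :\ i)%SET y * 0 + 0 * monomial B y) = (fun=> 0).
  by apply/funext => y; rewrite mulr0 mul0r addr0.
by rewrite Eg_cst mulr0.
Qed.

(** Products of distinct centred independent coordinates are orthogonal: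
    integration by parts removes the coordinates one at a time. *)
Lemma Eg_monomialM A B : Eg (fun y => monomial A y * monomial B y) =
  if A == B then s ^+ (2 * #|A|) else 0.
Proof.
case: eqP => [<-{B}|/eqP AB]; last first.
  have [AsB|] := boolP (A \subset B); last first.
    by move=> /fintype.subsetPn[i iA iB]; exact: (Eg_monomialM_neq iA iB).
  have : ~~ (B \subset A) by apply: contra AB => BA; rewrite finset.eqEsubset AsB.
  move=> /fintype.subsetPn[i iB iA]; rewrite -(Eg_monomialM_neq iB iA).
  by congr Eg; apply/funext => y; rewrite mulrC.
elim: {A}#|A| {-2}A (erefl #|A|) => [|n IHn] A cA.
  move/eqP: cA; rewrite cards_eq0 => /eqP ->.
  have -> : (fun y => monomial finset.set0 y * monomial finset.set0 y) = (fun=> 1).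
    by apply/funext => y; rewrite /monomial !big_set0 mulr1.
  by rewrite Eg_cst cards0.
have /card_gt0P[i iA] : (0 < #|A|)%N by rewrite cA.
have iA' : i \notin (A :\ i)%SET by rewrite !inE eqxx.
have cA' : #|(A :\ i)%SET| = n by apply: succn_inj; rewrite -cA (cardsD1 i A) iA.
have pm := partial_monomial_indep iA'.
have -> : (fun y => monomial A y * monomial A y) =
    (fun y => y i * (y i * (monomial (A :\ i)%SET y * monomial (A :\ i)%SET y))).
  by apply/funext => y; rewrite (monomialD1 _ iA); ring.
rewrite (partial_ibp (partialM (partial_coord i) (partialM pm pm))).
have -> : (fun y => y i * (monomial (A :\ i)%SET y * 0 + 0 * monomial (A :\ i)%SET y) +
    1 * (monomial (A :\ i)%SET y * monomial (A :\ i)%SET y)) =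
    (fun y => monomial (A :\ i)%SET y * monomial (A :\ i)%SET y).
  by apply/funext => y; ring.
by rewrite (IHn _ cA') cA' cA -exprD mulnS.
Qed.

Lemma Eg_monomial A : A != finset.set0 -> Eg (monomial A) = 0.
Proof.
move=> A0; have := Eg_monomialM A finset.set0; rewrite (negbTE A0) => <-.
by congr Eg; apply/funext => y; rewrite {3}/monomial big_set0 mulr1.
Qed.

(** The square of F - E F - psi is nonnegative. For psi in the span of an
    orthogonal family, with the right coefficients, this is the inequality of
    Bessel. *)
Lemma variance_test_function (f psi : (I -> R) -> R) : good f -> good psi ->
  Eg psi = 0 ->
  2 * Eg (fun y => f y * psi y) - Eg (fun y => psi y ^+ 2) <=
  Eg (fun y => f y ^+ 2) - Eg f ^+ 2.
Proof.
move=> gf gp p0; rewrite -subr_ge0; set m := Eg f.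
have gfp : good (fun y => f y * psi y) by exact: goodM.
have gf2 : good (fun y => f y ^+ 2) by exact: goodX.
have gp2 : good (fun y => psi y ^+ 2) by exact: goodX.
have : 0 <= Eg (fun y => (f y - m - psi y) ^+ 2) by apply: Eg_ge0 => y; exact: sqr_ge0.
have -> : (fun y => (f y - m - psi y) ^+ 2) =
   (fun y => (f y ^+ 2 + psi y ^+ 2) - 2 * (f y * psi y) + (2 * m * psi y - 2 * m *
     f y + m ^+ 2)).
  by apply/funext => y; ring.
have g1 : good (fun y => f y ^+ 2 + psi y ^+ 2) by exact: goodD.
have g2 : good (fun y => 2 * (f y * psi y)) by exact: goodZ.
have g3 : good (fun y => 2 * m * psi y) by exact: goodZ.
have g4 : good (fun y => 2 * m * f y) by exact: goodZ.
have g5 : good (fun y => 2 * m * psi y - 2 * m * f y) by exact: goodB.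
have g6 : good (fun y => (f y ^+ 2 + psi y ^+ 2) - 2 * (f y * psi y)) by exact: goodB.
have g7 : good (fun y : I -> R => m ^+ 2) by exact: good_cst.
have g8 : good (fun y => 2 * m * psi y - 2 * m * f y + m ^+ 2) by exact: goodD.
rewrite (EgD s0 gdist gind g6 g8) (EgB s0 gdist gind g1 g2) (EgD s0 gdist gind gf2 gp2).
rewrite (EgZ s0 gdist gind _ gfp) (EgD s0 gdist gind g5 g7) (EgB s0 gdist gind g3 g4).
by rewrite Eg_cst !(EgZ s0 gdist gind)// p0 -/m; lra.
Qed.

End gaussian_monomials.

Lemma ffact_ge (R : realType) (N k : nat) : (0 < N)%N ->
  N%:R ^+ k * (1 - k%:R ^+ 2 / N%:R) <= (N ^_ k)%:R :> R.
Proof.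
move=> N0; have N0' : 0 < N%:R :> R by rewrite ltr0n.
elim: k => [|k IHk]; first by rewrite expr0 mul1r expr0n mul0r subr0 ffactn0.
have Nk : 0 < N%:R ^+ k :> R by rewrite exprn_gt0.
have [Nk1|kN] := leqP N k.
  rewrite ffact_small ?ltnS//; apply: mulr_ge0_le0; first by rewrite exprn_ge0 ?ltW.
  rewrite subr_le0 ler_pdivlMr// mul1r -natrX ler_nat (leq_trans Nk1)//.
  by rewrite (leq_trans (leqnSn k))// -{1}[k.+1]expn1 leq_pexp2l.
rewrite ffactnSr natrM natrB ?(ltnW kN)//.
have kN' : 0 <= N%:R - k%:R :> R by rewrite subr_ge0 ler_nat ltnW.
apply: le_trans (ler_wpM2r kN' IHk).
rewrite exprSr -[leLHS]mulrA -[leRHS]mulrA ler_pM2l// -natr1.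
have k0 : 0 <= k%:R :> R by [].
move: (k%:R : R) k0 => x x0.
have -> : (1 - x ^+ 2 / N%:R) * (N%:R - x) = N%:R - x - x ^+ 2 + x ^+ 3 / N%:R.
  by field; rewrite gt_eqF.
have -> : N%:R * (1 - (x + 1) ^+ 2 / N%:R) = N%:R - (x + 1) ^+ 2.
  by field; rewrite gt_eqF.
have : 0 <= x ^+ 3 / N%:R by rewrite divr_ge0 ?exprn_ge0 ?(ltW N0').
by nra.
Qed.

(** * Variance and the projection on cycles *)

Section variance_lower_bound.
Context {R : realType} (N : nat) (e0 : edge N).
Context d (T : measurableType d) (P : probability T R).
Variables (s : R) (g : edge N -> {RV P >-> R}).
Hypothesis N1 : (1 < N)%N.
Hypothesis s0 : 0 < s.
Hypothesis sN : s ^+ 2 = N%:R^-1.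
Hypothesis gdist : forall i (A : set R), measurable A ->
  distribution P (g i) A = normal_prob 0 s A.
Hypothesis gind : mutually_independent [set: edge N]%SET g.
Local Notation Eg := (Eg g).
Local Notation chi := (@edge_spin R N).
Local Notation F := (free_energy chi).
Local Notation cyc m := {ffun 'I_m.+1 -> 'I_N}.

Let o : {ffun 'I_N -> bool} := [ffun=> false].

Let N0 : 0 < N%:R :> R. Proof. by rewrite ltr0n ltnW. Qed.

Let gF : good F. Proof. exact: (good_free_energy o (@edge_spin_sqr R N)). Qed.

Let sX n : s ^+ (2 * n) = N%:R ^- n.
Proof. by rewrite exprM sN exprVn. Qed.

Definition cycle_sum (m : nat) (y : edge N -> R) : R :=
  \sum_(v : cyc m | injectiveb v) monomial (cycle_edges e0 v) y.

(** With A the sum over the labelled cycles of length m.+1, one has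
    E[F A] at least about 1 and E[A^2] at most 2 m.+1, so the lower bound
    2 c E[F A] - c^2 E[A^2] is best for the coefficient c chosen here. *)
Definition cycle_test (M : nat) (y : edge N -> R) : R :=
  \sum_(2 <= m < M) (2 * m.+1%:R)^-1 * cycle_sum m y.

Lemma good_cycle_sum m : good (cycle_sum m).
Proof. by apply: good_sum => v; exact: good_monomial. Qed.

Lemma good_cycle_test M : good (cycle_test M).
Proof. by apply: good_sum => m; apply: goodZ; exact: good_cycle_sum. Qed.

Lemma cycle_edges_neq0 m (v : cyc m) : cycle_edges e0 v != finset.set0.
Proof. by apply/set0Pn; exists (cycle_edge e0 v ord0); exact: imset_f. Qed.

Lemma Eg_cycle_test M : Eg (cycle_test M) = 0.
Proof.
rewrite (Eg_sum s0 gdist gind); last by move=> m; apply: goodZ; exact: good_cycle_sum.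
rewrite big1// => m _; rewrite (EgZ s0 gdist gind); last exact: good_cycle_sum.
rewrite (Eg_sum s0 gdist gind); last by move=> v; exact: good_monomial.
by rewrite big1 ?mulr0// => v _; rewrite (Eg_monomial s0 gdist gind)// cycle_edges_neq0.
Qed.

Lemma Eg_free_energy_cycle m (v : cyc m) : (2 <= m)%N -> injective v ->
  Eg (fun y => F y * monomial (cycle_edges e0 v) y) =
  N%:R ^- m.+1 * Eg (cumulant chi (edge_seq e0 v) m).
Proof.
move=> m2 vi; have ei := @cycle_edge_inj _ _ e0 m2 v vi.
rewrite -sX -(Eg_free_energy_prod o s0 gdist gind (@edge_spin_sqr R N)).
  congr Eg; apply/funext => y; congr (_ * _).
  rewrite /monomial big_imset/=; last by move=> i j _ _; exact: ei.
  by rewrite big_mkord; apply: eq_bigr => i _; rewrite /edge_seq inord_val.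
move=> i j im jm /ei /(congr1 (@nat_of_ord _)).
by rewrite !inordK.
Qed.

Lemma Eg_free_energy_cycle_sum_ge m (u : R) : (2 <= m)%N -> 1 <= u -> u ^+ 32 = N%:R ->
  1 - m.+1%:R ^+ 2 / N%:R - 3 * ((2 * m.+1) ^ m)%:R / u <=
  Eg (fun y => F y * cycle_sum m y) .
Proof.
move=> m2 u1 uN; have u0 : 0 < u by exact: lt_le_trans u1.
have Nm : 0 < N%:R ^+ m.+1 :> R by rewrite exprn_gt0.
have -> : Eg (fun y => F y * cycle_sum m y) =
    N%:R ^- m.+1 * \sum_(v : cyc m | injectiveb v) Eg (cumulant chi (edge_seq e0 v) m).
  have -> : (fun y => F y * cycle_sum m y) =
      (fun y => \sum_(v : cyc m | injectiveb v) F y * monomial (cycle_edges e0 v) y).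
    by apply/funext => y; rewrite /cycle_sum mulr_sumr.
  rewrite (Eg_sum s0 gdist gind); last by move=> v; apply: goodM => //;
    exact: good_monomial.
  by rewrite mulr_sumr; apply: eq_bigr => v /injectiveP vi; exact: Eg_free_energy_cycle.
rewrite -ler_pdivrMl ?invr_gt0// invrK.
apply: le_trans (sum_Eg_cumulant_ge e0 N1 s0 sN gdist gind m2 u1 uN).
rewrite mulrBr lerB//; first by apply: ffact_ge; exact: ltnW.
by rewrite le_eqVlt; apply/orP; left; apply/eqP; ring.
Qed.

Lemma Eg_cycle_sumM_neq m m' : (2 <= m)%N -> (2 <= m')%N -> m != m' ->
  Eg (fun y => cycle_sum m y * cycle_sum m' y) = 0.
Proof.
move=> m2 m2' mm'.
have -> : (fun y => cycle_sum m y * cycle_sum m' y) =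
    (fun y => \sum_(v : cyc m | injectiveb v) \sum_(w : cyc m' | injectiveb w)
       monomial (cycle_edges e0 v) y * monomial (cycle_edges e0 w) y).
  by apply/funext => y; rewrite /cycle_sum big_distrlr.
have gm (A B : {set edge N}) : good (fun y : edge N -> R => monomial A y * monomial B y).
  by apply: goodM; exact: good_monomial.
rewrite (Eg_sum s0 gdist gind); last by move=> v; exact: good_sum.
rewrite big1// => v /injectiveP vi; rewrite (Eg_sum s0 gdist gind)//.
rewrite big1// => w /injectiveP wi; rewrite (Eg_monomialM s0 gdist gind);
  case: eqP => // vw.
have := @card_cycle_edges _ _ e0 m2 v vi; rewrite vw card_cycle_edges// => -[] /eqP.
by rewrite eq_sym (negbTE mm').
Qed.

(** Only the labellings of the same cycle are correlated, and a cycle on m+1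
    vertices has at most 2 (m+1) of them. *)
Lemma Eg_cycle_sum_sqr_le m : (2 <= m)%N ->
  Eg (fun y => cycle_sum m y * cycle_sum m y) <= 2 * m.+1%:R.
Proof.
move=> m2.
have Nm : 0 < N%:R ^+ m.+1 :> R by rewrite exprn_gt0.
have -> : (fun y => cycle_sum m y * cycle_sum m y) =
    (fun y => \sum_(v : cyc m | injectiveb v) \sum_(w : cyc m | injectiveb w)
       monomial (cycle_edges e0 v) y * monomial (cycle_edges e0 w) y).
  by apply/funext => y; rewrite /cycle_sum big_distrlr.
have gm (A B : {set edge N}) : good (fun y : edge N -> R => monomial A y * monomial B y).
  by apply: goodM; exact: good_monomial.
rewrite (Eg_sum s0 gdist gind); last by move=> v; exact: good_sum.
apply: (@le_trans _ _ (\sum_(v : cyc m | injectiveb v) N%:R ^- m.+1 * (2 * m.+1%:R))).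
  apply: ler_sum => v /injectiveP vi; rewrite (Eg_sum s0 gdist gind)//.
  have -> : \sum_(w : cyc m | injectiveb w) Eg (fun y =>
    monomial (cycle_edges e0 v) y * monomial (cycle_edges e0 w) y) =
     \sum_(w in [set w : cyc m | injectiveb w & cycle_edges e0 w == cycle_edges e0 v])
       N%:R ^- m.+1.
    rewrite big_mkcond [RHS]big_mkcond; apply: eq_bigr => w _.
    rewrite inE (Eg_monomialM s0 gdist gind) card_cycle_edges// sX eq_sym.
    by case: (injectiveb w).
  rewrite sumr_const -[_ *+ _]mulr_natr ler_pM2l ?invr_gt0//.
  by rewrite -natrM ler_nat card_same_cycle.
rewrite sumr_const -[_ *+ _]mulr_natl mulrA ler_piMl ?mulr_ge0//.
rewrite ler_pdivrMr// mul1r -natrX ler_nat.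
rewrite (leq_trans (max_card _))// card_ffun !card_ord//.
Qed.

Lemma Eg_cycle_test_sqr_le M :
  Eg (fun y => cycle_test M y ^+ 2) <= \sum_(2 <= m < M) (2 * m.+1%:R)^-1.
Proof.
have gc m m' : good (fun y => cycle_sum m y * cycle_sum m' y).
  by apply: goodM; exact: good_cycle_sum.
have -> : (fun y => cycle_test M y ^+ 2) =
    (fun y => \sum_(2 <= m < M) \sum_(2 <= m' < M)
      ((2 * m.+1%:R)^-1 * (2 * m'.+1%:R)^-1) * (cycle_sum m y * cycle_sum m' y)).
  apply/funext => y; rewrite expr2 /cycle_test big_distrlr/=.
  by apply: eq_bigr => m _; apply: eq_bigr => m' _; rewrite mulrACA.
rewrite (Eg_sum s0 gdist gind); last by move=> m; apply: good_sum => m'; exact: goodZ.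
rewrite big_nat_cond [leRHS]big_nat_cond; apply: ler_sum => m /andP[/andP[m2 mM] _].
rewrite (Eg_sum s0 gdist gind); last by move=> m'; exact: goodZ.
rewrite (bigD1_seq m) ?mem_index_iota ?m2 ?iota_uniq//= big_nat_cond big1 ?addr0;
  last first.
  move=> m' /andP[/andP[m2' _] mm']; rewrite (EgZ s0 gdist gind)//.
  by rewrite Eg_cycle_sumM_neq ?mulr0// eq_sym.
rewrite (EgZ s0 gdist gind)//.
have c0 : 0 < 2 * m.+1%:R :> R by rewrite mulr_gt0// ltr0n.
rewrite -mulrA ler_piMr ?invr_ge0 ?(ltW c0)//.
by rewrite mulrC ler_pdivrMr// mul1r Eg_cycle_sum_sqr_le.
Qed.

(** The terms with m from 2 to M.-1 are the cycles of length 3 to M. *)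
Lemma variance_ge M (u : R) : 1 <= u -> u ^+ 32 = N%:R ->
  \sum_(2 <= m < M) ((2 * m.+1%:R)^-1 - m.+1%:R / N%:R - 3 * ((2 * m.+1) ^ m)%:R / u) <=
  Eg (fun y => F y ^+ 2) - Eg F ^+ 2.
Proof.
move=> u1 uN; have u0 : 0 < u by exact: lt_le_trans u1.
apply: le_trans (variance_test_function s0 gdist gind gF (good_cycle_test M)
  (Eg_cycle_test M)).
apply: le_trans (lerB (lexx _) (Eg_cycle_test_sqr_le M)).
have -> : (fun y => F y * cycle_test M y) =
    (fun y => \sum_(2 <= m < M) (2 * m.+1%:R)^-1 * (F y * cycle_sum m y)).
  by apply/funext => y; rewrite /cycle_test mulr_sumr; apply: eq_bigr => m _;
    rewrite mulrCA.
have gc m : good (fun y => F y * cycle_sum m y) by apply: goodM => //;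
  exact: good_cycle_sum.
rewrite (Eg_sum s0 gdist gind); last by move=> m; exact: goodZ.
rewrite mulr_sumr -sumrB big_nat_cond [leRHS]big_nat_cond.
apply: ler_sum => m /andP[/andP[m2 _] _].
rewrite (EgZ s0 gdist gind)//.
have := Eg_free_energy_cycle_sum_ge m2 u1 uN.
move: (Eg _) => E; set t := ((2 * m.+1) ^ m)%:R; set k := m.+1%:R => h.
have k1 : 1 <= k by rewrite /k ler1n.
have k0 : 0 < k by exact: lt_le_trans k1.
have -> : 2 * ((2 * k)^-1 * E) - (2 * k)^-1 = k^-1 * E - k^-1 / 2 by field; rewrite gt_eqF.
have h2 : k^-1 * (1 - k ^+ 2 / N%:R - 3 * t / u) <= k^-1 * E by rewrite ler_pM2l// invr_gt0.
have e : k^-1 * (1 - k ^+ 2 / N%:R - 3 * t / u) = k^-1 - k / N%:R - k^-1 * (3 * t / u).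
  by field; rewrite !gt_eqF.
have e' : (2 * k)^-1 = k^-1 / 2 by field; rewrite gt_eqF.
have t3 : k^-1 * (3 * t / u) <= 3 * t / u.
  by rewrite ler_piMl ?invf_le1// divr_ge0 ?mulr_ge0 ?(ltW u0).
move: h2 t3; rewrite e e'.
move: (k^-1 * (3 * t / u)) (3 * t / u) (k^-1 * E) (k / N%:R) (k^-1) => a b c c' c'' h2 h3.
by lra.
Qed.

End variance_lower_bound.

(** * Disorder as an independent family over the edges *)

Section transfer.
Context {R : realType} d (T : measurableType d) (P : probability T R).

Lemma variance_sample (I : finType) (s : R) (g : I -> {RV P >-> R})
    (f : (I -> R) -> R) : 0 < s ->
  (forall i (A : set R), measurable A ->
     distribution P (g i) A = normal_prob 0 s A) ->
  mutually_independent [set: I]%SET g -> good f ->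
  ('V_P[fun w => f (sample g w)] =
   (Eg g (fun y => f y ^+ 2) - Eg g f ^+ 2)%:E)%E.
Proof.
move=> s0 gdist gind gf.
have EE h : good h -> ('E_P[fun w => h (sample g w)] = (Eg g h)%:E)%E.
  move=> gh; rewrite unlock /Eg /Rintegral fineK//.
  by apply: integrable_fin_num => //; exact: (good_integrable s0 gdist gind gh).
rewrite /variance unlock (EE f gf)/=.
have gh : good (fun y => (f y - Eg g f) * (f y - Eg g f)).
  by apply: goodM; apply: goodB => //; exact: good_cst.
transitivity ('E_P[fun w => ((f (sample g w) - Eg g f) * (f (sample g w) - Eg g f))%R])%E.
  by [].
rewrite (EE _ gh); congr EFin; set m := Eg g f.
have -> : (fun y => (f y - m) * (f y - m)) = (fun y => f y ^+ 2 - 2 * m * f y + m ^+ 2).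
  by apply/funext => y; ring.
have g2 : good (fun y => f y ^+ 2) by exact: goodX.
have g3 : good (fun y => 2 * m * f y) by exact: goodZ.
have g4 : good (fun y => f y ^+ 2 - 2 * m * f y) by exact: goodB.
have g5 : good (fun y : I -> R => m ^+ 2) by exact: good_cst.
rewrite (EgD s0 gdist gind g4 g5) Eg_cst (EgB s0 gdist gind g2 g3) (EgZ s0 gdist gind _
  gf) -/m.
by ring.
Qed.

Lemma variance_shift (I : finType) (s : R) (g : I -> {RV P >-> R})
    (f : (I -> R) -> R) (c : R) : 0 < s ->
  (forall i (A : set R), measurable A ->
     distribution P (g i) A = normal_prob 0 s A) ->
  mutually_independent [set: I]%SET g -> good f ->
  Eg g (fun y => (c + f y) ^+ 2) - Eg g (fun y => c + f y) ^+ 2 =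
  Eg g (fun y => f y ^+ 2) - Eg g f ^+ 2.
Proof.
move=> s0 gdist gind gf; set m := Eg g f.
have -> : (fun y => (c + f y) ^+ 2) = (fun y => f y ^+ 2 + (c ^+ 2 + 2 * c * f y)).
  by apply/funext => y; ring.
have g2 : good (fun y => f y ^+ 2) by exact: goodX.
have g3 : good (fun y => 2 * c * f y) by exact: goodZ.
have g5 a : good (fun y : I -> R => a) by exact: good_cst.
have g4 : good (fun y => c ^+ 2 + 2 * c * f y) by exact: goodD.
rewrite (EgD s0 gdist gind g2 g4) (EgD s0 gdist gind (g5 _) g3) (EgD s0 gdist gind (g5
  c) gf).
by rewrite !Eg_cst (EgZ s0 gdist gind _ gf) -/m; ring.
Qed.

Variables (N : nat) (g : 'I_N -> 'I_N -> {RV P >-> R}).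
Hypothesis gsk : sk_disorder g.
Hypothesis N1 : (1 < N)%N.
Variable e0 : edge N.

Definition edge_disorder (e : edge N) : {RV P >-> R} := g (val e).1 (val e).2.

Lemma edge_disorder_normal e (A : set R) : measurable A ->
  distribution P (edge_disorder e) A = normal_prob 0 (Num.sqrt N%:R^-1) A.
Proof. by move=> mA; apply: gsk.1 => //; exact: (valP e). Qed.

(** A family indexed by edges is transported to one indexed by pairs of
    vertices; insubd extends the events by a default edge outside the range. *)
Lemma edge_disorder_indep : mutually_independent [set: edge N]%SET edge_disorder.
Proof.
move=> J A _ mA.
have := gsk.2 (val @: J)%SET (fun p => A (insubd e0 p)).
have sub : (val @: J)%SET \subset [set p : 'I_N * 'I_N | (p.1 < p.2)%N]%SET.
  by apply/fintype.subsetP => _ /imsetP[e _ ->]; rewrite inE; exact: (valP e).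
move=> /(_ sub); have mA' p : p \in (val @: J)%SET -> measurable (A (insubd e0 p)).
  by move=> /imsetP[e eJ ->]; rewrite valKd; exact: mA.
move=> /(_ mA').
have -> : \bigcap_(i in [set` (val @: J)%SET]) (g i.1 i.2 @^-1` A (insubd e0 i)) =
    \bigcap_(e in [set` J]) (edge_disorder e @^-1` A e).
  apply/seteqP; split=> w h e /=.
    by move=> eJ; have := h (val e); rewrite /= imset_f// valKd; exact.
  by move=> /imsetP[f fJ ->]; rewrite valKd; exact: h.
move=> ->; rewrite big_imset/=; last by move=> e f _ _; exact: val_inj.
by apply: eq_bigr => e _; rewrite valKd.
Qed.

Lemma sk_free_energyE w :
  sk_free_energy (fun i j => g i j w) 1 =
  - ln (2 ^+ N) + free_energy (@edge_spin R N) (sample edge_disorder w).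
Proof.
have Z0 := partition_sum_gt0 (@edge_spin R N) [ffun=> false] (sample edge_disorder w).
rewrite /sk_free_energy -lnV ?posrE ?exprn_gt0// -lnM ?posrE ?invr_gt0 ?exprn_gt0//.
congr ln; rewrite /sk_partition; congr (_ * _); apply: eq_bigr => x _.
rewrite !mul1r; congr expR; rewrite /sk_hamiltonian /energy pair_big_dep/=.
rewrite (reindex (val : edge N -> _))/=; last first.
  exists (insubd e0) => [e _|p pP]; first by rewrite valKd.
  by rewrite insubdK.
apply: eq_big => [e|e _]; first by rewrite (valP e).
rewrite /edge_spin /sample /edge_disorder; ring.
Qed.

Lemma sk_variance_ge M (u : R) : 1 <= u -> u ^+ 32 = N%:R ->
  ((\sum_(2 <= m < M)
     ((2 * m.+1%:R)^-1 - m.+1%:R / N%:R - 3 * ((2 * m.+1) ^ m)%:R / u))%:E <=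
  'V_P[fun w => sk_free_energy (fun i j => g i j w) 1])%E.
Proof.
move=> u1 uN.
have s0 : 0 < Num.sqrt N%:R^-1 :> R by rewrite sqrtr_gt0 invr_gt0 ltr0n ltnW.
have sN : Num.sqrt N%:R^-1 ^+ 2 = N%:R^-1 :> R by rewrite sqr_sqrtr ?invr_ge0.
have gF : good (free_energy (@edge_spin R N)).
  exact: (good_free_energy [ffun=> false] (@edge_spin_sqr R N)).
have gcF : good (fun y => - ln (2 ^+ N) + free_energy (@edge_spin R N) y).
  by apply: goodD => //; exact: good_cst.
have -> : (fun w => sk_free_energy (fun i j => g i j w) 1) =
   (fun w => - ln (2 ^+ N) + free_energy (@edge_spin R N) (sample edge_disorder w)).
  by apply/funext => w; exact: sk_free_energyE.
rewrite (variance_sample s0 edge_disorder_normal edge_disorder_indep gcF).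
rewrite (variance_shift _ s0 edge_disorder_normal edge_disorder_indep gF) lee_fin.
exact: (variance_ge e0 N1 s0 sN edge_disorder_normal edge_disorder_indep).
Qed.

End transfer.

(** * Asymptotics in the number of spins *)

Section asymptotics.
Context {R : realType}.

(** The losses of variance_ge, for u = N^(1/32) and M = loglog_floor R N. *)
Definition sk_error (N : nat) : R :=
  \sum_(2 <= m < loglog_floor R N)
    (m.+1%:R / N%:R + 3 * ((2 * m.+1) ^ m)%:R / expR (ln N%:R / 32)).

(** Since (M/3)^3 <= expR M <= ln N, one has M^2 cutoff <= M^3 <= 27 ln N as soon
    as M is at least cutoff; 64 * 81 then gives 3 M^2 <= (ln N) / 64. *)
Definition cutoff : R := 64 * 81.

Definition sk_error_bound : R := 4 * expR (3 * cutoff ^+ 2).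

Lemma sk_error_bound_gt0 : 0 < sk_error_bound.
Proof. by rewrite mulr_gt0// expR_gt0. Qed.

Let K := sk_error_bound.

Lemma sk_error_ge0 N : 0 <= sk_error N.
Proof.
by apply: sumr_ge0 => m _; rewrite addr_ge0// ?divr_ge0// ?expR_ge0.
Qed.

(** The number of monomials is at most (2M)^M with M <= ln (ln N), which grows
    more slowly than any positive power of N. Half of the available power
    N^(-1/32) absorbs it. *)
Lemma sk_error_le N : (0 < N)%N -> sk_error N <= K * expR (- (ln N%:R / 64)).
Proof.
move=> N0; rewrite /sk_error; set M := loglog_floor R N; set L : R := ln N%:R.
have L0 : 0 <= L by rewrite ln_ge0// ler1n.
have N0' : 0 < N%:R :> R by rewrite ltr0n.
have [->|M0] := posnP M.
  by rewrite big_geq// mulr_ge0 ?expR_ge0// mulr_ge0// expR_ge0.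
(* The floor is positive only when ln (ln N) is at least 1. *)
have l1 : 1 <= ln L by rewrite -truncn_gt0.
have Ml : M%:R <= ln L by rewrite truncn_le (le_trans ler01).
clearbody M.
have Lgt0 : 0 < L.
  rewrite lt_neqAle L0 andbT; apply: contraTneq l1 => <-.
  by rewrite ln0// ler10.
have ML : expR M%:R <= L by rewrite -[leRHS]lnK ?posrE// ler_expR.
have M1 : 1 <= M%:R :> R by rewrite ler1n.
have MM : M%:R <= M%:R ^+ 2 :> R by rewrite expr2 ler_peMl// (le_trans ler01).
have M2 : 0 <= M%:R ^+ 2 :> R by exact: sqr_ge0.
set u := expR (L / 32).
have u0 : 0 < u by exact: expR_gt0.
have uN : u <= N%:R.
  by rewrite -[leRHS]lnK ?posrE// ler_expR -/L; lra.
have pow2 : (2 * M%:R) ^+ M <= expR (2 * M%:R ^+ 2) :> R.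
  have -> : 2 * M%:R ^+ 2 = M%:R * (2 * M%:R) :> R by ring.
  rewrite expRM_natl lerXn2r ?nnegrE ?mulr_ge0 ?expR_ge0//.
  by have := expR_ge1Dx (2 * M%:R : R); lra.
have term m : (0 < m < M)%N -> m.+1%:R / N%:R + 3 * ((2 * m.+1) ^ m)%:R / u <=
    4 * expR (2 * M%:R ^+ 2) / u.
  move=> /andP[m0 mM].
  have h1 : ((2 * m.+1) ^ m)%:R <= expR (2 * M%:R ^+ 2) :> R.
    apply: le_trans pow2; rewrite -natrM -natrX ler_nat.
    apply: (@leq_trans ((2 * M) ^ m)%N); first by rewrite leq_exp2r// leq_mul2l.
    by rewrite leq_pexp2l ?muln_gt0// ltnW.
  have h2 : m.+1%:R / N%:R <= expR (2 * M%:R ^+ 2) / u.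
    apply: ler_pM; rewrite ?invr_ge0//.
      apply: (@le_trans _ _ M%:R); first by rewrite ler_nat.
      apply: le_trans MM _; have := expR_ge1Dx (2 * M%:R ^+ 2 : R).
      by move: M2; move: (M%:R ^+ 2) => a; lra.
    by rewrite lef_pV2.
  have h3 : ((2 * m.+1) ^ m)%:R / u <= expR (2 * M%:R ^+ 2) / u.
    by rewrite ler_pM2r ?invr_gt0.
  rewrite -[3 * _ / u]mulrA -[4 * _ / u]mulrA.
  by move: h2 h3; lra.
apply: (@le_trans _ _ (\sum_(2 <= m < M) 4 * expR (2 * M%:R ^+ 2) / u)).
  rewrite big_nat_cond [leRHS]big_nat_cond; apply: ler_sum => m /andP[/andP[m2 mM] _].
  by apply: term; rewrite mM (ltn_trans _ m2).
rewrite sumr_const_nat -[_ *+ (M - 2)]mulr_natl.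
have Mle : (M - 2)%:R <= expR (M%:R ^+ 2) :> R.
  apply: (@le_trans _ _ M%:R); first by rewrite ler_nat leq_subr.
  have := expR_ge1Dx (M%:R ^+ 2 : R).
  by apply: le_trans; apply: le_trans MM _; rewrite lerDr.
have expo : M%:R ^+ 2 + 2 * M%:R ^+ 2 <= 3 * cutoff ^+ 2 + L / 64 :> R.
  have M3 : (M%:R / 3) ^+ 3 <= L.
    apply: le_trans ML.
    have M3E : M%:R = 3%:R * (M%:R / 3) :> R by field.
    rewrite [in leRHS]M3E expRM_natl lerXn2r ?nnegrE ?divr_ge0 ?expR_ge0//.
    by have := expR_ge1Dx (M%:R / 3 : R); lra.
  move: M1 M3; move: (M%:R : R) => x x1.
  have -> : (x / 3) ^+ 3 = x ^+ 2 * x / 27 by field.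
  move=> x3; have x2 : 0 <= x ^+ 2 by exact: sqr_ge0.
  have [xs|xb] := lerP x cutoff.
    have x0 : 0 <= x by lra.
    have : x ^+ 2 <= cutoff ^+ 2.
      by rewrite lerXn2r// nnegrE// (le_trans x0).
    have : 0 <= x ^+ 2 * x by rewrite mulr_ge0.
    move: x2 x3; move: (x ^+ 2 * x) (x ^+ 2) (cutoff ^+ 2) => a b c; lra.
  have : x ^+ 2 * cutoff <= x ^+ 2 * x by rewrite ler_wpM2l// ltW.
  have -> : x ^+ 2 * cutoff = 64 * 81 * x ^+ 2 by rewrite /cutoff mulrC.
  have : 0 <= cutoff ^+ 2 by exact: sqr_ge0.
  move: x2 x3; move: (x ^+ 2 * x) (x ^+ 2) (cutoff ^+ 2) => a b c; lra.
have -> : 4 * expR (2 * M%:R ^+ 2) / u = expR (2 * M%:R ^+ 2) * (4 / u) by ring.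
rewrite mulrA.
apply: (@le_trans _ _ (expR (3 * cutoff ^+ 2 + L / 64) * (4 / u))).
  rewrite ler_wpM2r ?divr_ge0 ?(ltW u0)//.
  apply: (@le_trans _ _ (expR (M%:R ^+ 2) * expR (2 * M%:R ^+ 2))).
    by rewrite ler_wpM2r ?expR_ge0.
  by rewrite -expRD ler_expR.
rewrite /u -expRN mulrCA -expRD /K /sk_error_bound -mulrA ler_pM2l// -expRD ler_expR.
lra.
Qed.

Lemma sk_error_cvg0 : sk_error @ \oo --> (0 : R).
Proof.
apply/cvgrPdist_le => e e0.
have K0 : 0 < K := sk_error_bound_gt0.
near=> N.
rewrite sub0r normrN ger0_norm ?sk_error_ge0//.
have N0 : (0 < N)%N by near: N; exact: nbhs_infty_gt.
apply: le_trans (sk_error_le N0) _.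
rewrite -ler_pdivlMl// [K^-1 * e]mulrC -[leRHS]lnK ?posrE ?divr_gt0// ler_expR.
have : expR (- (64 * ln (e / K))) <= N%:R by near: N; exact: nbhs_infty_ger.
rewrite -ler_ln ?posrE ?expR_gt0 ?ltr0n// expRK; lra.
Unshelve. all: by end_near. Qed.

Lemma sk_error_bounded N : (0 < N)%N -> sk_error N <= K.
Proof.
move=> N0; apply: le_trans (sk_error_le N0) _.
rewrite ler_piMr ?(ltW sk_error_bound_gt0)// -[leRHS]expR0 ler_expR oppr_le0 divr_ge0//.
by rewrite ln_ge0// ler1n.
Qed.

Lemma harmonic_ge_ln M : ln M.+1%:R - ln 3 <= \sum_(3 <= k < M.+1) k%:R^-1 :> R.
Proof.
have [M2|M2] := leqP M.+1 3.
  by rewrite big_geq// subr_le0 ler_ln ?posrE ?ltr0n// ler_nat.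
elim: M M2 => // M IHM M2.
have M0 : 0 < M.+1%:R :> R by rewrite ltr0n.
have step : ln M.+2%:R <= ln M.+1%:R + M.+1%:R^-1 :> R.
  rewrite -lerBlDl -ln_div ?posrE ?ltr0n//.
  have -> : M.+2%:R / M.+1%:R = 1 + M.+1%:R^-1 :> R.
    by rewrite -natr1 mulrDl mul1r divff ?gt_eqF.
  by apply: le_ln1Dx; rewrite (lt_trans (ltrN10 R))// invr_gt0.
have [M2'|M2'] := leqP M.+1 3.
  have ME : M.+1 = 3%N by apply/eqP; rewrite eqn_leq M2'.
  by rewrite big_ltn// big_geq ?ME// addr0; move: step; rewrite ME; lra.
rewrite big_nat_recr//=.
move: (IHM M2') step; move: (ln M.+1%:R) (ln M.+2%:R) (ln 3) (M.+1%:R^-1) (\sum_(_ <=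
  _ < _) _) => a b c e f; lra.
Qed.

Lemma ln_loglog_le N : ln (ln (ln (N%:R : R))) <= ln (loglog_floor R N).+1%:R.
Proof.
have [l0|l0] := lerP (ln (ln (N%:R : R))) 0.
  by rewrite ln0// ln_ge0// ler1n.
by rewrite ler_ln ?posrE ?ltr0n// ltW// truncnS_gt.
Qed.

Lemma sk_variance_ge_loglog (N : nat) (d : measure_display) (T : measurableType d)
    (P : probability T R) (g : 'I_N -> 'I_N -> {RV P >-> R}) :
  (3 <= N)%N -> sk_disorder g ->
  ((2^-1 * \sum_(3 <= k < (loglog_floor R N).+1) k%:R^-1 - sk_error N)%:E
    <= 'V_P[fun w => sk_free_energy (fun i j => g i j w) 1])%E.
Proof.
move=> N3 gsk; have N1 : (1 < N)%N by exact: leq_trans N3.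
have N0 : (0 < N)%N by exact: leq_trans N3.
pose e0 : edge N := exist _ (Ordinal N0, Ordinal N1) isT.
pose u : R := expR (ln N%:R / 32).
have u1 : 1 <= u by rewrite -[leLHS]expR0 ler_expR divr_ge0// ln_ge0// ler1n.
have uN : u ^+ 32 = N%:R.
  by rewrite /u -expRM_natl mulrCA divff ?mulr1 ?lnK ?posrE ?ltr0n// pnatr_eq0.
apply: le_trans (sk_variance_ge gsk N1 e0 (loglog_floor R N) u1 uN).
rewrite lee_fin le_eqVlt; apply/orP; left; apply/eqP.
rewrite big_add1/= mulr_sumr /sk_error -sumrB; apply: eq_bigr => m _.
by rewrite -/u invfM; ring.
Qed.

End asymptotics.

Theorem theorem2 (R : realType) :
  (exists eps : nat -> R,
    eps @ \oo --> (0 : R) /\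
    forall N : nat, (3 <= N)%N ->
    forall (d : measure_display) (T : measurableType d) (P : probability T R)
      (g : 'I_N -> 'I_N -> {RV P >-> R}),
    sk_disorder g ->
    ((2^-1 * \sum_(3 <= k < (loglog_floor R N).+1) k%:R^-1 - eps N)%:E
      <= 'V_P[fun w => sk_free_energy (fun i j => g i j w) 1])%E) /\
  (exists C : R, 0 < C /\
    forall N : nat, (3 <= N)%N ->
    forall (d : measure_display) (T : measurableType d) (P : probability T R)
      (g : 'I_N -> 'I_N -> {RV P >-> R}),
    sk_disorder g ->
    ((2^-1 * ln (ln (ln N%:R)) - C)%:E
      <= 'V_P[fun w => sk_free_energy (fun i j => g i j w) 1])%E).
Proof.
split.
  exists (@sk_error R); split; first exact: sk_error_cvg0.
  by move=> N N3 d T P g gsk; exact: sk_variance_ge_loglog.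
exists (2^-1 * ln 3 + sk_error_bound); split.
  by rewrite ltr_wpDl ?sk_error_bound_gt0// mulr_ge0// ln_ge0// ler1n.
move=> N N3 d T P g gsk.
apply: le_trans (sk_variance_ge_loglog N3 gsk); rewrite lee_fin.
have N0 : (0 < N)%N by exact: leq_trans N3.
have := sk_error_bounded (R := R) N0.
have := harmonic_ge_ln (R := R) (loglog_floor R N); have := ln_loglog_le (R := R) N.
move: (sk_error N) (\sum_(3 <= k < _) _) (ln _.+1%:R) (ln (ln _)) sk_error_bound =>
  a b c e K.
lra.
Qed.
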